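(* Consider the piecewise-smooth system $$(\dot x,\dot y)^\top=\begin{cases}(X^+(x,y),Y^+(x,y))^\top & \text{if } y>0,\\ (X^-(x,y),Y^-(x,y))^\top & \text{if } y<0,\end{cases}$$ with $X^\pm,Y^\pm$ real analytic, having a monodromic singular point at the origin $O$ around which orbits rotate counterclockwise. Suppose that $O$ is a weak focus of order $\varsigma^+\in\mathbb N\cup\{+\infty\}$ of the upper subsystem. When $O$ is a weak focus of order $\varsigma^-\in\mathbb N\cup\{+\infty\}$ of the lower subsystem, the order $\varsigma$ of the monodromic singular point $O$ (of FF type) of the piecewise-smooth system satisfies: (a) $\varsigma=0$ if $\varsigma^+=0$ and $\varsigma^-\in\mathbb Z^+\cup\{+\infty\}$, and likewise if $\varsigma^-=0$ and $\varsigma^+\in\mathbb Z^+\cup\{+\infty\}$; (b) $\varsigma\in\left(\bigcup_{i=0}^{m-1}\left\{\frac{2i+1}2\right\}\right)\cup\{m\}$ if $\varsigma^\pm\in\mathbb Z^+\cup\{+\infty\}$ and $\varsigma^+\ne\varsigma^-$, where $m:=\min\{\varsigma^+,\varsigma^-\}$; (c) $\varsigma\in\left(\bigcup_{i=0}^{\varsigma^+-1}\left\{\frac{2i+1}2\right\}\right)\cup\left(\bigcup_{i=2\varsigma^+}^{+\infty}\left\{\frac i2\right\}\right)$ if $\varsigma^\pm\in\mathbb Z^+\cup\{+\infty\}$ and $\varsigma^+=\varsigma^-$. When $O$ is an invisible tangent point of the lower subsystem, the order $\varsigma$ of the monodromic singular point $O$ (of FP type) of the piecewise-smooth system satisfies: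 (d) $\varsigma=0$ if $\varsigma^+=0$; (e) $\varsigma\in\left(\bigcup_{i=0}^{\varsigma^+-1}\left\{\frac{2i+1}2\right\}\right)\cup\{\varsigma^+\}$ if $\varsigma^+\in\mathbb Z^+\cup\{+\infty\}$.
   Context: $\mathbb N$ includes $0$; $\mathbb Z^+$ is the set of positive integers. Monodromic singular point: no orbit approaches $O$ in a definite direction as $t\to\pm\infty$. For small $x>0$ (resp. small $x<0$), $\Pi^+(x)$ (resp. $\Pi^-(x)$) is the $x$-coordinate of the first intersection point between the orbit passing through $(x,0)$, which enters $y>0$ (resp. $y<0$), and the switching line $y=0$. The displacement map is $\Delta(x)=(\Pi^-)^{-1}(x)-\Pi^+(x)=\sum_{k\ge1}V_kx^k$ for small $x>0$; $V_k$ is the $k$-th Lyapunov constant. The monodromic singular point $O$ has order $\varsigma\in\{i/2: i\in\mathbb N\}$ if $V_1=\cdots=V_{2\varsigma}=0$ and $V_{2\varsigma+1}\neq0$, and order $+\infty$ if all $V_k=0$. Order $0$ corresponds to a rough focus and order $+\infty$ to a center. A union $\bigcup_{i=a}^{+\infty}\{i/2\}$ is understood to include the value $+\infty$ (order of a center); for $a=+\infty$ it equals $\{+\infty\}$, and $\bigcup_{i=0}^{+\infty-1}\{\frac{2i+1}{2}\}$ contains all positive half-odd-integers. Weak focus of order $\varsigma^\pm$ of a subsystem: $O$ is an equilibrium of the analytic subsystem with linear part having eigenvalues $\alpha\pm\beta i$, $\beta\neq0$ (order $0$, i.e. $\alpha\ne0$, is allowed). To define its order, extend the analytic subsystem to a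 whole neighborhood of $O$, regard it as a piecewise-smooth system with two identical subsystems, and let $V_k$ be the Lyapunov constants of $O$ for that system, i.e. the coefficients of its displacement map $\Delta(x)=(\Pi^-)^{-1}(x)-\Pi^+(x)=\sum_{k\ge1}V_kx^k$; the order is the number $s\in\{i/2: i\in\mathbb N\}$ with $V_1=\cdots=V_{2s}=0$ and $V_{2s+1}\neq0$, and it is $+\infty$ if all these $V_k=0$ (this order is always an integer or $+\infty$). Invisible tangent point of the lower subsystem: for some integer $\ell\ge1$, $X^-(0,0)\ne0$, $\partial_x^jY^-(0,0)=0$ for $0\le j\le2\ell-2$, and $X^-(0,0)\,\partial_x^{2\ell-1}Y^-(0,0)>0$. FF type: both subsystems have a focus (complex non-real eigenvalues) at $O$; FP type: the upper subsystem has a focus and the lower one an invisible tangent point at $O$. *)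

(* Defs.v *)
From Stdlib Require Import Reals.
From Coquelicot Require Export Coquelicot.

Open Scope R_scope.

Record vector_field := VectorField { vX : R -> R -> R; vY : R -> R -> R }.

(* [f] is, near the origin, the sum of an absolutely convergent double power
   series [sum a i j x^i y^j], summed by total degree.  Nothing is required of
   [f] away from the origin. *)
Definition analytic_at_O (f : R -> R -> R) : Prop :=
  exists (a : nat -> nat -> R) (r : R), 0 < r /\
    forall x y, Rabs x < r -> Rabs y < r ->
      ex_series (fun n => sum_n (fun i => Rabs (a i (n - i)%nat * x ^ i * y ^ (n - i))) n) /\
      is_series (fun n => sum_n (fun i => a i (n - i)%nat * x ^ i * y ^ (n - i)) n) (f x y).

Definition analytic_field (F : vector_field) : Prop :=
  analytic_at_O (vX F) /\ analytic_at_O (vY F).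

(* [Fp] governs y > 0 and [Fm] governs y < 0.  On the switching line the
   convention is Filippov's: any convex combination of the two fields. *)
Definition velocity (Fp Fm : vector_field) (x y a b : R) : Prop :=
  (0 < y /\ a = vX Fp x y /\ b = vY Fp x y) \/
  (y < 0 /\ a = vX Fm x y /\ b = vY Fm x y) \/
  (y = 0 /\ exists l, 0 <= l <= 1 /\
     a = l * vX Fp x y + (1 - l) * vX Fm x y /\
     b = l * vY Fp x y + (1 - l) * vY Fm x y).

Definition right_derivative (u : R -> R) (t a : R) : Prop :=
  filterlim (fun h => (u (t + h) - u t) / h) (at_right 0) (locally a).

Definition left_derivative (u : R -> R) (t a : R) : Prop :=
  filterlim (fun h => (u (t + h) - u t) / h) (at_left 0) (locally a).

(* [I] is meant to be an open interval of times.  Where v <> 0 the two one-sided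
   velocities agree, so there [(u, v)] solves the corresponding subsystem; where
   v = 0 it may cross the switching line or slide along it. *)
Definition solution_on (Fp Fm : vector_field) (I : R -> Prop) (u v : R -> R) : Prop :=
  forall t, I t ->
    (exists a b, velocity Fp Fm (u t) (v t) a b /\
       right_derivative u t a /\ right_derivative v t b) /\
    (exists a b, velocity Fp Fm (u t) (v t) a b /\
       left_derivative u t a /\ left_derivative v t b).

Definition in_time_domain (infty : Rbar) (t0 t : R) : Prop :=
  match infty with
  | p_infty => t0 < t
  | m_infty => t < t0
  | Finite _ => False
  end.

(* For [infty] equal to [p_infty] or [m_infty]: some orbit tends to O as
   t -> infty, its polar direction having a limit [(c, s)]. *)
Definition orbit_approaches_O_in_definite_direction
    (Fp Fm : vector_field) (infty : Rbar) : Prop :=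
  exists (t0 : R) (u v : R -> R) (c s : R),
    solution_on Fp Fm (in_time_domain infty t0) u v /\
    (forall t, in_time_domain infty t0 t -> (u t, v t) <> (0, 0)) /\
    is_lim u infty 0 /\ is_lim v infty 0 /\
    is_lim (fun t => u t / sqrt (u t ^ 2 + v t ^ 2)) infty c /\
    is_lim (fun t => v t / sqrt (u t ^ 2 + v t ^ 2)) infty s.

Definition monodromic_singular_point (Fp Fm : vector_field) : Prop :=
  velocity Fp Fm 0 0 0 0 /\
  ~ orbit_approaches_O_in_definite_direction Fp Fm p_infty /\
  ~ orbit_approaches_O_in_definite_direction Fp Fm m_infty.

(* The orbit of [F] through [(x, 0)] enters the open half-plane [side] and first
   meets the line y = 0 again at [(x1, 0)]. *)
Definition half_return (side : R -> Prop) (F : vector_field) (x x1 : R) : Prop :=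
  exists (T : R) (u v : R -> R),
    0 < T /\
    (forall t, 0 <= t <= T ->
       is_derive u t (vX F (u t) (v t)) /\ is_derive v t (vY F (u t) (v t))) /\
    u 0 = x /\ v 0 = 0 /\
    (forall t, 0 < t < T -> side (v t)) /\
    u T = x1 /\ v T = 0.

(* Graphs of the maps Pi^+ and Pi^-. *)
Definition Pi_plus (Fp : vector_field) (x x1 : R) : Prop :=
  half_return (fun y => 0 < y) Fp x x1.

Definition Pi_minus (Fm : vector_field) (x x1 : R) : Prop :=
  half_return (fun y => y < 0) Fm x x1.

Definition rotates_counterclockwise (Fp Fm : vector_field) : Prop :=
  exists d, 0 < d /\
    (forall x, 0 < x < d -> exists x1, x1 < 0 /\ Pi_plus Fp x x1) /\
    (forall x, - d < x < 0 -> exists x1, 0 < x1 /\ Pi_minus Fm x x1).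

(* Graph of Delta = (Pi^-)^{-1} - Pi^+. *)
Definition displacement (Fp Fm : vector_field) (x d : R) : Prop :=
  exists x0 x1, x0 < 0 /\ Pi_minus Fm x0 x /\ Pi_plus Fp x x1 /\ d = x0 - x1.

(* [V k] is V_k for k >= 1; [V 0] is irrelevant. *)
Definition lyapunov_constants (Fp Fm : vector_field) (V : nat -> R) : Prop :=
  exists r, 0 < r /\ forall x, 0 < x < r ->
    exists d, displacement Fp Fm x d /\ is_series (fun k => V (S k) * x ^ S k) d.

(* Orders live in {i/2 : i in nat} together with +oo. *)
Definition has_order (Fp Fm : vector_field) (s : Rbar) : Prop :=
  exists V, lyapunov_constants Fp Fm V /\
    ((exists i : nat, s = Finite (INR i / 2) /\
        (forall k : nat, (1 <= k <= i)%nat -> V k = 0) /\ V (S i) <> 0) \/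
     (s = p_infty /\ forall k : nat, (1 <= k)%nat -> V k = 0)).

Definition eigenvalue (a b c d : R) (z : C) : Prop :=
  exists p q : C, (p, q) <> (RtoC 0, RtoC 0) /\
    (a * p + b * q = z * p)%C /\ (c * p + d * q = z * q)%C.

Definition is_focus (F : vector_field) : Prop :=
  vX F 0 0 = 0 /\ vY F 0 0 = 0 /\
  exists alpha beta : R, beta <> 0 /\
    let J := eigenvalue (Derive (fun x => vX F x 0) 0) (Derive (fun y => vX F 0 y) 0)
                        (Derive (fun x => vY F x 0) 0) (Derive (fun y => vY F 0 y) 0) in
    J (alpha, beta) /\ J (alpha, - beta).

Definition weak_focus_of_order (F : vector_field) (s : Rbar) : Prop :=
  is_focus F /\ has_order F F s.

Definition invisible_tangent_point_of_lower (F : vector_field) : Prop :=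
  exists l : nat, (1 <= l)%nat /\
    vX F 0 0 <> 0 /\
    (forall j : nat, (j <= 2 * l - 2)%nat -> Derive_n (fun x => vY F x 0) j 0 = 0) /\
    0 < vX F 0 0 * Derive_n (fun x => vY F x 0) (2 * l - 1) 0.

Definition nat_or_infty (s : Rbar) : Prop :=
  (exists n : nat, s = Finite (INR n)) \/ s = p_infty.

Definition posint_or_infty (s : Rbar) : Prop :=
  (exists n : nat, (1 <= n)%nat /\ s = Finite (INR n)) \/ s = p_infty.

(* The union of {(2i+1)/2} for i = 0, ..., m - 1, all i being allowed when m = +oo. *)
Definition odd_halves_below (m s : Rbar) : Prop :=
  exists i : nat, Rbar_le (INR i) (Rbar_minus m 1) /\ s = Finite ((2 * INR i + 1) / 2).

(* The union of {i/2} for i >= a, which by convention includes +oo. *)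
Definition halves_from (a s : Rbar) : Prop :=
  (exists i : nat, Rbar_le a (INR i) /\ s = Finite (INR i / 2)) \/ s = p_infty.

(* Main.v *)
Require Import Defs.
From Stdlib Require Import Reals Lra Lia Psatz List Factorial.

(** The hypotheses supply all the orbits, and the order of O depends only on the jets of the half-return
    maps; so every estimate below concerns an arbitrary orbit with a small endpoint on the switching line.

    Jets at a focus.  In polar coordinates in which the radius [r] may be negative while the angle stays
    in [[0, PI]], the upper and the lower half-plane are described by the same equations
    [r' = r * (P th + O(r))], [th' = Q th + O(r)] with [Q > 0].  A formal first integral
    [I = r * c1 th + r ^ 2 * c2 th + ...] with [I = r] at [th = 0] is found by solving one scalar linear
    equation per coefficient ([angular_first_integral]).  Comparing [I] at both ends of a half-turn
    ([half_arc]) shows that [q y = I (- y) PI], truncated at any order, is the jet of the inverse of the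
    half-return map, simultaneously for [Pi_plus] at [0+] and for [Pi_minus] at [0-]
    ([focus_half_return_jet]).  This two-sidedness is what analyticity at a focus contributes.

    Comparison of constants.  Let [q1], [q2] be these jets for the upper and the lower focus, and let
    [V1], [V2], [V] be the [k]-th constants of the upper subsystem, of the lower one and of the piecewise
    system, all earlier ones being zero.  The displacement maps say, modulo [x ^ (k + 1)], that
    [q1 (q1 x - V1 x^k)], [q2 (q2 x - V2 x^k)] and [q1 (q2 x - V x^k)] all equal [x].  For [k = 1] these
    are three equations between the slopes.  For [k > 1] both slopes are [-1], the polynomial
    [e = q2 - q1] has order at least [k], and substituting [q2 x = - x + ...] into it multiplies its [k]-th
    coefficient by [(-1) ^ k]; for odd [k] this gives [2 V = V1 + V2] ([mean_of_constants]).  As long as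
    [V1] and [V2] vanish, the first nonzero constant [V k] can thus only have an even index; and if exactly
    one of [V1], [V2] stops vanishing at an index, which is odd, then [V] does so there at the latest.  The
    lists of orders follow ([orders_classified]).

    Tangency.  Near an invisible tangent point the flow is a flow box, with a first integral
    [y + ...] known up to any order ([flow_box_integral]).  Its restriction [g] to the switching line
    behaves like [- gamma x ^ (2 l)], and the two ends of an arc have the same value of [g].  Therefore
    the jet [psi] of the inverse of [Pi_minus] satisfies [psi (psi x) = x] ([fold_potential_reflects]),
    as if the lower subsystem were a center, and the comparison above applies with [V2 = 0]. *)

(** * Polynomials and flatness at 0+ *)

(** The radii of validity of the estimates are nested minima; this makes their bounds available to linear
    arithmetic. *)
Ltac min_bounds :=
  repeat match goal with
  | H : context [Rmin ?a ?b] |- _ =>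
      lazymatch goal with
      | _ : Rmin a b <= a |- _ => fail
      | _ => pose proof (Rmin_l a b); pose proof (Rmin_r a b)
      end
  end.

Ltac triangle := eapply Rle_trans; [apply Rabs_triang|].

Fixpoint peval (l : list R) (x : R) : R :=
  match l with
  | nil => 0
  | c :: l' => c + x * peval l' x
  end.

(** Polynomials are treated as functions: their composition is then the composition of functions, and a
    one-sided estimate at [0+] carries over to the other side through [poly_bigO_factor]. *)
Definition polynomial (f : R -> R) : Prop := exists l, forall x, f x = peval l x.

Lemma poly_ext f g : (forall x, f x = g x) -> polynomial f -> polynomial g.
Proof. intros E [l H]; exists l; intros x; now rewrite <- E. Qed.

Lemma poly_const c : polynomial (fun _ => c).
Proof. exists (c :: nil); intros x; simpl; ring. Qed.

Lemma poly_id : polynomial (fun x => x).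
Proof. exists (0 :: 1 :: nil); intros x; simpl; ring. Qed.

Lemma poly_cons c f : polynomial f -> polynomial (fun x => c + x * f x).
Proof. intros [l H]; exists (c :: l); intros x; simpl; now rewrite H. Qed.

Lemma poly_plus f g : polynomial f -> polynomial g -> polynomial (fun x => f x + g x).
Proof.
  intros [l H] Hg; revert f g H Hg; induction l as [|c l IH]; intros f g H Hg.
  - apply (poly_ext g); [|exact Hg]. intros x; rewrite H; simpl; ring.
  - destruct Hg as [[|c' l'] Hg].
    + exists (c :: l). intros x; rewrite H, Hg; simpl; ring.
    + apply (poly_ext (fun x => (c + c') + x * (peval l x + peval l' x))).
      * intros x; rewrite H, Hg; simpl; ring.
      * apply poly_cons, (IH (peval l)); [reflexivity|]. now exists l'.
Qed.

Lemma poly_scal c f : polynomial f -> polynomial (fun x => c * f x).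
Proof.
  intros [l H]; exists (map (Rmult c) l); intros x; rewrite H; clear H.
  induction l as [|a l IH]; simpl; [ring|]. rewrite <- IH; ring.
Qed.

Lemma poly_mult f g : polynomial f -> polynomial g -> polynomial (fun x => f x * g x).
Proof.
  intros [l H] Hg. revert f H; induction l as [|c l IH]; intros f H.
  - apply (poly_ext (fun _ => 0)); [|apply poly_const]. intros x; rewrite H; simpl; ring.
  - apply (poly_ext (fun x => c * g x + (0 + x * (peval l x * g x)))).
    + intros x; rewrite H; simpl; ring.
    + apply poly_plus; [now apply poly_scal|].
      apply poly_cons. now apply IH.
Qed.

Lemma poly_comp f g : polynomial f -> polynomial g -> polynomial (fun x => f (g x)).
Proof.
  intros [l H] Hg. apply (poly_ext (fun x => peval l (g x))); [intros x; now rewrite H|].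
  clear f H. induction l as [|c l IH]; simpl; [apply poly_const|].
  apply poly_plus; [apply poly_const|]. now apply poly_mult.
Qed.

Lemma poly_pow n : polynomial (fun x => x ^ n).
Proof.
  induction n as [|n IH]; simpl; [apply poly_const|]. apply poly_mult; [apply poly_id|exact IH].
Qed.

Lemma poly_split f : polynomial f -> exists g, polynomial g /\ forall x, f x = f 0 + x * g x.
Proof.
  intros [[|c l] H].
  - exists (fun _ => 0); split; [apply poly_const|]. intros x; rewrite !H; simpl; ring.
  - exists (peval l); split; [now exists l|]. intros x; rewrite !H; simpl; ring.
Qed.

Lemma poly_bounded f : polynomial f -> exists B, 0 <= B /\ forall x, Rabs x <= 1 -> Rabs (f x) <= B.
Proof.
  intros [l H]; revert f H; induction l as [|c l IH]; intros f H.
  - exists 0; split; [lra|]. intros x _; rewrite H; simpl; rewrite Rabs_R0; lra.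
  - destruct (IH (peval l)) as [B [HB HB']]; [reflexivity|].
    exists (Rabs c + B); split; [pose proof (Rabs_pos c); lra|].
    intros x Hx; rewrite H; simpl. triangle.
    rewrite Rabs_mult. specialize (HB' x Hx).
    pose proof (Rabs_pos x); pose proof (Rabs_pos (peval l x)). nra.
Qed.

Lemma poly_lipschitz f : polynomial f -> exists L, 0 <= L /\
  forall x y, Rabs x <= 1 -> Rabs y <= 1 -> Rabs (f x - f y) <= L * Rabs (x - y).
Proof.
  intros [l H]; revert f H; induction l as [|c l IH]; intros f H.
  - exists 0; split; [lra|]. intros x y _ _; rewrite !H; simpl.
    rewrite Rminus_diag, Rabs_R0; lra.
  - destruct (IH (peval l)) as [L [HL HL']]; [reflexivity|].
    destruct (poly_bounded (peval l)) as [B [HB HB']]; [now exists l|].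
    exists (L + B); split; [lra|].
    intros x y Hx Hy; rewrite !H; simpl.
    replace (c + x * peval l x - (c + y * peval l y))
      with (x * (peval l x - peval l y) + (x - y) * peval l y) by ring.
    triangle. rewrite !Rabs_mult.
    specialize (HL' x y Hx Hy). specialize (HB' y Hy).
    pose proof (Rabs_pos x); pose proof (Rabs_pos (x - y)); pose proof (Rabs_pos (peval l x - peval l y)).
    nra.
Qed.

(** Flatness at [0+] only: displacement maps live on [x > 0]. *)
Definition bigO (n : nat) (f : R -> R) : Prop :=
  exists C d, 0 <= C /\ 0 < d /\ d <= 1 /\ forall x, 0 < x < d -> Rabs (f x) <= C * x ^ n.

Lemma bigO_intro n f C d : 0 < d -> (forall x, 0 < x < d -> Rabs (f x) <= C * x ^ n) -> bigO n f.
Proof.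
  intros Hd H. exists (Rabs C), (Rmin d 1). split; [apply Rabs_pos|].
  split; [apply Rmin_glb_lt; lra|]. split; [apply Rmin_r|].
  intros x [Hx Hx']. eapply Rle_trans; [apply H; split; [lra|]|].
  - eapply Rlt_le_trans; [exact Hx'|apply Rmin_l].
  - apply Rmult_le_compat_r; [apply pow_le; lra|apply Rle_abs].
Qed.

Lemma bigO_ext n f g : (forall x, f x = g x) -> bigO n f -> bigO n g.
Proof.
  intros E (C & d & HC & Hd & Hd' & H); exists C, d; repeat split; try assumption.
  intros x Hx; rewrite <- E; auto.
Qed.

Lemma bigO_plus n f g : bigO n f -> bigO n g -> bigO n (fun x => f x + g x).
Proof.
  intros (C & d & HC & Hd & _ & H) (C' & d' & HC' & Hd' & _ & H').
  apply (bigO_intro _ _ (C + C') (Rmin d d')); [now apply Rmin_glb_lt|].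
  intros x [Hx Hx']. triangle.
  min_bounds.
  rewrite Rmult_plus_distr_r. apply Rplus_le_compat; [apply H|apply H']; lra.
Qed.

Lemma bigO_scal n c f : bigO n f -> bigO n (fun x => c * f x).
Proof.
  intros (C & d & HC & Hd & _ & H). apply (bigO_intro _ _ (Rabs c * C) d Hd).
  intros x Hx; rewrite Rabs_mult, Rmult_assoc. apply Rmult_le_compat_l; [apply Rabs_pos|auto].
Qed.

Lemma bigO_minus n f g : bigO n f -> bigO n g -> bigO n (fun x => f x - g x).
Proof.
  intros Hf Hg. apply (bigO_ext _ (fun x => f x + (-1) * g x)); [intros; ring|].
  apply bigO_plus; [assumption|now apply bigO_scal].
Qed.

Lemma bigO_mult n m f g : bigO n f -> bigO m g -> bigO (n + m) (fun x => f x * g x).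
Proof.
  intros (C & d & HC & Hd & _ & H) (C' & d' & HC' & Hd' & _ & H').
  apply (bigO_intro _ _ (C * C') (Rmin d d')); [now apply Rmin_glb_lt|].
  intros x [Hx Hx']. pose proof (Rmin_l d d'); pose proof (Rmin_r d d').
  rewrite Rabs_mult, pow_add.
  replace (C * C' * (x ^ n * x ^ m)) with ((C * x ^ n) * (C' * x ^ m)) by ring.
  apply Rmult_le_compat; try apply Rabs_pos; [apply H|apply H']; lra.
Qed.

Lemma bigO_pow n : bigO n (fun x => x ^ n).
Proof.
  apply (bigO_intro _ _ 1 1); [lra|]. intros x Hx.
  rewrite Rabs_pos_eq; [lra|apply pow_le; lra].
Qed.

Lemma bigO_weaken n m f : (m <= n)%nat -> bigO n f -> bigO m f.
Proof.
  intros Hm (C & d & HC & Hd & Hd1 & H). apply (bigO_intro _ _ C d Hd).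
  intros x Hx. eapply Rle_trans; [now apply H|]. apply Rmult_le_compat_l; [assumption|].
  replace n with (m + (n - m))%nat by lia. rewrite pow_add.
  assert (Hp : 0 <= x ^ m) by (apply pow_le; lra).
  assert (Hq : x ^ (n - m) <= 1 ^ (n - m)) by (apply pow_incr; lra).
  rewrite pow1 in Hq. nra.
Qed.

Lemma bigO_poly f : polynomial f -> bigO 0 f.
Proof.
  intros Hf; destruct (poly_bounded f Hf) as [B [HB HB']].
  apply (bigO_intro _ _ B 1); [lra|]. intros x Hx. simpl; rewrite Rmult_1_r.
  apply HB'. rewrite Rabs_pos_eq; lra.
Qed.

Lemma bigO_pow_poly n f : polynomial f -> bigO n (fun x => x ^ n * f x).
Proof.
  intros Hf. pose proof (bigO_mult n 0 _ _ (bigO_pow n) (bigO_poly f Hf)) as H.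
  now rewrite Nat.add_0_r in H.
Qed.

Lemma bigO_small f : bigO 1 f -> forall e, 0 < e ->
  exists d, 0 < d /\ forall x, 0 < x < d -> Rabs (f x) < e.
Proof.
  intros (C & d & HC & Hd & _ & H) e He. exists (Rmin d (e / (C + 1))).
  assert (0 < e / (C + 1)) by (apply Rdiv_lt_0_compat; lra).
  split; [now apply Rmin_glb_lt|]. intros x [Hx Hx'].
  min_bounds.
  eapply Rle_lt_trans; [apply H; lra|]. simpl; rewrite Rmult_1_r.
  assert (x * (C + 1) < e).
  { replace e with (e / (C + 1) * (C + 1)) by (field; lra). apply Rmult_lt_compat_r; lra. }
  nra.
Qed.

Lemma bigO_monomial n c : bigO (S n) (fun x => c * x ^ n) -> c = 0.
Proof.
  intros (C & d & HC & Hd & Hd1 & H). destruct (Req_dec c 0) as [|Hc]; [assumption|exfalso].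
  assert (Ha : 0 < Rabs c) by now apply Rabs_pos_lt.
  set (x := Rmin (d / 2) (Rabs c / (2 * (C + 1)))).
  assert (Hq : 0 < Rabs c / (2 * (C + 1))) by (apply Rdiv_lt_0_compat; lra).
  assert (Hx : 0 < x) by (apply Rmin_glb_lt; lra).
  assert (Hx1 : x <= d / 2) by apply Rmin_l.
  assert (Hx2 : x <= Rabs c / (2 * (C + 1))) by apply Rmin_r.
  specialize (H x ltac:(lra)). rewrite Rabs_mult, (Rabs_pos_eq (x ^ n)) in H by (apply pow_le; lra).
  simpl in H. assert (Hp : 0 < x ^ n) by now apply pow_lt.
  assert (Rabs c <= C * x).
  { apply Rmult_le_reg_r with (x ^ n); [assumption|]. lra. }
  assert (x * (C + 1) <= Rabs c / 2).
  { replace (Rabs c / 2) with (Rabs c / (2 * (C + 1)) * (C + 1)) by (field; lra).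
    apply Rmult_le_compat_r; lra. }
  nra.
Qed.

(** An estimate for small positive [x] forces the low coefficients to vanish, and so holds for negative [x]
    as well. *)
Lemma poly_bigO_factor n f : polynomial f -> bigO n f ->
  exists g, polynomial g /\ forall x, f x = x ^ n * g x.
Proof.
  revert f; induction n as [|n IH]; intros f Hf HO.
  - exists f; split; [assumption|]. intros x; simpl; ring.
  - destruct (poly_split f Hf) as [g [Hg E]].
    assert (H0 : f 0 = 0).
    { apply (bigO_monomial 0).
      apply (bigO_ext _ (fun x => f x - x * g x)); [intros x; rewrite (E x); simpl; ring|].
      apply bigO_minus; [apply (bigO_weaken (S n)); [lia|assumption]|].
      apply (bigO_ext _ (fun x => x ^ 1 * g x)); [intros; simpl; ring|].
      apply (bigO_mult 1 0); [apply bigO_pow|now apply bigO_poly]. }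
    destruct (IH g Hg) as [g' [Hg' E']].
    { destruct HO as (C & d & HC & Hd & Hd1 & H). apply (bigO_intro _ _ C d Hd).
      intros x Hx. apply Rmult_le_reg_l with x; [lra|].
      specialize (H x Hx). rewrite (E x), H0, Rplus_0_l, Rabs_mult, (Rabs_pos_eq x) in H by lra.
      simpl in H; lra. }
    exists g'; split; [assumption|]. intros x; rewrite E, H0, E'; simpl; ring.
Qed.

(** * Relations between the first odd constants *)

(** The form of the jet of a half-return map: it reverses the half-axes, whence the sign of the slope. *)
Definition tangent_to_line (lam : R) (q : R -> R) : Prop :=
  exists p, polynomial p /\ forall x, q x = - lam * x + x ^ 2 * p x.

Lemma tangent_poly lam q : tangent_to_line lam q -> polynomial q.
Proof.
  intros [p [Hp E]]. apply (poly_ext (fun x => - lam * x + x ^ 2 * p x)); [intros; now rewrite E|].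
  apply poly_plus; [apply poly_scal, poly_id|]. apply poly_mult; [apply poly_pow|assumption].
Qed.

(** The quadratic remainder is controlled by the size of the points, so perturbing the argument by
    [O(x ^ n)] changes [q] by its slope times the perturbation, up to one more order. *)
Lemma tangent_linearization lam q : tangent_to_line lam q ->
  exists C, 0 <= C /\ forall a b, Rabs a <= 1 -> Rabs b <= 1 ->
    Rabs (q b - q a + lam * (b - a)) <= C * (Rabs a + Rabs b) * Rabs (b - a).
Proof.
  intros [p [Hp E]].
  destruct (poly_bounded p Hp) as [B [HB HB']].
  destruct (poly_lipschitz p Hp) as [L [HL HL']].
  exists (B + L); split; [lra|]. intros a b Ha Hb. rewrite !E.
  replace (- lam * b + b ^ 2 * p b - (- lam * a + a ^ 2 * p a) + lam * (b - a))
    with ((a + b) * (b - a) * p b + a * a * (p b - p a)) by ring.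
  triangle. rewrite !Rabs_mult.
  specialize (HB' b Hb). specialize (HL' b a Hb Ha).
  pose proof (Rabs_triang a b) as Ht.
  pose proof (Rabs_pos a) as P1; pose proof (Rabs_pos b) as P2; pose proof (Rabs_pos (b - a)) as P3.
  pose proof (Rabs_pos (p b)) as P4.
  pose proof (Rabs_pos (a + b)) as P5.
  pose proof (Rabs_pos (p b - p a)) as P6.
  set (A := Rabs a) in *; set (D := Rabs (b - a)) in *; set (B0 := Rabs b) in *.
  assert (Rabs (a + b) * D * Rabs (p b) <= (A + B0) * D * B).
  { apply Rmult_le_compat; try assumption; [now apply Rmult_le_pos|].
    apply Rmult_le_compat_r; assumption. }
  assert (A * A * Rabs (p b - p a) <= A * (L * D)).
  { apply Rmult_le_compat; try assumption; nra. }
  assert (A * (L * D) <= (A + B0) * D * L).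
  { replace (A * (L * D)) with (A * (D * L)) by ring. rewrite Rmult_assoc.
    apply Rmult_le_compat_r; [now apply Rmult_le_pos|lra]. }
  lra.
Qed.

Lemma tangent_local_injectivity lam q : 0 < lam -> tangent_to_line lam q ->
  exists e, 0 < e /\ forall a b, Rabs a < e -> Rabs b < e -> lam / 2 * Rabs (b - a) <= Rabs (q b - q a).
Proof.
  intros Hlam T. destruct (tangent_linearization lam q T) as (C & HC & HL).
  exists (Rmin 1 (lam / (4 * (C + 1)))).
  split; [apply Rmin_glb_lt; [lra|apply Rdiv_lt_0_compat; lra]|]. intros a b Ha Hb.
  pose proof (Rmin_l 1 (lam / (4 * (C + 1)))) as M1; pose proof (Rmin_r 1 (lam / (4 * (C + 1)))) as M2.
  specialize (HL a b ltac:(lra) ltac:(lra)). set (D := b - a) in *.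
  assert (Hs : C * (Rabs a + Rabs b) <= lam / 2).
  { apply Rle_trans with ((C + 1) * (2 * (lam / (4 * (C + 1))))).
    - apply Rmult_le_compat; try lra. pose proof (Rabs_pos a); pose proof (Rabs_pos b); lra.
    - apply Req_le; field; lra. }
  assert (HD : lam * Rabs D <= Rabs (q b - q a + lam * D) + Rabs (q b - q a)).
  { rewrite <- (Rabs_pos_eq lam) at 1 by lra. rewrite <- Rabs_mult.
    replace (lam * D) with ((q b - q a + lam * D) - (q b - q a)) at 1 by ring.
    triangle. rewrite Rabs_Ropp; lra. }
  pose proof (Rabs_pos D). nra.
Qed.

Lemma tangent_leading lam q : tangent_to_line lam q -> bigO 2 (fun x => q x + lam * x).
Proof.
  intros [p [Hp E]]. apply (bigO_ext _ (fun x => x ^ 2 * p x)); [intros; rewrite E; ring|].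
  apply (bigO_mult 2 0); [apply bigO_pow|now apply bigO_poly].
Qed.

Lemma bigO_1_of_leading lam f : bigO 2 (fun x => f x + lam * x) -> bigO 1 f.
Proof.
  intros H. apply (bigO_ext _ (fun x => (f x + lam * x) - lam * x ^ 1)); [intros; simpl; ring|].
  apply bigO_minus; [now apply (bigO_weaken 2); [lia|]|]. apply bigO_scal, bigO_pow.
Qed.

Lemma tangent_substitution lam q n f g : tangent_to_line lam q ->
  bigO 1 f -> bigO 1 g -> bigO n (fun x => g x - f x) ->
  bigO (S n) (fun x => q (g x) - q (f x) + lam * (g x - f x)).
Proof.
  intros Hq Hf Hg Hfg. destruct (tangent_linearization lam q Hq) as [C [HC H]].
  destruct (bigO_small f Hf 1 ltac:(lra)) as [d1 [Hd1 H1]].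
  destruct (bigO_small g Hg 1 ltac:(lra)) as [d2 [Hd2 H2]].
  destruct Hf as (A & d3 & HA & Hd3 & _ & H3).
  destruct Hg as (B & d4 & HB & Hd4 & _ & H4).
  destruct Hfg as (D & d5 & HD & Hd5 & _ & H5).
  set (d := Rmin (Rmin d1 d2) (Rmin d3 (Rmin d4 d5))).
  apply (bigO_intro _ _ (C * (A + B) * D) d); [unfold d; repeat apply Rmin_glb_lt; assumption|].
  intros x [Hx Hx']. unfold d in Hx'. min_bounds.
  eapply Rle_trans; [apply H; apply Rlt_le; [apply H1|apply H2]; lra|].
  specialize (H3 x ltac:(lra)); specialize (H4 x ltac:(lra)); specialize (H5 x ltac:(lra)).
  simpl in H3, H4. rewrite Rmult_1_r in H3, H4.
  replace (C * (A + B) * D * x ^ S n) with (C * (A * x + B * x) * (D * x ^ n)) by (simpl; ring).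
  pose proof (Rabs_pos (f x)); pose proof (Rabs_pos (g x)).
  apply Rmult_le_compat; try apply Rabs_pos; try assumption.
  - apply Rmult_le_pos; lra.
  - apply Rmult_le_compat_l; lra.
Qed.

(** Moves a constant out of the argument of [q], where it enters linearly. *)
Lemma tangent_perturbed lam q n f V : tangent_to_line lam q -> bigO 1 f -> (1 <= n)%nat ->
  bigO (S n) (fun x => q (f x - V * x ^ n) - x) ->
  bigO (S n) (fun x => q (f x) - x + lam * V * x ^ n).
Proof.
  intros Hq Hf Hn H.
  assert (HV : bigO n (fun x => V * x ^ n)) by apply bigO_scal, bigO_pow.
  assert (Hg : bigO 1 (fun x => f x - V * x ^ n)) by (apply bigO_minus; [|apply (bigO_weaken n)]; assumption).
  pose proof (tangent_substitution lam q n _ _ Hq Hg Hf) as S.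
  apply (bigO_ext _ (fun x => (q (f x) - q (f x - V * x ^ n) + lam * (f x - (f x - V * x ^ n)))
    + (q (f x - V * x ^ n) - x))); [intros; ring|].
  apply bigO_plus; [|assumption]. apply S.
  apply (bigO_ext _ (fun x => V * x ^ n)); [intros; ring|assumption].
Qed.

Lemma tangent_comp_leading l1 l2 q1 q2 : tangent_to_line l1 q1 -> tangent_to_line l2 q2 ->
  bigO 2 (fun x => q1 (q2 x) - l1 * l2 * x).
Proof.
  intros H1 H2.
  pose proof (tangent_leading _ _ H2) as L2.
  pose proof (bigO_1_of_leading _ _ L2) as B2.
  pose proof (tangent_substitution l1 q1 1 (fun _ => 0) q2 H1) as S.
  assert (E0 : q1 0 = 0) by (destruct H1 as [p [_ E]]; rewrite E; ring).
  apply (bigO_ext _ (fun x => (q1 (q2 x) - q1 0 + l1 * (q2 x - 0)) - l1 * (q2 x + l2 * x))).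
  { intros x; rewrite E0; ring. }
  apply bigO_minus; [|now apply bigO_scal]. apply S; try assumption.
  - apply (bigO_ext _ (fun x => 0 * x ^ 1)); [intros; ring|apply bigO_scal, bigO_pow].
  - apply (bigO_ext _ q2); [intros; ring|assumption].
Qed.

(** The coefficient of [x] in the displacement identity for [k = 1]. *)
Lemma product_of_slopes l1 l2 q1 q2 V : tangent_to_line l1 q1 -> tangent_to_line l2 q2 ->
  bigO 2 (fun x => q1 (q2 x - V * x ^ 1) - x) -> l1 * (l2 + V) = 1.
Proof.
  intros H1 H2 H.
  pose proof (bigO_1_of_leading _ _ (tangent_leading _ _ H2)) as B2.
  pose proof (tangent_perturbed l1 q1 1 q2 V H1 B2 ltac:(lia) H) as P.
  pose proof (tangent_comp_leading l1 l2 q1 q2 H1 H2) as Q.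
  cut (l1 * (l2 + V) - 1 = 0); [lra|]. apply (bigO_monomial 1).
  apply (bigO_ext _ (fun x => (q1 (q2 x) - x + l1 * V * x ^ 1) - (q1 (q2 x) - l1 * l2 * x)));
    [intros; simpl; ring|]. now apply bigO_minus.
Qed.

(** A vanishing first constant makes [q] an involution at first order, and the slope is negative. *)
Lemma involution_slope l q n V : (2 <= n)%nat -> 0 < l -> tangent_to_line l q ->
  bigO (S n) (fun x => q (q x - V * x ^ n) - x) -> l = 1.
Proof.
  intros Hn Hl Hq H.
  pose proof (bigO_1_of_leading _ _ (tangent_leading _ _ Hq)) as B2.
  pose proof (tangent_perturbed l q n q V Hq B2 ltac:(lia) H) as P.
  pose proof (tangent_comp_leading l l q q Hq Hq) as Q.
  assert (E : l * l - 1 = 0).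
  { apply (bigO_monomial 1).
    apply (bigO_ext _ (fun x => (q (q x) - x + l * V * x ^ n) - (q (q x) - l * l * x) - l * V * x ^ n));
      [intros; simpl; ring|].
    apply bigO_minus; [apply bigO_minus; [|assumption]|].
    - apply (bigO_weaken (S n)); [lia|assumption].
    - apply bigO_scal, (bigO_weaken n); [lia|apply bigO_pow]. }
  nra.
Qed.

(** The parity argument: the difference [e] of the two jets is [E0 * x ^ n + ...] by local injectivity, and
    [V - V1 = E0] by comparing [q1 (q2 x)] with [q1 (q1 x)].  Comparing [q2 (q2 x)] with [q1 (q2 x)] means
    evaluating [e] at [q2 x = - x + ...], so [V2 - V = E0] when [n] is odd. *)
Lemma mean_of_constants n q1 q2 V1 V2 V : (3 <= n)%nat -> Nat.Odd n ->
  tangent_to_line 1 q1 -> tangent_to_line 1 q2 ->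
  bigO (S n) (fun x => q1 (q1 x - V1 * x ^ n) - x) ->
  bigO (S n) (fun x => q2 (q2 x - V2 * x ^ n) - x) ->
  bigO (S n) (fun x => q1 (q2 x - V * x ^ n) - x) ->
  2 * V = V1 + V2.
Proof.
  intros Hn Hodd T1 T2 H11 H22 H12.
  pose proof (bigO_1_of_leading _ _ (tangent_leading _ _ T1)) as B1.
  pose proof (bigO_1_of_leading _ _ (tangent_leading _ _ T2)) as B2.
  apply (tangent_perturbed 1 q1 n q1 V1 T1 B1 ltac:(lia)) in H11.
  apply (tangent_perturbed 1 q2 n q2 V2 T2 B2 ltac:(lia)) in H22.
  apply (tangent_perturbed 1 q1 n q2 V T1 B2 ltac:(lia)) in H12.
  set (e := fun x => q2 x - q1 x).
  assert (Pe : polynomial e).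
  { apply (poly_ext (fun x => q2 x + -1 * q1 x)); [intros; unfold e; ring|].
    apply poly_plus; [|apply poly_scal]; eapply tangent_poly; eassumption. }
  assert (D : bigO n (fun x => q1 (q2 x) - q1 (q1 x))).
  { apply (bigO_ext _ (fun x => (q1 (q2 x) - x + 1 * V * x ^ n) - (q1 (q1 x) - x + 1 * V1 * x ^ n)
      + (V1 - V) * x ^ n)); [intros; ring|].
    apply bigO_plus; [apply (bigO_weaken (S n)); [lia|now apply bigO_minus]|apply bigO_scal, bigO_pow]. }
  (* q1 has an invertible linear part, so e inherits the flatness of q1 (q2 x) - q1 (q1 x). *)
  assert (Oe : bigO n e).
  { destruct (tangent_local_injectivity 1 q1 ltac:(lra) T1) as (r & Hr & Hinj).
    destruct (bigO_small q1 B1 r Hr) as [d1 [Hd1 H1]].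
    destruct (bigO_small q2 B2 r Hr) as [d2 [Hd2 H2]].
    destruct D as (A & d3 & HA & Hd3 & _ & H3).
    apply (bigO_intro _ _ (2 * A) (Rmin (Rmin d1 d2) d3)); [repeat apply Rmin_glb_lt; assumption|].
    intros x [Hx Hx'].
    min_bounds.
    specialize (Hinj (q1 x) (q2 x) ltac:(apply H1; lra) ltac:(apply H2; lra)).
    specialize (H3 x ltac:(lra)). unfold e. lra. }
  destruct (poly_bigO_factor n e Pe Oe) as [E [PE HE]].
  destruct (poly_split E PE) as [E' [PE' HE']].
  set (E0 := E 0) in *.
  assert (OE : bigO (S n) (fun x => e x - E0 * x ^ n)).
  { apply (bigO_ext _ (fun x => x ^ S n * E' x)).
    - intros x; rewrite HE, HE'; simpl; ring.
    - now apply bigO_pow_poly. }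
  assert (K1 : V - V1 - E0 = 0).
  { apply (bigO_monomial n).
    pose proof (tangent_substitution 1 q1 n q1 q2 T1 B1 B2 Oe) as S.
    apply (bigO_ext _ (fun x => (q1 (q2 x) - x + 1 * V * x ^ n) - (q1 (q1 x) - x + 1 * V1 * x ^ n)
      - (q1 (q2 x) - q1 (q1 x) + 1 * (q2 x - q1 x)) + (e x - E0 * x ^ n))).
    { intros; unfold e; ring. }
    apply bigO_plus; [apply bigO_minus; [now apply bigO_minus|assumption]|assumption]. }
  (* For odd n the substitution x -> q2 x = - x + ... changes the sign of the leading term of e. *)
  assert (K2 : V2 - V - E0 = 0).
  { apply (bigO_monomial n).
    assert (Oc : bigO (S n) (fun x => e (q2 x) + E0 * x ^ n)).
    { destruct T2 as [p2 [Pp2 Ep2]].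
      (* q2 x = x * s x with s 0 = - 1 *)
      set (s := fun x => -1 + x * p2 x).
      assert (Ps : polynomial s) by now apply poly_cons.
      assert (Pw : polynomial (fun x => s x ^ n * E (q2 x))).
      { apply poly_mult; [apply (poly_comp (fun z => z ^ n) s); [apply poly_pow|assumption]|].
        apply poly_comp; [assumption|]. apply (tangent_poly 1). now exists p2. }
      destruct (poly_split _ Pw) as [w [Hw Ew]].
      assert (q2 0 = 0) as Z by (rewrite Ep2; ring).
      assert (s 0 ^ n = -1) as Sn.
      { unfold s. replace (-1 + 0 * p2 0) with (-1) by ring.
        destruct Hodd as [j ->]. rewrite Nat.add_1_r. apply pow_1_odd. }
      apply (bigO_ext _ (fun x => x ^ S n * w x)).
      - intros x. rewrite HE.
        replace (q2 x ^ n) with (x ^ n * s x ^ n).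
        2:{ rewrite <- Rpow_mult_distr. f_equal. rewrite Ep2; unfold s; ring. }
        specialize (Ew x); cbv beta in Ew. rewrite Rmult_assoc, Ew, Z, Sn. fold E0. simpl; ring.
      - now apply bigO_pow_poly. }
    apply (bigO_ext _ (fun x => (q2 (q2 x) - x + 1 * V2 * x ^ n) - (q1 (q2 x) - x + 1 * V * x ^ n)
      - (e (q2 x) + E0 * x ^ n))).
    { intros; unfold e; ring. }
    apply bigO_minus; [now apply bigO_minus|assumption]. }
  lra.
Qed.

(** What the equations for [k = 1] and for odd [k > 1] have in common. *)
Definition odd_constants_linked (V1 V2 V : R) : Prop :=
  (V1 = 0 -> V2 = 0 -> V = 0) /\ (V = 0 -> (V1 = 0 <-> V2 = 0)).

Lemma first_odd_constants n q1 q2 l1 l2 V1 V2 V : Nat.Odd n ->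
  0 < l1 -> 0 < l2 -> tangent_to_line l1 q1 -> tangent_to_line l2 q2 ->
  bigO (S n) (fun x => q1 (q1 x - V1 * x ^ n) - x) ->
  bigO (S n) (fun x => q2 (q2 x - V2 * x ^ n) - x) ->
  bigO (S n) (fun x => q1 (q2 x - V * x ^ n) - x) ->
  odd_constants_linked V1 V2 V.
Proof.
  intros Hodd Hl1 Hl2 T1 T2 H11 H22 H12.
  destruct (Nat.eq_dec n 1) as [->|Hn].
  - apply (product_of_slopes l1 l1) in H11; try assumption.
    apply (product_of_slopes l2 l2) in H22; try assumption.
    apply (product_of_slopes l1 l2) in H12; try assumption.
    split.
    + intros -> ->. assert (l1 = 1) by nra. assert (l2 = 1) by nra. subst; lra.
    + intros ->; split; intros ->.
      * assert (l1 = 1) by nra. assert (l2 = 1) by nra. subst; lra.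
      * assert (l2 = 1) by nra. assert (l1 = 1) by nra. subst; lra.
  - assert (3 <= n)%nat by (destruct Hodd; lia).
    rewrite (involution_slope l1 q1 n V1 ltac:(lia) Hl1 T1 H11) in T1.
    rewrite (involution_slope l2 q2 n V2 ltac:(lia) Hl2 T2 H22) in T2.
    pose proof (mean_of_constants n q1 q2 V1 V2 V H Hodd T1 T2 H11 H22 H12).
    split; [|intros; split]; intros; lra.
Qed.

(** * Taylor expansions of the fields and of the displacement map *)

(** A geometric factor in the terms comes out of the remainder. *)
Lemma series_tail (b A : nat -> R) (l th : R) (N : nat) :
  ex_series A -> (forall n, 0 <= A n) -> 0 <= th <= 1 ->
  (forall n, Rabs (b n) <= A n * th ^ n) -> is_series b l ->
  Rabs (l - sum_n b N) <= Series A * th ^ S N.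
Proof.
  intros HA HA0 Hth Hb Hl.
  assert (Hp : forall n, 0 <= th ^ n) by (intros n; apply pow_le; lra).
  assert (Hp1 : forall n, th ^ n <= 1).
  { intros n. rewrite <- (pow1 n). apply pow_incr; lra. }
  assert (E : l - sum_n b N = Series (fun k => b (S N + k)%nat)).
  { rewrite <- (is_series_unique _ _ Hl), (Series_incr_n b (S N)); [|lia|now exists l].
    rewrite sum_n_Reals; simpl Init.Nat.pred; ring. }
  rewrite E.
  assert (HA' : ex_series (fun k => A (S N + k)%nat)) by now apply (ex_series_incr_n A (S N)).
  assert (Hc : forall k, 0 <= Rabs (b (S N + k)%nat) <= th ^ S N * A (S N + k)%nat).
  { intros k; split; [apply Rabs_pos|]. eapply Rle_trans; [apply Hb|].
    rewrite pow_add. replace (A (S N + k)%nat * (th ^ S N * th ^ k))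
      with (th ^ S N * A (S N + k)%nat * th ^ k) by ring.
    rewrite <- (Rmult_1_r (th ^ S N * A (S N + k)%nat)) at 2.
    apply Rmult_le_compat_l; [apply Rmult_le_pos; [apply Hp|apply HA0]|apply Hp1]. }
  assert (HA'' : ex_series (fun k => th ^ S N * A (S N + k)%nat)).
  { apply (ex_series_scal_l (K := R_AbsRing) (V := R_NormedModule)). exact HA'. }
  eapply Rle_trans; [apply Series_Rabs|].
  - apply (ex_series_le (K := R_AbsRing) (V := R_CompleteNormedModule) _ (fun k => th ^ S N * A (S N + k)%nat));
      [|assumption].
    intros k. unfold norm; simpl. unfold abs; simpl. rewrite Rabs_Rabsolu. apply Hc.
  - eapply Rle_trans; [apply Series_le; [exact Hc|exact HA'']|].
    rewrite Series_scal_l, Rmult_comm. apply Rmult_le_compat_r; [apply Hp|].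
    rewrite (Series_incr_n A (S N)); [|lia|assumption].
    assert (0 <= sum_f_R0 A (Init.Nat.pred (S N))) by (apply cond_pos_sum; assumption). lra.
Qed.

Lemma CV_radius_of_half_disk (a : nat -> R) (r : R) : 0 < r ->
  (forall x, 0 < x < r -> ex_series (fun n => a n * x ^ n)) ->
  forall s, Rabs s < r -> Rbar_lt (Rabs s) (CV_radius a).
Proof.
  intros Hr H s Hs. set (x := (Rabs s + r) / 2).
  pose proof (Rabs_pos s).
  apply Rbar_lt_le_trans with (Finite x); [simpl; unfold x; lra|].
  apply Rbar_not_lt_le. intros Hlt. rewrite <- (Rabs_pos_eq x) in Hlt by (unfold x; lra).
  apply (CV_disk_outside a x Hlt). apply (ex_series_lim_0 (fun n => a n * x ^ n)).
  apply H. unfold x; lra.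
Qed.

Lemma pseries_tail (a : nat -> R) (r : R) : 0 < r ->
  (forall x, 0 < x < r -> ex_series (fun n => a n * x ^ n)) ->
  forall N, exists C d, 0 < d /\ forall x l, Rabs x < d -> is_series (fun n => a n * x ^ n) l ->
    Rabs (l - sum_n (fun n => a n * x ^ n) N) <= C * Rabs x ^ S N.
Proof.
  intros Hr H N. set (s := r / 2). assert (Hs : 0 < s) by (unfold s; lra).
  set (A := fun n => Rabs (a n * s ^ n)).
  assert (HA : ex_series A).
  { apply CV_disk_inside, (CV_radius_of_half_disk a r Hr H). rewrite Rabs_pos_eq; unfold s; lra. }
  exists (Series A / s ^ S N), s; split; [assumption|]. intros x l Hx Hl.
  assert (Hsn : s ^ S N <> 0) by (apply pow_nonzero; lra).
  replace (Series A / s ^ S N * Rabs x ^ S N) with (Series A * (Rabs x / s) ^ S N).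
  2:{ unfold Rdiv; rewrite Rpow_mult_distr, pow_inv; ring. }
  apply series_tail; try assumption.
  - intros n; apply Rabs_pos.
  - split; [apply Rdiv_le_0_compat; [apply Rabs_pos|lra]|]. apply Rle_div_l; lra.
  - intros n. unfold A. rewrite !Rabs_mult, <- !RPow_abs, (Rabs_pos_eq s) by lra.
    apply Req_le. unfold Rdiv; rewrite Rpow_mult_distr, pow_inv. field. apply pow_nonzero; lra.
Qed.

(** Polynomials in two variables are lists of monomials [c * x ^ i * y ^ j], so that degrees are visible and
    differentiation and integration are maps. *)
Fixpoint meval (l : list (R * nat * nat)) (x y : R) : R :=
  match l with
  | nil => 0
  | (c, i, j) :: l' => c * x ^ i * y ^ j + meval l' x y
  end.

Definition degrees_from (m : nat) (l : list (R * nat * nat)) : Prop :=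
  Forall (fun t => (m <= snd (fst t) + snd t)%nat) l.

Lemma meval_app l l' x y : meval (l ++ l') x y = meval l x y + meval l' x y.
Proof. induction l as [|[[c i] j] l IH]; simpl; [ring|rewrite IH; ring]. Qed.

Lemma degrees_from_app m l l' : degrees_from m l -> degrees_from m l' -> degrees_from m (l ++ l').
Proof. intros H H'; apply Forall_app; now split. Qed.

Lemma meval_bound m l : degrees_from m l -> exists C, 0 <= C /\
  forall x y rho, Rabs x <= rho -> Rabs y <= rho -> rho <= 1 -> Rabs (meval l x y) <= C * rho ^ m.
Proof.
  induction l as [|[[c i] j] l IH]; intros H.
  - exists 0; split; [lra|]. intros; simpl. rewrite Rabs_R0; lra.
  - apply Forall_cons_iff in H as [Hd H]; simpl in Hd. destruct (IH H) as [C [HC HC']].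
    exists (Rabs c + C); split; [pose proof (Rabs_pos c); lra|].
    intros x y rho Hx Hy Hr; simpl. triangle.
    rewrite Rmult_plus_distr_r; apply Rplus_le_compat; [|now apply HC'].
    rewrite !Rabs_mult, <- !RPow_abs.
    assert (0 <= rho) by (pose proof (Rabs_pos x); lra).
    assert (Rabs x ^ i <= rho ^ i) by (apply pow_incr; split; [apply Rabs_pos|assumption]).
    assert (Rabs y ^ j <= rho ^ j) by (apply pow_incr; split; [apply Rabs_pos|assumption]).
    assert (0 <= Rabs x ^ i) by apply pow_le, Rabs_pos.
    assert (0 <= Rabs y ^ j) by apply pow_le, Rabs_pos.
    assert (rho ^ i * rho ^ j <= rho ^ m).
    { rewrite <- pow_add. replace (i + j)%nat with (m + (i + j - m))%nat by lia. rewrite pow_add.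
      assert (0 <= rho ^ m) by now apply pow_le.
      assert (rho ^ (i + j - m) <= 1) by (rewrite <- (pow1 (i + j - m)); apply pow_incr; lra).
      nra. }
    rewrite Rmult_assoc. apply Rmult_le_compat_l; [apply Rabs_pos|].
    eapply Rle_trans; [|eassumption]. apply Rmult_le_compat; assumption.
Qed.

Lemma homogeneous_part_meval (a : nat -> nat -> R) (n k : nat) : (k <= n)%nat ->
  exists l, degrees_from n l /\ forall x y,
    sum_n (fun i => a i (n - i)%nat * x ^ i * y ^ (n - i)) k = meval l x y.
Proof.
  induction k as [|k IH]; intros Hk.
  - exists ((a 0 (n - 0), 0, n - 0)%nat :: nil). split.
    + constructor; [simpl; lia|constructor].
    + intros x y. rewrite sum_O. simpl. ring.
  - destruct IH as [l [Hl E]]; [lia|]. exists ((a (S k) (n - S k), S k, n - S k)%nat :: l). split.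
    + constructor; [simpl; lia|assumption].
    + intros x y. rewrite sum_Sn, E. unfold plus; cbn -[pow]. ring.
Qed.

Definition expands_at_O (f : R -> R -> R) (a b : R) : Prop :=
  forall M, exists l C d,
    degrees_from 2 l /\ 0 < d /\ d <= 1 /\ 0 <= C /\
    forall x y rho, Rabs x <= rho -> Rabs y <= rho -> rho < d ->
      Rabs (f x y - (f 0 0 + a * x + b * y + meval l x y)) <= C * rho ^ M.

(** Summation by total degree makes the partial sums Taylor polynomials; absolute convergence at one point
    of the open first quadrant bounds the tail uniformly on a square.  The linear coefficients [a], [b]
    are chosen once for all degrees. *)
Lemma analytic_expansion f : analytic_at_O f -> exists a b, expands_at_O f a b.
Proof.
  intros (a & r & Hr & H).
  set (hom := fun x y n => sum_n (fun i => a i (n - i)%nat * x ^ i * y ^ (n - i)) n).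
  assert (Hl : forall M, exists l, degrees_from 2 l /\ forall x y,
    sum_n (hom x y) (S M) = a 0%nat 0%nat + a 1%nat 0%nat * x + a 0%nat 1%nat * y + meval l x y).
  { induction M as [|M [l [Hl E]]].
    - exists nil; split; [constructor|]. intros x y. rewrite sum_Sn, sum_O. unfold hom.
      rewrite sum_O, sum_Sn, sum_O. unfold plus; simpl. ring.
    - destruct (homogeneous_part_meval a (S (S M)) (S (S M)) ltac:(lia)) as [l' [Hl' E']].
      exists (l ++ l'); split.
      + apply degrees_from_app; [assumption|]. eapply Forall_impl; [|exact Hl'].
        simpl; intros; lia.
      + intros x y. rewrite sum_Sn, E, meval_app. unfold hom. rewrite E'.
        unfold plus; simpl; ring. }
  set (s := r / 2). assert (Hs : 0 < s) by (unfold s; lra).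
  set (A := fun n => sum_n (fun i => Rabs (a i (n - i)%nat * s ^ i * s ^ (n - i))) n).
  assert (HA : ex_series A) by (apply (H s s); rewrite Rabs_pos_eq; unfold s; lra).
  assert (Htail : forall N x y rho, Rabs x <= rho -> Rabs y <= rho -> rho < s ->
    Rabs (f x y - sum_n (hom x y) N) <= Series A * (rho / s) ^ S N).
  { intros N x y rho Hx Hy Hrho. apply series_tail; try assumption.
    - intros n. unfold A. rewrite sum_n_Reals. apply cond_pos_sum. intros; apply Rabs_pos.
    - assert (0 <= rho) by (pose proof (Rabs_pos x); lra).
      split; [apply Rdiv_le_0_compat; lra|]. apply Rle_div_l; lra.
    - intros n. unfold hom, A. rewrite !sum_n_Reals.
      eapply Rle_trans; [apply Rsum_abs|]. rewrite Rmult_comm, scal_sum. apply sum_Rle.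
      intros i Hi. rewrite !Rabs_mult, <- !RPow_abs, (Rabs_pos_eq s) by lra.
      replace ((rho / s) ^ n) with ((rho / s) ^ i * (rho / s) ^ (n - i)).
      2:{ rewrite <- pow_add. f_equal; lia. }
      unfold Rdiv; rewrite !Rpow_mult_distr, !pow_inv.
      replace (Rabs (a i (n - i)%nat) * s ^ i * s ^ (n - i) * (rho ^ i * / s ^ i * (rho ^ (n - i) * / s ^ (n - i))))
        with (Rabs (a i (n - i)%nat) * rho ^ i * rho ^ (n - i)).
      2:{ field; split; apply pow_nonzero; lra. }
      pose proof (Rabs_pos x); pose proof (Rabs_pos y).
      apply Rmult_le_compat; [|apply pow_le; lra| |apply pow_incr; lra].
      + apply Rmult_le_pos; [apply Rabs_pos|apply pow_le; lra].
      + apply Rmult_le_compat_l; [apply Rabs_pos|apply pow_incr; lra].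
    - apply H; unfold s in *; lra. }
  assert (E00 : f 0 0 = a 0%nat 0%nat).
  { destruct (Hl 0%nat) as [l [Hd E]].
    pose proof (Htail 0%nat 0 0 0 ltac:(rewrite Rabs_R0; lra) ltac:(rewrite Rabs_R0; lra) Hs) as T.
    rewrite sum_O in T. unfold hom in T. rewrite sum_O in T. simpl in T.
    replace (0 / s) with 0 in T by (field; lra).
    rewrite Rmult_0_l, Rmult_0_r in T. rewrite !Rmult_1_r in T.
    apply Rminus_diag_uniq. destruct (Req_dec (f 0 0 - a 0%nat 0%nat) 0) as [|Hn]; [assumption|].
    apply Rabs_pos_lt in Hn. lra. }
  exists (a 1%nat 0%nat), (a 0%nat 1%nat). intros M.
  destruct (Hl M) as [l [Hd E]]. exists l, (Series A / s ^ M), (Rmin s 1).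
  assert (HS : 0 <= Series A).
  { rewrite <- (Rmult_0_l (Series A)), <- Series_scal_l. apply Series_le; [|assumption].
    intros n. assert (0 <= A n); [|lra]. unfold A. rewrite sum_n_Reals. apply cond_pos_sum.
    intros; apply Rabs_pos. }
  split; [assumption|]. split; [apply Rmin_glb_lt; lra|]. split; [apply Rmin_r|].
  split; [apply Rdiv_le_0_compat; [assumption|now apply pow_lt]|].
  intros x y rho Hx Hy Hrho.
  assert (rho < s) by (eapply Rlt_le_trans; [eassumption|apply Rmin_l]).
  assert (0 <= rho) by (pose proof (Rabs_pos x); lra).
  rewrite E00, <- E. eapply Rle_trans; [apply Htail; eassumption|].
  replace (Series A / s ^ M * rho ^ M) with (Series A * (rho / s) ^ M).
  2:{ unfold Rdiv; rewrite Rpow_mult_distr, pow_inv; ring. }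
  apply Rmult_le_compat_l; [assumption|].
  assert (0 <= rho / s <= 1) as [T1 T2].
  { split; [apply Rdiv_le_0_compat; lra|]. apply Rle_div_l; lra. }
  assert (0 <= (rho / s) ^ M) by now apply pow_le.
  assert ((rho / s) ^ 2 <= 1) by (simpl; nra).
  replace (S (S M)) with (2 + M)%nat by lia. rewrite pow_add.
  rewrite <- (Rmult_1_l ((rho / s) ^ M)) at 2. apply Rmult_le_compat_r; assumption.
Qed.

Lemma is_derive_of_quadratic_bound g g0 a C d : 0 < d ->
  (forall x, Rabs x < d -> Rabs (g x - (g0 + a * x)) <= C * x ^ 2) -> is_derive g 0 a.
Proof.
  intros Hd H. assert (G0 : g 0 = g0).
  { specialize (H 0 ltac:(rewrite Rabs_R0; lra)).
    replace (C * 0 ^ 2) with 0 in H by (simpl; ring).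
    apply Rminus_diag_uniq. destruct (Req_dec (g 0 - g0) 0) as [|Hn]; [assumption|].
    apply Rabs_pos_lt in Hn. replace (g 0 - (g0 + a * 0)) with (g 0 - g0) in H by ring. lra. }
  apply is_derive_Reals. intros e He. set (K := Rabs C + 1).
  assert (HK : 0 < K) by (pose proof (Rabs_pos C); unfold K; lra).
  assert (Hm : 0 < Rmin d (e / K)) by (apply Rmin_glb_lt; [assumption|now apply Rdiv_lt_0_compat]).
  exists (mkposreal _ Hm); simpl. intros h Hh Hh'. rewrite Rplus_0_l, G0.
  min_bounds.
  specialize (H h ltac:(lra)).
  replace ((g h - g0) / h - a) with ((g h - (g0 + a * h)) / h) by (field; assumption).
  unfold Rdiv. rewrite Rabs_mult, Rabs_inv. apply Rabs_pos_lt in Hh as Hp.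
  apply Rmult_lt_reg_r with (Rabs h); [assumption|].
  rewrite Rmult_assoc, Rinv_l, Rmult_1_r by lra.
  eapply Rle_lt_trans; [exact H|]. rewrite <- (pow2_abs h).
  pose proof (Rle_abs C).
  assert (Rabs h * K < e).
  { replace e with (e / K * K) by (field; lra). apply Rmult_lt_compat_r; lra. }
  unfold K in *. simpl. nra.
Qed.

Lemma analytic_partial_derivatives f a b : expands_at_O f a b ->
  Derive (fun x => f x 0) 0 = a /\ Derive (fun y => f 0 y) 0 = b.
Proof.
  intros H. destruct (H 2%nat) as (l & C & d & Hl & Hd & Hd1 & HC & HE).
  destruct (meval_bound 2 l Hl) as [B [HB HB']].
  assert (Q : forall x y rho, Rabs x <= rho -> Rabs y <= rho -> rho < d ->
    Rabs (f x y - (f 0 0 + a * x + b * y)) <= (C + B) * rho ^ 2).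
  { intros x y rho Hx Hy Hr.
    replace (f x y - (f 0 0 + a * x + b * y))
      with ((f x y - (f 0 0 + a * x + b * y + meval l x y)) + meval l x y) by ring.
    triangle. rewrite Rmult_plus_distr_r.
    apply Rplus_le_compat; [now apply HE|apply HB'; lra]. }
  split; apply is_derive_unique; apply (is_derive_of_quadratic_bound _ (f 0 0) _ (C + B) d Hd).
  - intros x Hx. rewrite <- (pow2_abs x).
    replace (f 0 0 + a * x) with (f 0 0 + a * x + b * 0) by ring.
    apply Q; rewrite ?Rabs_R0; try lra. apply Rabs_pos.
  - intros y Hy. rewrite <- (pow2_abs y).
    replace (f 0 0 + b * y) with (f 0 0 + a * 0 + b * y) by ring.
    apply Q; rewrite ?Rabs_R0; try lra. apply Rabs_pos.
Qed.

(** On the axis the double series is a power series in [x], so derivatives are read off its coefficients. *)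
Lemma analytic_axis_leading f n : analytic_at_O f ->
  (forall j, (j < n)%nat -> Derive_n (fun x => f x 0) j 0 = 0) ->
  exists C d, 0 < d /\ forall x, Rabs x < d ->
    Rabs (f x 0 - Derive_n (fun x => f x 0) n 0 / INR (fact n) * x ^ n) <= C * Rabs x ^ S n.
Proof.
  intros (a & r & Hr & H) H0.
  set (b := fun n => a n 0%nat).
  assert (Hs : forall x, Rabs x < r -> is_series (fun n => b n * x ^ n) (f x 0)).
  { intros x Hx. destruct (H x 0 Hx ltac:(rewrite Rabs_R0; lra)) as [_ S].
    eapply is_series_ext; [|exact S]. clear - b. intros n; cbv beta. unfold b.
    destruct n as [|n]; [rewrite sum_O; simpl; ring|].
    rewrite sum_Sn, Nat.sub_diag, (sum_n_ext_loc _ (fun _ => 0)).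
    - rewrite sum_n_const. unfold plus; simpl. ring.
    - intros k Hk. replace (S n - k)%nat with (S (n - k)) by lia. simpl. ring. }
  assert (Hr0 : Rbar_lt 0 (CV_radius b)).
  { rewrite <- Rabs_R0. apply (CV_radius_of_half_disk b r Hr); [|rewrite Rabs_R0; assumption].
    intros x Hx. exists (f x 0). apply Hs. rewrite Rabs_pos_eq; lra. }
  assert (HD : forall k, Derive_n (fun x => f x 0) k 0 = b k * INR (fact k)).
  { intros k. rewrite <- (Derive_n_coef b k Hr0). apply Derive_n_ext_loc.
    exists (mkposreal r Hr). intros x Hx.
    assert (Hx' : Rabs x < r).
    { replace x with (x - 0) by ring. exact Hx. }
    symmetry. apply is_pseries_unique, is_pseries_R, Hs, Hx'. }
  destruct (pseries_tail b r Hr) with (N := n) as (C & d & Hd & Ht).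
  { intros x Hx. exists (f x 0). apply Hs. rewrite Rabs_pos_eq; lra. }
  exists C, (Rmin d r). split; [now apply Rmin_glb_lt|]. intros x Hx.
  min_bounds.
  specialize (Ht x (f x 0) ltac:(lra) (Hs x ltac:(lra))).
  replace (sum_n (fun n => b n * x ^ n) n) with (b n * x ^ n) in Ht.
  - rewrite HD. replace (b n * INR (fact n) / INR (fact n)) with (b n); [assumption|].
    field. apply INR_fact_neq_0.
  - destruct n as [|n]; [now rewrite sum_O|].
    rewrite sum_Sn, (sum_n_ext_loc _ (fun _ => 0)).
    + rewrite sum_n_const. unfold plus; cbn -[pow]. ring.
    + intros k Hk. specialize (H0 k ltac:(lia)). rewrite HD in H0.
      apply Rmult_integral in H0 as [E|E]; [rewrite E; apply Rmult_0_l|].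
      now apply INR_fact_neq_0 in E.
Qed.

(** The relation [D] stands for the displacement, which is a relation between [x] and its value. *)
Lemma lyapunov_leading_term (V : nat -> R) (r : R) (D : R -> R -> Prop) (k : nat) : 0 < r ->
  (forall x, 0 < x < r -> exists d, D x d /\ is_series (fun k => V (S k) * x ^ S k) d) ->
  (1 <= k)%nat -> (forall j, (1 <= j < k)%nat -> V j = 0) ->
  exists C e, 0 < e /\ forall x, 0 < x < e -> exists d, D x d /\ Rabs (d - V k * x ^ k) <= C * x ^ S k.
Proof.
  intros Hr H Hk H0. set (b := fun n => match n with 0%nat => 0 | _ => V n end).
  assert (Hs : forall x d : R, is_series (fun k => V (S k) * x ^ S k) d -> is_series (fun n => b n * x ^ n) d).
  { intros x d Hd. apply is_series_decr_1.
    assert (E : d = plus d (opp (b 0%nat * x ^ 0))) by (unfold plus, opp, b; simpl; ring).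
    exact (eq_ind d (fun z => is_series (fun k => V (S k) * x ^ S k) z) Hd _ E). }
  destruct (pseries_tail b r Hr) with (N := k) as (C & e & He & Ht).
  { intros x Hx. destruct (H x Hx) as [d [_ Hd]]. exists d. now apply Hs. }
  exists C, (Rmin e r). split; [now apply Rmin_glb_lt|]. intros x [Hx Hx'].
  min_bounds.
  destruct (H x ltac:(lra)) as [d [HD Hd]]. exists d; split; [assumption|].
  specialize (Ht x d ltac:(rewrite Rabs_pos_eq; lra) (Hs x d Hd)).
  rewrite (Rabs_pos_eq x) in Ht by lra.
  replace (sum_n (fun n => b n * x ^ n) k) with (V k * x ^ k) in Ht; [assumption|].
  destruct k as [|k]; [lia|]. rewrite sum_Sn, (sum_n_ext_loc _ (fun _ => 0)).
  - rewrite sum_n_const. unfold plus; cbn -[pow]. ring.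
  - intros [|j] Hj; simpl; [apply Rmult_0_l|]. rewrite H0 by lia. apply Rmult_0_l.
Qed.

(** * Formal first integrals in polar coordinates *)

Lemma is_derive_continuous (f : R -> R) x l : is_derive f x l -> continuous f x.
Proof. intros H; apply (ex_derive_continuous f x); now exists l. Qed.

(** Finite sums of [h th * r ^ k] with [k >= m] and [h] continuous.  Membership records the order of vanishing
    in [r], which is all that is asked of the remainders. *)
Inductive angular_poly (m : nat) : (R -> R -> R) -> Prop :=
| angular_zero f : (forall r th, f r th = 0) -> angular_poly m f
| angular_term h k g f : (forall th, continuous h th) -> (m <= k)%nat -> angular_poly m g ->
    (forall r th, f r th = h th * r ^ k + g r th) -> angular_poly m f.

Lemma angular_ext m f g : (forall r th, f r th = g r th) -> angular_poly m f -> angular_poly m g.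
Proof.
  intros E Hf; revert E; destruct Hf as [f' H|h k g' f' Hh Hk Hg H]; intros E.
  - apply angular_zero; intros; now rewrite <- E.
  - apply (angular_term m h k g'); try assumption. intros; now rewrite <- E.
Qed.

Lemma angular_plus m f g : angular_poly m f -> angular_poly m g ->
  angular_poly m (fun r th => f r th + g r th).
Proof.
  intros Hf Hg; induction Hf as [f H|h k f' f Hh Hk Hf' IH H].
  - apply (angular_ext m g); [|assumption]. intros; rewrite H; ring.
  - apply (angular_term m h k (fun r th => f' r th + g r th)); try assumption.
    intros; rewrite H; ring.
Qed.

Lemma angular_monomial m h k : (forall th, continuous h th) -> (m <= k)%nat ->
  angular_poly m (fun r th => h th * r ^ k).
Proof.
  intros Hh Hk. apply (angular_term m h k (fun _ _ => 0)); try assumption.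
  - now apply angular_zero.
  - intros; ring.
Qed.

Lemma angular_mult m n c k f : (forall th, continuous c th) -> (n <= m + k)%nat -> angular_poly m f ->
  angular_poly n (fun r th => c th * r ^ k * f r th).
Proof.
  intros Hc Hn Hf; induction Hf as [f H|h j f' f Hh Hj Hf' IH H].
  - apply angular_zero. intros; rewrite H; ring.
  - apply (angular_term n (fun th => c th * h th) (k + j) (fun r th => c th * r ^ k * f' r th)).
    + intros th. apply (continuous_mult c h); auto.
    + lia.
    + assumption.
    + intros; rewrite H, pow_add; ring.
Qed.

Lemma continuous_bounded_on (h : R -> R) a b : (forall th, continuous h th) ->
  exists C, 0 <= C /\ forall th, a <= th <= b -> Rabs (h th) <= C.
Proof.
  intros Hh. destruct (bounded_continuity h a b) as [C HC]; [intros; apply Hh|].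
  exists (Rabs C); split; [apply Rabs_pos|]. intros th Hth. specialize (HC th Hth).
  pose proof (Rle_abs C). change (norm (h th)) with (Rabs (h th)) in HC. lra.
Qed.

Lemma pow_le_antitone r k m : 0 <= r <= 1 -> (m <= k)%nat -> r ^ k <= r ^ m.
Proof.
  intros Hr Hk. replace k with (m + (k - m))%nat by lia. rewrite pow_add.
  assert (0 <= r ^ m) by (apply pow_le; lra).
  assert (r ^ (k - m) <= 1) by (rewrite <- (pow1 (k - m)); apply pow_incr; lra). nra.
Qed.

Lemma angular_bound m f : angular_poly m f -> exists C, 0 <= C /\
  forall r th, Rabs r <= 1 -> 0 <= th <= PI -> Rabs (f r th) <= C * Rabs r ^ m.
Proof.
  induction 1 as [f H|h k f' f Hh Hk Hf' IH H].
  - exists 0; split; [lra|]. intros; rewrite H, Rabs_R0; lra.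
  - destruct IH as [C [HC IH]]. destruct (continuous_bounded_on h 0 PI Hh) as [B [HB HB']].
    exists (B + C); split; [lra|]. intros r th Hr Hth. rewrite H.
    triangle. rewrite Rmult_plus_distr_r.
    apply Rplus_le_compat; [|now apply IH]. rewrite Rabs_mult, <- RPow_abs.
    apply Rmult_le_compat; [apply Rabs_pos|apply pow_le, Rabs_pos|now apply HB'|].
    apply pow_le_antitone; [|assumption]. split; [apply Rabs_pos|assumption].
Qed.

Notation angular_coefficient := ((R -> R) * (R -> R) * nat)%type.

(** An entry [(c, dc, k)] stands for the term [c th * r ^ k]; [dc] is the derivative of [c]. *)
Fixpoint Ival (l : list angular_coefficient) (r th : R) : R :=
  match l with nil => 0 | (c, _, k) :: l' => c th * r ^ k + Ival l' r th end.

Fixpoint Irad (l : list angular_coefficient) (r th : R) : R :=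
  match l with nil => 0 | (c, _, k) :: l' => c th * (INR k * r ^ pred k) + Irad l' r th end.

Fixpoint Iang (l : list angular_coefficient) (r th : R) : R :=
  match l with nil => 0 | (_, dc, k) :: l' => dc th * r ^ k + Iang l' r th end.

Definition differentiable_from (m : nat) (l : list angular_coefficient) : Prop :=
  Forall (fun t => (m <= snd t)%nat /\
    forall th, is_derive (fst (fst t)) th (snd (fst t) th) /\ continuous (snd (fst t)) th) l.

Lemma Ival_derive m l r th t dr dth : differentiable_from m l ->
  is_derive r t dr -> is_derive th t dth ->
  is_derive (fun s => Ival l (r s) (th s)) t (Irad l (r t) (th t) * dr + Iang l (r t) (th t) * dth).
Proof.
  intros Hl Hr Hth; induction l as [|[[c dc] k] l IH].
  - simpl. replace (0 * dr + 0 * dth) with 0 by ring. apply (is_derive_const (V := R_NormedModule)).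
  - apply Forall_cons_iff in Hl as [[_ Hc] Hl]; simpl in Hc. specialize (IH Hl). cbn [Ival Irad Iang].
    assert (D1 : is_derive (fun s => c (th s)) t (dth * dc (th t))).
    { apply (is_derive_comp c th); [apply Hc|assumption]. }
    assert (D2 : is_derive (fun s => r s ^ k) t (INR k * dr * r t ^ pred k)).
    { now apply is_derive_pow. }
    pose proof (is_derive_plus (V := R_NormedModule) _ _ t _ _
      (is_derive_mult _ _ t _ _ D1 D2 Rmult_comm) IH) as D.
    eapply eq_ind; [exact D|]. unfold plus, mult; simpl. ring.
Qed.

(** Needed at the ends of a half-turn, where the angle is only known as a limit. *)
Lemma Ival_limit m l {T : Type} (F : (T -> Prop) -> Prop) {FF : Filter F} (r th : T -> R) (r0 th0 : R) :
  differentiable_from m l ->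
  filterlim r F (locally r0) -> filterlim th F (locally th0) ->
  filterlim (fun s => Ival l (r s) (th s)) F (locally (Ival l r0 th0)).
Proof.
  intros Hl Hr Hth; induction l as [|[[c dc] k] l IH]; [apply filterlim_const|].
  apply Forall_cons_iff in Hl as [[_ Hc] Hl]; simpl in Hc. cbn [Ival].
  assert (L1 : filterlim (fun s => c (th s)) F (locally (c th0))).
  { apply (filterlim_comp _ _ _ th c) with (1 := Hth). change (continuous c th0).
    eapply is_derive_continuous, Hc. }
  assert (L2 : filterlim (fun s => r s ^ k) F (locally (r0 ^ k))).
  { apply (filterlim_comp _ _ _ r (fun z => z ^ k)) with (1 := Hr).
    change (continuous (fun z => z ^ k) r0). apply (ex_derive_continuous (fun z => z ^ k)).
    exists (INR k * 1 * r0 ^ pred k).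
    apply (is_derive_pow (fun z => z)), (is_derive_id (K := R_AbsRing)). }
  assert (L3 : filterlim (fun s => c (th s) * r s ^ k) F (locally (c th0 * r0 ^ k))).
  { eapply filterlim_comp_2; [exact L1|exact L2|].
    exact (filterlim_mult (K := R_AbsRing) (c th0) (r0 ^ k)). }
  eapply filterlim_comp_2; [exact L3|exact (IH Hl)|].
  exact (filterlim_plus (V := R_NormedModule) _ _).
Qed.

(** The bound on the angular derivative keeps a factor [r], which compensates the division by [r] in the
    error of the angular speed. *)
Lemma Ival_bounds l : differentiable_from 1 l -> exists C, 0 <= C /\
  forall r th, Rabs r <= 1 -> 0 <= th <= PI ->
    Rabs (Irad l r th) <= C /\ Rabs (Iang l r th) <= C * Rabs r.
Proof.
  induction l as [|[[c dc] k] l IH]; intros Hl.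
  - exists 0; split; [lra|]. intros; simpl; rewrite Rabs_R0; split; lra.
  - apply Forall_cons_iff in Hl as [[Hk Hc] Hl]; simpl in Hk, Hc. destruct (IH Hl) as [C [HC IH']].
    destruct (continuous_bounded_on c 0 PI) as [B [HB HB']].
    { intros th. eapply is_derive_continuous, Hc. }
    destruct (continuous_bounded_on dc 0 PI) as [D [HD HD']]; [intros; apply Hc|].
    pose proof (pos_INR k) as Pk.
    assert (0 <= B * INR k) by (apply Rmult_le_pos; assumption).
    exists (B * INR k + D + C); split; [lra|].
    intros r th Hr Hth. destruct (IH' r th Hr Hth) as [I1 I2]. cbn [Irad Iang].
    pose proof (Rabs_pos r) as Pr. split; (eapply Rle_trans; [apply Rabs_triang|]).
    + assert (Rabs (c th * (INR k * r ^ pred k)) <= B * INR k); [|lra].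
      rewrite !Rabs_mult, <- RPow_abs, (Rabs_pos_eq (INR k)) by assumption.
      assert (Rabs r ^ pred k <= 1) by (rewrite <- (pow1 (pred k)); apply pow_incr; lra).
      assert (0 <= Rabs r ^ pred k) by now apply pow_le.
      apply Rmult_le_compat; [apply Rabs_pos|now apply Rmult_le_pos|now apply HB'|nra].
    + assert (Rabs (dc th * r ^ k) <= D * Rabs r); [|nra].
      rewrite Rabs_mult, <- RPow_abs.
      apply Rmult_le_compat; [apply Rabs_pos|now apply pow_le|now apply HD'|].
      rewrite <- (pow_1 (Rabs r)) at 2. apply pow_le_antitone; [lra|assumption].
Qed.

Lemma Ival_app l l' r th : Ival (l ++ l') r th = Ival l r th + Ival l' r th.
Proof. induction l as [|[[c dc] k] l IH]; simpl; [ring|rewrite IH; ring]. Qed.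

Lemma Irad_app l l' r th : Irad (l ++ l') r th = Irad l r th + Irad l' r th.
Proof. induction l as [|[[c dc] k] l IH]; simpl; [ring|rewrite IH; ring]. Qed.

Lemma Iang_app l l' r th : Iang (l ++ l') r th = Iang l r th + Iang l' r th.
Proof. induction l as [|[[c dc] k] l IH]; simpl; [ring|rewrite IH; ring]. Qed.

Lemma Ival_poly_quadratic l th : differentiable_from 2 l ->
  exists p, polynomial p /\ forall r, Ival l r th = r ^ 2 * p r.
Proof.
  induction l as [|[[c dc] k] l IH]; intros Hl.
  - exists (fun _ => 0); split; [apply poly_const|]. intros; simpl; ring.
  - apply Forall_cons_iff in Hl as [[Hk _] Hl]; simpl in Hk. destruct (IH Hl) as [p [Hp E]].
    exists (fun r => c th * r ^ (k - 2) + p r); split.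
    + apply poly_plus; [apply poly_scal, poly_pow|assumption].
    + intros r. cbn [Ival]. rewrite E. replace k with (2 + (k - 2))%nat at 1 by lia.
      rewrite pow_add. ring.
Qed.

(** Rate of change of [Ival l] along [r' = r * (P + p)], [th' = Q + q]. *)
Definition transport (P Q : R -> R) (p q : R -> R -> R) (l : list angular_coefficient) (r th : R) : R :=
  Irad l r th * (r * (P th + p r th)) + Iang l r th * (Q th + q r th).

Lemma RInt_derive (f : R -> R) : (forall x, continuous f x) ->
  forall x, is_derive (fun y => RInt f 0 y) x (f x).
Proof.
  intros Hf x. apply (is_derive_RInt f (fun y => RInt f 0 y) 0); [|apply Hf].
  apply filter_forall. intros y. apply (RInt_correct (V := R_CompleteNormedModule)).
  apply (ex_RInt_continuous (V := R_CompleteNormedModule)). intros; apply Hf.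
Qed.

(** Variation of constants.  For [H = 0] the solution is [c0] times an exponential, whence its sign. *)
Lemma linear_scalar_ode (A H : R -> R) (c0 : R) :
  (forall x, continuous A x) -> (forall x, continuous H x) ->
  exists c, c 0 = c0 /\ (forall x, is_derive c x (A x * c x + H x)) /\
    ((forall x, H x = 0) -> 0 < c0 -> forall x, 0 < c x).
Proof.
  intros CA CH. set (a := fun y => RInt A 0 y).
  assert (Da : forall x, is_derive a x (A x)) by now apply RInt_derive.
  assert (Dm : forall x, is_derive (fun y => exp (- a y)) x (- A x * exp (- a x))).
  { intros x. apply (is_derive_comp exp (fun y => - a y) x).
    - apply is_derive_exp.
    - apply (is_derive_opp (V := R_NormedModule)), Da. }
  set (K := fun y => exp (- a y) * H y).
  assert (CK : forall x, continuous K x).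
  { intros x. apply (continuous_mult (fun y => exp (- a y)) H); [|apply CH].
    eapply is_derive_continuous, Dm. }
  set (b := fun y => RInt K 0 y).
  assert (Db : forall x, is_derive b x (K x)) by now apply RInt_derive.
  exists (fun y => exp (a y) * (c0 + b y)).
  assert (a 0 = 0) as A0 by (unfold a; apply (RInt_point (V := R_CompleteNormedModule))).
  assert (b 0 = 0) as B0 by (unfold b; apply (RInt_point (V := R_CompleteNormedModule))).
  split; [|split].
  - rewrite A0, B0, exp_0; ring.
  - intros x.
    assert (De : is_derive (fun y => exp (a y)) x (A x * exp (a x))).
    { apply (is_derive_comp exp a x); [apply is_derive_exp|apply Da]. }
    assert (Dc : is_derive (fun y => c0 + b y) x (0 + K x)).
    { apply (is_derive_plus (V := R_NormedModule)); [apply (is_derive_const (V := R_NormedModule))|apply Db]. }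
    eapply eq_ind; [exact (is_derive_mult _ _ x _ _ De Dc Rmult_comm)|].
    unfold plus, mult, K; simpl. rewrite exp_Ropp. field. apply Rgt_not_eq, exp_pos.
  - intros H0 Hc x. apply Rmult_lt_0_compat; [apply exp_pos|].
    assert (b x = 0) as ->; [|lra]. unfold b.
    rewrite (RInt_ext _ (fun _ => 0)); [|intros; unfold K; rewrite H0; apply Rmult_0_r].
    rewrite RInt_const. apply Rmult_0_r.
Qed.

(** The equation says that the transport of [c th * r ^ k] cancels [h th * r ^ k] at lowest order. *)
Lemma angular_coefficient_exists (P Q h : R -> R) (k : nat) (c0 : R) :
  (forall x, continuous P x) -> (forall x, continuous Q x) -> (forall x, 0 < Q x) ->
  (forall x, continuous h x) ->
  exists c dc, c 0 = c0 /\
    (forall x, is_derive c x (dc x) /\ continuous dc x /\ continuous c x) /\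
    (forall x, INR k * c x * P x + dc x * Q x = - h x) /\
    ((forall x, h x = 0) -> 0 < c0 -> forall x, 0 < c x).
Proof.
  intros CP CQ PQ Ch.
  assert (CI : forall x, continuous (fun y => / Q y) x).
  { intros x. apply continuous_Rinv_comp; [apply CQ|]. specialize (PQ x); lra. }
  set (A := fun y => - INR k * (P y * / Q y)). set (H := fun y => -1 * (h y * / Q y)).
  assert (CA : forall x, continuous A x).
  { intros x. apply (continuous_mult (fun _ => - INR k) (fun y => P y * / Q y)); [apply continuous_const|].
    apply (continuous_mult P (fun y => / Q y)); auto. }
  assert (CH : forall x, continuous H x).
  { intros x. apply (continuous_mult (fun _ => -1) (fun y => h y * / Q y)); [apply continuous_const|].
    apply (continuous_mult h (fun y => / Q y)); auto. }
  destruct (linear_scalar_ode A H c0 CA CH) as (c & C0 & Dc & Pc).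
  assert (Cc : forall x, continuous c x).
  { intros x. eapply is_derive_continuous, Dc. }
  exists c, (fun x => A x * c x + H x). split; [assumption|]. split; [|split].
  - intros x. split; [apply Dc|]. split; [|apply Cc].
    apply (continuous_plus (fun x => A x * c x) H); [|apply CH].
    apply (continuous_mult A c); auto.
  - intros x. unfold A, H. specialize (PQ x). field. lra.
  - intros Hh Hc. apply Pc; [|assumption]. intros x; unfold H; rewrite Hh; ring.
Qed.

(** The terms of [f] may have different degrees; each is cancelled by a term of its own degree, and what
    the correction produces besides has one degree more. *)
Lemma angular_correction (P Q : R -> R) (p q : R -> R -> R) :
  (forall x, continuous P x) -> (forall x, continuous Q x) -> (forall x, 0 < Q x) ->
  angular_poly 1 p -> angular_poly 1 q ->
  forall m f, (1 <= m)%nat -> angular_poly m f ->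
  exists l g, differentiable_from m l /\ (forall r, Ival l r 0 = 0) /\ angular_poly (S m) g /\
    forall r th, transport P Q p q l r th = - f r th + g r th.
Proof.
  intros CP CQ PQ Hp Hq m f Hm; induction 1 as [f H|h k f' f Hh Hk Hf' IH H].
  - exists nil, (fun _ _ => 0). split; [constructor|]. split; [reflexivity|].
    split; [now apply angular_zero|]. intros; unfold transport; simpl. rewrite H; ring.
  - destruct IH as (l & g & Hl & L0 & Hg & E).
    destruct (angular_coefficient_exists P Q h k 0 CP CQ PQ Hh) as (c & dc & C0 & Dc & Ec & _).
    exists ((c, dc, k) :: l), (fun r th => (INR k * c th * r ^ k * p r th + dc th * r ^ k * q r th) + g r th).
    split; [|split; [|split]].
    + constructor; [|assumption]. simpl. split; [assumption|]. intros th; split; apply Dc.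
    + intros r; simpl. rewrite C0, L0; ring.
    + apply angular_plus; [|assumption]. apply angular_plus.
      * apply (angular_mult 1 (S m) (fun th => INR k * c th) k); [|lia|assumption].
        intros th. apply (continuous_mult (fun _ => INR k) c); [apply continuous_const|apply Dc].
      * apply (angular_mult 1 (S m)); [apply Dc|lia|assumption].
    + intros r th. specialize (E r th). unfold transport in *; cbn [Irad Iang].
      rewrite H. specialize (Ec th).
      assert (Ek : r ^ pred k * r = r ^ k).
      { destruct k as [|k]; [lia|]. simpl; ring. }
      replace ((c th * (INR k * r ^ pred k) + Irad l r th) * (r * (P th + p r th)) +
        (dc th * r ^ k + Iang l r th) * (Q th + q r th)) with
       ((INR k * c th * P th) * (r ^ pred k * r) + dc th * Q th * r ^ k
        + INR k * c th * (r ^ pred k * r) * p r th + dc th * r ^ k * q r th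
        + (Irad l r th * (r * (P th + p r th)) + Iang l r th * (Q th + q r th))) by ring.
      rewrite Ek, E. replace (INR k * c th * P th * r ^ k + dc th * Q th * r ^ k)
        with ((INR k * c th * P th + dc th * Q th) * r ^ k) by ring.
      rewrite Ec; ring.
Qed.

(** The coefficient of [r] is positive at [PI] because it solves a homogeneous linear equation. *)
Lemma angular_first_integral (P Q : R -> R) (p q : R -> R -> R) :
  (forall x, continuous P x) -> (forall x, continuous Q x) -> (forall x, 0 < Q x) ->
  angular_poly 1 p -> angular_poly 1 q ->
  forall m, exists l g, differentiable_from 1 l /\ (forall r, Ival l r 0 = r) /\
    angular_poly (S (S m)) g /\ (forall r th, transport P Q p q l r th = g r th) /\
    exists lam s, 0 < lam /\ polynomial s /\ forall r, Ival l r PI = lam * r + r ^ 2 * s r.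
Proof.
  intros CP CQ PQ Hp Hq m. induction m as [|m IH].
  - destruct (angular_coefficient_exists P Q (fun _ => 0) 1 1 CP CQ PQ) as (c & dc & C0 & Dc & Ec & Pc);
      [intros; apply continuous_const|].
    exists ((c, dc, 1%nat) :: nil), (fun r th => c th * r ^ 1 * p r th + dc th * r ^ 1 * q r th).
    split; [|split; [|split; [|split]]].
    + constructor; [|constructor]. simpl. split; [lia|]. intros th; split; apply Dc.
    + intros r; simpl. rewrite C0; ring.
    + apply angular_plus; (apply (angular_mult 1 2); [apply Dc|lia|assumption]).
    + intros r th. unfold transport; simpl. specialize (Ec th). simpl in Ec.
      replace ((c th * (1 * 1) + 0) * (r * (P th + p r th)) +
        (dc th * (r * 1) + 0) * (Q th + q r th))
       with ((1 * c th * P th + dc th * Q th) * r + c th * (r * 1) * p r th + dc th * (r * 1) * q r th) by ring.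
      rewrite Ec; ring.
    + exists (c PI), (fun _ => 0). split; [apply Pc; [reflexivity|lra]|].
      split; [apply poly_const|]. intros r; simpl; ring.
  - destruct IH as (l & g & Hl & L0 & Hg & E & lam & s & Hlam & Hs & Es).
    destruct (angular_correction P Q p q CP CQ PQ Hp Hq (S (S m)) g ltac:(lia) Hg)
      as (l' & g' & Hl' & L0' & Hg' & E').
    exists (l ++ l'), g'. split; [|split; [|split; [|split]]].
    + apply Forall_app; split; [assumption|].
      eapply Forall_impl; [|exact Hl']. simpl; intros t [Ht Ht']; split; [lia|assumption].
    + intros r; rewrite Ival_app, L0, L0'; ring.
    + assumption.
    + intros r th. specialize (E r th); specialize (E' r th). unfold transport in *.
      rewrite Irad_app, Iang_app.
      replace (g' r th) with (g r th + (- g r th + g' r th)) by ring. rewrite <- E', <- E at 1. ring.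
    + destruct (Ival_poly_quadratic l' PI) as (s' & Hs' & Es').
      { eapply Forall_impl; [|exact Hl']. simpl; intros t [Ht Ht']; split; [lia|assumption]. }
      exists lam, (fun r => s r + s' r). split; [assumption|]. split; [now apply poly_plus|].
      intros r; rewrite Ival_app, Es, Es'; ring.
Qed.

(** * First integrals near a focus *)

Lemma continuous_pow_R (f : R -> R) n x : continuous f x -> continuous (fun y => f y ^ n) x.
Proof.
  intros H. apply (continuous_comp f (fun z => z ^ n)); [assumption|].
  eapply is_derive_continuous. apply (is_derive_pow (fun z => z)), (is_derive_id (K := R_AbsRing)).
Qed.

(** The factor [r] is split off because the radial speed is [r] times a function of [angular_poly 1]. *)
Lemma meval_polar l : degrees_from 2 l -> exists f, angular_poly 1 f /\
  forall r th, meval l (r * cos th) (r * sin th) = r * f r th.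
Proof.
  induction l as [|[[c i] j] l IH]; intros Hl.
  - exists (fun _ _ => 0); split; [now apply angular_zero|]. intros; simpl; ring.
  - apply Forall_cons_iff in Hl as [Hd Hl]; simpl in Hd. destruct (IH Hl) as [f [Hf E]].
    exists (fun r th => (c * (cos th ^ i * sin th ^ j)) * r ^ (i + j - 1) + f r th). split.
    + apply angular_plus; [|assumption]. apply angular_monomial; [|lia]. intros th.
      apply (continuous_mult (fun _ => c) (fun th => cos th ^ i * sin th ^ j)); [apply continuous_const|].
      apply (continuous_mult (fun th => cos th ^ i) (fun th => sin th ^ j));
        apply continuous_pow_R; [apply continuous_cos|apply continuous_sin].
    + intros r th. cbn [meval]. rewrite E, !Rpow_mult_distr.
      assert (Er : r ^ i * r ^ j = r * r ^ (i + j - 1)).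
      { rewrite <- pow_add. replace (i + j)%nat with (S (i + j - 1)) at 1 by lia. reflexivity. }
      replace (c * (r ^ i * cos th ^ i) * (r ^ j * sin th ^ j))
        with (c * cos th ^ i * sin th ^ j * (r ^ i * r ^ j)) by ring.
      rewrite Er; ring.
Qed.

Definition radial_speed (F : vector_field) (r th : R) : R :=
  cos th * vX F (r * cos th) (r * sin th) + sin th * vY F (r * cos th) (r * sin th).

Definition angular_speed (F : vector_field) (r th : R) : R :=
  (cos th * vY F (r * cos th) (r * sin th) - sin th * vX F (r * cos th) (r * sin th)) / r.

(** The angular speed of the linearized field. *)
Definition rotation_form (a b c d th : R) : R :=
  cos th * (c * cos th + d * sin th) - sin th * (a * cos th + b * sin th).

Lemma cos_abs_le th : Rabs (cos th) <= 1.
Proof. apply Rabs_le. pose proof (COS_bound th); lra. Qed.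

Lemma sin_abs_le th : Rabs (sin th) <= 1.
Proof. apply Rabs_le. pose proof (SIN_bound th); lra. Qed.

Lemma rotate_bound x y e th : Rabs x <= e -> Rabs y <= e ->
  Rabs (cos th * x + sin th * y) <= 2 * e /\ Rabs (cos th * y - sin th * x) <= 2 * e.
Proof.
  intros Hx Hy. pose proof (cos_abs_le th) as Hc; pose proof (sin_abs_le th) as Hs.
  pose proof (Rabs_pos x); pose proof (Rabs_pos y).
  pose proof (Rabs_pos (cos th)); pose proof (Rabs_pos (sin th)).
  split; unfold Rminus; (eapply Rle_trans; [apply Rabs_triang|]); rewrite ?Rabs_Ropp, !Rabs_mult; nra.
Qed.

(** A truncated first integral with the data that a half-turn uses.  All rates are compared with the angular
    speed, so the angle, which stays between [0] and [PI], replaces time: errors accumulate over a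
    bounded range, however long the half-turn lasts. *)
Record focal_integral (F : vector_field) (M : nat) (l : list angular_coefficient) (lam : R)
    (s : R -> R) (delta K : R) : Prop := {
  fi_differentiable : differentiable_from 1 l;
  fi_initial : forall r, Ival l r 0 = r;
  fi_slope : 0 < lam;
  fi_poly : polynomial s;
  fi_final : forall r, Ival l r PI = lam * r + r ^ 2 * s r;
  fi_delta : 0 < delta;
  fi_K : 0 <= K;
  fi_rates : forall r th, r <> 0 -> Rabs r < delta -> 0 <= th <= PI ->
    0 < angular_speed F r th /\
    Rabs (radial_speed F r th) <= K * Rabs r * angular_speed F r th /\
    Rabs (Irad l r th * radial_speed F r th + Iang l r th * angular_speed F r th)
      <= K * Rabs r ^ M * angular_speed F r th }.

Lemma focal_integral_exists F a b c d :
  vX F 0 0 = 0 -> vY F 0 0 = 0 -> expands_at_O (vX F) a b -> expands_at_O (vY F) c d ->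
  (forall th, 0 < rotation_form a b c d th) ->
  forall M, exists l lam s delta K, focal_integral F M l lam s delta K.
Proof.
  intros X0 Y0 EX EY HQ M.
  destruct (EX (S (S M))) as (lx & Cx & dx & Hlx & Hdx & Hdx1 & HCx & HX).
  destruct (EY (S (S M))) as (ly & Cy & dy & Hly & Hdy & Hdy1 & HCy & HY).
  destruct (meval_polar lx Hlx) as (px & Hpx & Epx).
  destruct (meval_polar ly Hly) as (py & Hpy & Epy).
  set (P := fun th => cos th * (a * cos th + b * sin th) + sin th * (c * cos th + d * sin th)).
  set (Q := rotation_form a b c d).
  assert (Clin : forall u v th, continuous (fun th => u * cos th + v * sin th) th).
  { intros u v th. apply (continuous_plus (fun th => u * cos th) (fun th => v * sin th)).
    - apply (continuous_mult (fun _ => u) cos); [apply continuous_const|apply continuous_cos].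
    - apply (continuous_mult (fun _ => v) sin); [apply continuous_const|apply continuous_sin]. }
  assert (CP : forall th, continuous P th).
  { intros th. apply (continuous_plus (fun th => cos th * (a * cos th + b * sin th))
      (fun th => sin th * (c * cos th + d * sin th))).
    - apply (continuous_mult cos (fun th => a * cos th + b * sin th)); [apply continuous_cos|apply Clin].
    - apply (continuous_mult sin (fun th => c * cos th + d * sin th)); [apply continuous_sin|apply Clin]. }
  assert (CQ : forall th, continuous Q th).
  { intros th. apply (continuous_minus (fun th => cos th * (c * cos th + d * sin th))
      (fun th => sin th * (a * cos th + b * sin th))).
    - apply (continuous_mult cos (fun th => c * cos th + d * sin th)); [apply continuous_cos|apply Clin].
    - apply (continuous_mult sin (fun th => a * cos th + b * sin th)); [apply continuous_sin|apply Clin]. }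
  set (p := fun r th => cos th * r ^ 0 * px r th + sin th * r ^ 0 * py r th).
  set (q := fun r th => cos th * r ^ 0 * py r th + (-1 * sin th) * r ^ 0 * px r th).
  assert (Hp : angular_poly 1 p).
  { apply angular_plus; (apply (angular_mult 1 1); [|lia|assumption]).
    - apply continuous_cos. - apply continuous_sin. }
  assert (Hq : angular_poly 1 q).
  { apply angular_plus.
    - apply (angular_mult 1 1); [apply continuous_cos|lia|assumption].
    - apply (angular_mult 1 1 (fun th => -1 * sin th)); [|lia|assumption].
      intros th; apply (continuous_mult (fun _ => -1) sin); [apply continuous_const|apply continuous_sin]. }
  destruct (angular_first_integral P Q p q CP CQ HQ Hp Hq M)
    as (l & g & Hl & L0 & Hg & Eg & lam & s & Hlam & Hs & Es).
  destruct (Ival_bounds l Hl) as (CI & HCI & BI).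
  destruct (angular_bound _ _ Hg) as (Cg & HCg & Bg).
  destruct (angular_bound _ _ Hp) as (Cp & HCp & Bp).
  destruct (angular_bound _ _ Hq) as (Cq & HCq & Bq).
  destruct (continuous_bounded_on P 0 PI CP) as (CP0 & HCP0 & BP).
  assert (Hbeta : exists beta, 0 < beta /\ forall th, 0 <= th <= PI -> beta <= Q th).
  { destruct (continuity_ab_min Q 0 PI) as (m & Hm & _); [pose proof PI_RGT_0; lra| |].
    - intros; apply continuity_pt_filterlim, CQ.
    - exists (Q m); split; [apply HQ|assumption]. }
  destruct Hbeta as (beta & Hbeta & BQ).
  set (E := Cx + Cy).
  set (B := Cq + 2 * E + 1). assert (HB : 0 < B) by (unfold B, E; lra).
  set (delta := Rmin (Rmin dx dy) (beta / (2 * B))).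
  set (K1 := CP0 + Cp + 2 * E). set (K2 := Cg + 4 * CI * E).
  assert (HE : 0 <= E) by (unfold E; lra).
  assert (HCE : 0 <= CI * E) by now apply Rmult_le_pos.
  assert (HK1 : 0 <= K1) by (unfold K1; lra). assert (HK2 : 0 <= K2) by (unfold K2; lra).
  exists l, lam, s, delta, (2 / beta * (K1 + K2)).
  assert (Hdl : delta <= dx /\ delta <= dy /\ delta <= beta / (2 * B)).
  { unfold delta. split; [|split]; [| |apply Rmin_r].
    - eapply Rle_trans; [apply Rmin_l|apply Rmin_l].
    - eapply Rle_trans; [apply Rmin_l|apply Rmin_r]. }
  assert (H2b : 0 < 2 / beta) by (apply Rdiv_lt_0_compat; lra).
  split; try assumption.
  - unfold delta; repeat apply Rmin_glb_lt; try assumption. apply Rdiv_lt_0_compat; lra.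
  - apply Rmult_le_pos; lra.
  - intros r th Hr0 Hr Hth. set (rho := Rabs r) in *.
    assert (Hrho : 0 < rho) by now apply Rabs_pos_lt.
    set (x := r * cos th). set (y := r * sin th).
    assert (Hx : Rabs x <= rho).
    { unfold x; rewrite Rabs_mult. fold rho. pose proof (cos_abs_le th). nra. }
    assert (Hy : Rabs y <= rho).
    { unfold y; rewrite Rabs_mult. fold rho. pose proof (sin_abs_le th). nra. }
    specialize (HX x y rho Hx Hy ltac:(lra)). specialize (HY x y rho Hx Hy ltac:(lra)).
    rewrite X0 in HX. rewrite Y0 in HY. unfold x at 3, y at 3 in HX. unfold x at 3, y at 3 in HY.
    rewrite Epx in HX. rewrite Epy in HY.
    set (ex := vX F x y - (0 + a * x + b * y + r * px r th)) in *.
    set (ey := vY F x y - (0 + c * x + d * y + r * py r th)) in *.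
    assert (HpM : 0 <= rho ^ S (S M)) by (apply pow_le; lra).
    destruct (rotate_bound ex ey (E * rho ^ S (S M)) th) as [He1 He2].
    { unfold E; rewrite Rmult_plus_distr_r. assert (0 <= Cy * rho ^ S (S M)) by now apply Rmult_le_pos. lra. }
    { unfold E; rewrite Rmult_plus_distr_r. assert (0 <= Cx * rho ^ S (S M)) by now apply Rmult_le_pos. lra. }
    set (e1 := cos th * ex + sin th * ey) in *. set (e2 := cos th * ey - sin th * ex) in *.
    assert (Rr : radial_speed F r th = r * (P th + p r th) + e1).
    { unfold radial_speed. fold x y.
      replace (vX F x y) with (ex + (0 + a * x + b * y + r * px r th)) by (unfold ex; ring).
      replace (vY F x y) with (ey + (0 + c * x + d * y + r * py r th)) by (unfold ey; ring).
      unfold e1, P, p, x, y; ring. }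
    assert (Ra : angular_speed F r th = Q th + q r th + e2 / r).
    { unfold angular_speed. fold x y.
      replace (vX F x y) with (ex + (0 + a * x + b * y + r * px r th)) by (unfold ex; ring).
      replace (vY F x y) with (ey + (0 + c * x + d * y + r * py r th)) by (unfold ey; ring).
      unfold e2, Q, rotation_form, q, x, y. field; assumption. }
    assert (Hrho1 : rho <= 1) by lra.
    specialize (Bp r th Hrho1 Hth). specialize (Bq r th Hrho1 Hth). specialize (Bg r th Hrho1 Hth).
    specialize (BP th Hth). specialize (BQ th Hth). destruct (BI r th Hrho1 Hth) as [BI1 BI2].
    fold rho in Bp, Bq, Bg, BI2. rewrite pow_1 in Bp, Bq.
    assert (HpS : rho ^ S (S M) = rho * rho ^ S M) by reflexivity.
    assert (Hpow1 : rho ^ S M <= rho).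
    { rewrite <- (pow_1 rho) at 2. apply pow_le_antitone; [lra|lia]. }
    assert (HpowM : rho ^ S (S M) <= rho ^ M) by (apply pow_le_antitone; [lra|lia]).
    assert (HpowM1 : rho ^ S M <= rho ^ M) by (apply pow_le_antitone; [lra|lia]).
    assert (HpS0 : 0 <= rho ^ S M) by (apply pow_le; lra).
    assert (HpM0 : 0 <= rho ^ M) by (apply pow_le; lra).
    assert (He2r : Rabs (e2 / r) <= 2 * E * rho ^ S M).
    { unfold Rdiv; rewrite Rabs_mult, Rabs_inv. fold rho.
      apply Rmult_le_reg_r with rho; [assumption|].
      rewrite Rmult_assoc, Rinv_l, Rmult_1_r by lra. rewrite HpS in He2. lra. }
    assert (He2r' : Rabs (e2 / r) <= 2 * E * rho) by nra.
    assert (Hang : beta / 2 <= angular_speed F r th).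
    { assert (Rabs (q r th + e2 / r) <= B * rho).
      { triangle. unfold B. nra. }
      assert (B * rho <= beta / 2).
      { apply Rle_trans with (B * (beta / (2 * B))); [apply Rmult_le_compat_l; lra|].
        apply Req_le; field; lra. }
      rewrite Ra. assert (- (beta / 2) <= q r th + e2 / r); [|lra].
      pose proof (Rle_abs (- (q r th + e2 / r))) as Ha. rewrite Rabs_Ropp in Ha. lra. }
    assert (Hone : 1 <= 2 / beta * angular_speed F r th).
    { replace 1 with (2 / beta * (beta / 2)) by (field; lra). apply Rmult_le_compat_l; lra. }
    split; [lra|]. split.
    + assert (HR1 : Rabs (radial_speed F r th) <= K1 * rho).
      { rewrite Rr. triangle. rewrite Rabs_mult. fold rho.
        pose proof (Rabs_triang (P th) (p r th)).
        assert (Rabs (P th + p r th) <= CP0 + Cp) by nra.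
        assert (Rabs e1 <= 2 * E * rho).
        { rewrite HpS in He1. assert (rho * rho ^ S M <= rho) by nra. nra. }
        unfold K1. nra. }
      assert (K1 * rho <= (K1 + K2) * rho) by nra.
      assert (0 <= (K1 + K2) * rho) by nra.
      replace (2 / beta * (K1 + K2) * rho * angular_speed F r th)
        with ((K1 + K2) * rho * (2 / beta * angular_speed F r th)) by ring. nra.
    + assert (HT : Rabs (Irad l r th * radial_speed F r th + Iang l r th * angular_speed F r th)
        <= K2 * rho ^ M).
      { replace (Irad l r th * radial_speed F r th + Iang l r th * angular_speed F r th)
          with (transport P Q p q l r th + (Irad l r th * e1 + Iang l r th * (e2 / r))).
        2:{ unfold transport; rewrite Rr, Ra; ring. }
        rewrite Eg. triangle.
        pose proof (Rabs_triang (Irad l r th * e1) (Iang l r th * (e2 / r))) as Ht.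
        rewrite !Rabs_mult in Ht.
        assert (A1 : Rabs (Irad l r th) * Rabs e1 <= CI * (2 * (E * rho ^ S (S M)))).
        { apply Rmult_le_compat; try apply Rabs_pos; assumption. }
        assert (A2 : Rabs (Iang l r th) * Rabs (e2 / r) <= CI * rho * (2 * E * rho ^ S M)).
        { apply Rmult_le_compat; try apply Rabs_pos; assumption. }
        replace (CI * (2 * (E * rho ^ S (S M)))) with (2 * (CI * E) * rho ^ S (S M)) in A1 by ring.
        replace (CI * rho * (2 * E * rho ^ S M)) with (2 * (CI * E) * rho ^ S (S M)) in A2 by (rewrite HpS; ring).
        unfold K2. nra. }
      assert (0 <= K1 * rho ^ M) by now apply Rmult_le_pos.
      assert (0 <= K2 * rho ^ M) by now apply Rmult_le_pos.
      replace (2 / beta * (K1 + K2) * rho ^ M * angular_speed F r th)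
        with ((K1 * rho ^ M + K2 * rho ^ M) * (2 / beta * angular_speed F r th)) by ring. nra.
Qed.

(** * Monotonicity, trapping and polar coordinates along an orbit *)

Lemma nondecreasing_of_derivative (f df : R -> R) a b : a <= b ->
  (forall t, a <= t <= b -> is_derive f t (df t)) ->
  (forall t, a <= t <= b -> 0 <= df t) -> f a <= f b.
Proof.
  intros Hab D P. destruct (MVT_gen f a b df) as (c & Hc & E).
  - rewrite Rmin_left, Rmax_right by assumption. intros; apply D; lra.
  - rewrite Rmin_left, Rmax_right by assumption. intros x Hx.
    apply continuity_pt_filterlim. eapply is_derive_continuous, D, Hx.
  - rewrite Rmin_left, Rmax_right in Hc by assumption. specialize (P c Hc).
    assert (0 <= df c * (b - a)) by (apply Rmult_le_pos; lra). lra.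
Qed.

Lemma increment_dominated (f df s ds : R -> R) A a b : a <= b ->
  (forall t, a <= t <= b -> is_derive f t (df t)) -> (forall t, a <= t <= b -> is_derive s t (ds t)) ->
  (forall t, a <= t <= b -> Rabs (df t) <= A * ds t) -> Rabs (f b - f a) <= A * (s b - s a).
Proof.
  intros Hab Df Ds H.
  assert (DA : forall t, a <= t <= b -> is_derive (fun t => A * s t) t (A * ds t)).
  { intros t Ht. exact (is_derive_scal _ t A _ (Ds t Ht)). }
  pose proof (nondecreasing_of_derivative (fun t => A * s t + f t) _ a b Hab
    (fun t Ht => is_derive_plus _ _ _ _ _ (DA t Ht) (Df t Ht))) as N1.
  pose proof (nondecreasing_of_derivative (fun t => A * s t - f t) _ a b Hab
    (fun t Ht => is_derive_minus _ _ _ _ _ (DA t Ht) (Df t Ht))) as N2.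
  cbv beta in N1, N2.
  assert (N1' : A * s a + f a <= A * s b + f b).
  { apply N1. intros t Ht. specialize (H t Ht). apply Rabs_le_between in H. unfold plus; simpl. lra. }
  assert (N2' : A * s a - f a <= A * s b - f b).
  { apply N2. intros t Ht. specialize (H t Ht). apply Rabs_le_between in H.
    unfold minus, plus, opp; simpl. lra. }
  apply Rabs_le_between. lra.
Qed.

Lemma continuous_eps (w : R -> R) x e : continuous w x -> 0 < e ->
  exists d, 0 < d /\ forall t, Rabs (t - x) < d -> Rabs (w t - w x) < e.
Proof.
  intros H He. destruct (proj1 (filterlim_locally w (w x)) H (mkposreal e He)) as [d Hd].
  exists d; split; [apply cond_pos|exact Hd].
Qed.

Lemma le_at_left_endpoint (w : R -> R) x t a : continuous w x -> x < t ->
  (forall s, x < s < t -> a <= w s) -> a <= w x.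
Proof.
  intros Hw Ht H. apply Rnot_lt_le; intros Hlt.
  destruct (continuous_eps w x (a - w x) Hw ltac:(lra)) as (d & Hd & Hw').
  set (s := x + Rmin d (t - x) / 2).
  assert (0 < Rmin d (t - x)) by (apply Rmin_glb_lt; lra).
  min_bounds.
  specialize (H s ltac:(unfold s; lra)).
  specialize (Hw' s ltac:(unfold s; rewrite Rabs_pos_eq; lra)).
  apply Rabs_def2 in Hw'. lra.
Qed.

Lemma ge_at_right_endpoint (w : R -> R) x t a : continuous w x -> t < x ->
  (forall s, t < s < x -> w s <= a) -> w x <= a.
Proof.
  intros Hw Ht H. apply Rnot_lt_le; intros Hlt.
  destruct (continuous_eps w x (w x - a) Hw ltac:(lra)) as (d & Hd & Hw').
  set (s := x - Rmin d (x - t) / 2).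
  assert (0 < Rmin d (x - t)) by (apply Rmin_glb_lt; lra).
  min_bounds.
  specialize (H s ltac:(unfold s; lra)).
  specialize (Hw' s ltac:(unfold s; rewrite Rabs_left; lra)).
  apply Rabs_def2 in Hw'. lra.
Qed.

(** Continuous induction: a bound that improves itself as long as [w] stays below [D] persists. *)
Lemma continuous_trap (w : R -> R) (T B D : R) : 0 < T ->
  (forall t, 0 <= t <= T -> continuous w t) -> w 0 <= B -> B < D ->
  (forall t1, 0 < t1 <= T -> (forall t, 0 < t < t1 -> w t < D) -> forall t, 0 < t < t1 -> w t <= B) ->
  forall t, 0 <= t <= T -> w t <= B.
Proof.
  intros HT Cw H0 HBD H.
  set (E := fun s => 0 <= s <= T /\ forall t, 0 <= t <= s -> w t < D).
  assert (E0 : E 0).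
  { split; [lra|]. intros t Ht; replace t with 0 by lra; lra. }
  destruct (completeness E) as [m [Hub Hlub]].
  { exists T; intros s [Hs _]; lra. }
  { now exists 0. }
  assert (Hm0 : 0 <= m) by now apply Hub.
  assert (HmT : m <= T) by (apply Hlub; intros s [Hs _]; lra).
  assert (Hlt : forall t, 0 <= t < m -> w t < D).
  { intros t Ht. apply Rnot_le_lt; intros Hle.
    assert (m <= t); [|lra]. apply Hlub. intros s [Hs Hs']. apply Rnot_lt_le; intros Hts.
    specialize (Hs' t ltac:(lra)); lra. }
  assert (HB : forall t, 0 <= t < m -> w t <= B).
  { intros t Ht. destruct (Req_dec t 0) as [->|]; [assumption|].
    apply (H m); [lra| |lra]. intros; apply Hlt; lra. }
  assert (HmB : w m <= B).
  { destruct (Req_dec m 0) as [->|]; [assumption|].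
    apply (ge_at_right_endpoint w m 0); [apply Cw; lra|lra|]. intros; apply HB; lra. }
  assert (m = T) as ->.
  { apply Rle_antisym; [assumption|]. apply Rnot_lt_le; intros HmT'.
    destruct (continuous_eps w m (D - w m) (Cw m ltac:(lra)) ltac:(lra)) as (d & Hd & Hw).
    set (m' := m + Rmin d (T - m) / 2).
    assert (0 < Rmin d (T - m)) by (apply Rmin_glb_lt; lra).
    min_bounds.
    assert (m' <= m); [|unfold m' in *; lra]. apply Hub. split; [unfold m'; lra|].
    intros t Ht. destruct (Rlt_le_dec t m) as [|Hmt]; [apply Hlt; lra|].
    specialize (Hw t ltac:(rewrite Rabs_pos_eq; unfold m' in *; lra)).
    apply Rabs_def2 in Hw; lra. }
  intros t Ht. destruct (Req_dec t T) as [->|]; [assumption|]. apply HB; lra.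
Qed.

Lemma continuous_trap_backward (w : R -> R) (T B D : R) : 0 < T ->
  (forall t, 0 <= t <= T -> continuous w t) -> w T <= B -> B < D ->
  (forall t1, 0 <= t1 < T -> (forall t, t1 < t < T -> w t < D) -> forall t, t1 < t < T -> w t <= B) ->
  forall t, 0 <= t <= T -> w t <= B.
Proof.
  intros HT Cw H0 HBD H.
  assert (H' : forall t, 0 <= t <= T -> w (T - t) <= B).
  { apply (continuous_trap (fun t => w (T - t)) T B D); try assumption.
    - intros t Ht. apply (continuous_comp (fun t => T - t) w); [|apply Cw; lra].
      apply (continuous_minus (fun _ => T) (fun t => t)); [apply continuous_const|apply continuous_id].
    - now rewrite Rminus_0_r.
    - intros t1 Ht1 Hin t Ht. apply (H (T - t1)); [lra| |lra].
      intros s Hs. replace s with (T - (T - s)) by ring. apply Hin; lra. }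
  intros t Ht. replace t with (T - (T - t)) by ring. apply H'; lra.
Qed.

Lemma endpoint_difference (f : R -> R) (T a b E : R) : 0 < T ->
  filterlim f (at_right 0) (locally a) -> filterlim f (at_left T) (locally b) ->
  (forall s t, 0 < s -> s < t -> t < T -> Rabs (f t - f s) <= E) -> Rabs (b - a) <= E.
Proof.
  intros HT Ha Hb H. apply Rnot_lt_le; intros Hlt.
  assert (He : 0 < (Rabs (b - a) - E) / 2) by lra.
  destruct (proj1 (filterlim_locally f a) Ha (mkposreal _ He)) as [da Hda].
  destruct (proj1 (filterlim_locally f b) Hb (mkposreal _ He)) as [db Hdb].
  set (s := Rmin da T / 3). set (t := T - Rmin db T / 3).
  pose proof (cond_pos da); pose proof (cond_pos db).
  assert (0 < Rmin da T) by (apply Rmin_glb_lt; lra).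
  assert (0 < Rmin db T) by (apply Rmin_glb_lt; lra).
  min_bounds.
  specialize (Hda s). specialize (Hdb t).
  assert (A : Rabs (f s - a) < (Rabs (b - a) - E) / 2).
  { apply Hda; [|unfold s; lra]. change (Rabs (s - 0) < da). rewrite Rabs_pos_eq; unfold s; lra. }
  assert (B : Rabs (f t - b) < (Rabs (b - a) - E) / 2).
  { apply Hdb; [|unfold t; lra]. change (Rabs (t - T) < db). rewrite Rabs_left; unfold t; lra. }
  specialize (H s t ltac:(unfold s; lra) ltac:(unfold s, t; lra) ltac:(unfold t; lra)).
  assert (Rabs (b - a) <= Rabs (f t - b) + (Rabs (f t - f s) + Rabs (f s - a))); [|lra].
  replace (b - a) with (- (f t - b) + ((f t - f s) + (f s - a))) by ring.
  triangle. rewrite Rabs_Ropp.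
  apply Rplus_le_compat_l, Rabs_triang.
Qed.

(** Signed polar coordinates: [r] carries the sign [sg] of the half-plane, and the angle stays in
    [(0, PI)] in both half-planes. *)
Definition signed_radius (sg x y : R) : R := sg * sqrt (x ^ 2 + y ^ 2).
Definition half_angle (x y : R) : R := PI / 2 - atan (x / y).

Lemma signed_radius_sqr sg x y : sg * sg = 1 -> signed_radius sg x y ^ 2 = x ^ 2 + y ^ 2.
Proof.
  intros Hs. unfold signed_radius. rewrite Rpow_mult_distr, pow2_sqrt; [|nra].
  replace (sg ^ 2) with (sg * sg) by ring. rewrite Hs; ring.
Qed.

Lemma half_angle_range x y : 0 < half_angle x y < PI.
Proof. unfold half_angle. pose proof (atan_bound (x / y)). lra. Qed.

Lemma signed_polar sg x y : sg * sg = 1 -> 0 < sg * y ->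
  signed_radius sg x y * cos (half_angle x y) = x /\ signed_radius sg x y * sin (half_angle x y) = y.
Proof.
  intros Hs Hy. assert (y <> 0) by (intros ->; lra).
  unfold half_angle, signed_radius. rewrite cos_shift, sin_shift, sin_atan, cos_atan.
  assert (E : sqrt (1 + (x / y)²) = sqrt (x ^ 2 + y ^ 2) / (sg * y)).
  { assert (Hsy : 0 < (sg * y) ^ 2) by (apply pow_lt; assumption).
    replace (1 + (x / y)²) with ((x ^ 2 + y ^ 2) / (sg * y) ^ 2).
    - rewrite sqrt_div_alt by assumption. f_equal. rewrite sqrt_pow2; lra.
    - rewrite Rpow_mult_distr. replace (sg ^ 2) with (sg * sg) by ring. rewrite Hs. unfold Rsqr; field; lra. }
  rewrite E. assert (0 < sqrt (x ^ 2 + y ^ 2)) by (apply sqrt_lt_R0; nra).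
  assert (sg <> 0) by (intros ->; lra).
  assert (1 = sg ^ 2) as Hs2 by (rewrite <- Hs; ring).
  split; field_simplify; try (repeat split; lra); rewrite <- Hs2; field.
Qed.

Lemma signed_radius_derive sg (u v : R -> R) t du dv : sg * sg = 1 -> 0 < sg * v t ->
  is_derive u t du -> is_derive v t dv ->
  is_derive (fun s => signed_radius sg (u s) (v s)) t
    (cos (half_angle (u t) (v t)) * du + sin (half_angle (u t) (v t)) * dv).
Proof.
  intros Hs Hv Du Dv. destruct (signed_polar sg (u t) (v t) Hs Hv) as [Ec Es].
  assert (Hp : 0 < u t ^ 2 + v t ^ 2).
  { assert (v t <> 0) by (intros E; rewrite E in Hv; lra). nra. }
  assert (Hq : 0 < sqrt (u t ^ 2 + v t ^ 2)) by now apply sqrt_lt_R0.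
  assert (D1 : is_derive (fun s => u s ^ 2 + v s ^ 2) t (2 * du * u t ^ 1 + 2 * dv * v t ^ 1)).
  { apply (is_derive_plus (V := R_NormedModule)).
    - apply (is_derive_pow u 2); assumption.
    - apply (is_derive_pow v 2); assumption. }
  pose proof (is_derive_sqrt _ _ _ D1 Hp) as D2.
  pose proof (is_derive_scal _ t sg _ D2) as D3.
  unfold signed_radius in Ec, Es. set (S := sqrt (u t ^ 2 + v t ^ 2)) in *.
  assert (Fc : cos (half_angle (u t) (v t)) = sg * u t / S).
  { rewrite <- Ec at 2. replace (sg * (sg * S * cos (half_angle (u t) (v t))) / S)
      with (sg * sg * cos (half_angle (u t) (v t))) by (field; lra). rewrite Hs; ring. }
  assert (Fs : sin (half_angle (u t) (v t)) = sg * v t / S).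
  { rewrite <- Es at 2. replace (sg * (sg * S * sin (half_angle (u t) (v t))) / S)
      with (sg * sg * sin (half_angle (u t) (v t))) by (field; lra). rewrite Hs; ring. }
  eapply eq_ind; [exact D3|]. rewrite Fc, Fs. fold S. simpl. field. lra.
Qed.

Lemma half_angle_derive sg (u v : R -> R) t du dv : sg * sg = 1 -> 0 < sg * v t ->
  is_derive u t du -> is_derive v t dv ->
  is_derive (fun s => half_angle (u s) (v s)) t
    ((cos (half_angle (u t) (v t)) * dv - sin (half_angle (u t) (v t)) * du) / signed_radius sg (u t) (v t)).
Proof.
  intros Hs Hv Du Dv. destruct (signed_polar sg (u t) (v t) Hs Hv) as [Ec Es].
  assert (Hv0 : v t <> 0) by (intros E; rewrite E in Hv; lra).
  assert (Hp : 0 < u t ^ 2 + v t ^ 2) by nra.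
  assert (Hr : signed_radius sg (u t) (v t) <> 0).
  { intros E. pose proof (signed_radius_sqr sg (u t) (v t) Hs) as E2. rewrite E in E2. nra. }
  pose proof (is_derive_div u v t du dv Du Dv Hv0) as D1.
  pose proof (is_derive_comp atan (fun s => u s / v s) t _ _ (is_derive_atan _) D1) as D2.
  pose proof (is_derive_minus (V := R_NormedModule) (fun _ => PI / 2) _ t _ _
    (is_derive_const (V := R_NormedModule) (PI / 2) t) D2) as D3.
  eapply eq_ind; [exact D3|]. unfold minus, plus, opp, zero, scal; simpl; unfold mult; simpl.
  set (r := signed_radius sg (u t) (v t)) in *.
  assert (Fc : cos (half_angle (u t) (v t)) = u t / r) by (apply (Rmult_eq_reg_l r); [rewrite Ec; field; assumption|assumption]).
  assert (Fs : sin (half_angle (u t) (v t)) = v t / r) by (apply (Rmult_eq_reg_l r); [rewrite Es; field; assumption|assumption]).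
  rewrite Fc, Fs. replace ((u t / r * dv - v t / r * du) / r) with ((u t * dv - v t * du) / r ^ 2) by (field; assumption).
  unfold r; rewrite signed_radius_sqr by assumption. unfold Rsqr. field. repeat split; try assumption; nra.
Qed.

(** The formula for the angle breaks down on the axis, so its limit there is recovered from the cosine. *)
Lemma angle_limit_0 {T : Type} (F : (T -> Prop) -> Prop) {FF : Filter F} (th : T -> R) :
  (forall s, 0 < th s < PI) -> filterlim (fun s => cos (th s)) F (locally 1) ->
  filterlim th F (locally 0).
Proof.
  intros Hth H. apply filterlim_locally; intros eps.
  set (e := Rmin eps (PI / 2)).
  assert (He : 0 < e) by (apply Rmin_glb_lt; [apply cond_pos|pose proof PI_RGT_0; lra]).
  assert (He1 : e <= PI / 2) by apply Rmin_r. assert (He2 : e <= eps) by apply Rmin_l.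
  pose proof PI_RGT_0 as HPI.
  assert (Hc : 0 < 1 - cos e).
  { rewrite <- cos_0. pose proof (cos_decreasing_1 0 e). lra. }
  pose proof (proj1 (filterlim_locally _ 1) H (mkposreal _ Hc)) as H'.
  eapply filter_imp; [|exact H']. intros s Hs.
  change (Rabs (cos (th s) - 1) < 1 - cos e) in Hs. change (Rabs (th s - 0) < eps).
  apply Rabs_def2 in Hs. rewrite Rminus_0_r, Rabs_pos_eq by (specialize (Hth s); lra).
  apply Rlt_le_trans with e; [|assumption].
  apply (cos_decreasing_0 e (th s)); specialize (Hth s); lra.
Qed.

Lemma angle_limit_PI {T : Type} (F : (T -> Prop) -> Prop) {FF : Filter F} (th : T -> R) :
  (forall s, 0 < th s < PI) -> filterlim (fun s => cos (th s)) F (locally (-1)) ->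
  filterlim th F (locally PI).
Proof.
  intros Hth H.
  assert (L : filterlim (fun s => PI - th s) F (locally 0)).
  { apply angle_limit_0; [assumption|intros s; specialize (Hth s); lra|].
    apply filterlim_locally; intros eps.
    pose proof (proj1 (filterlim_locally _ (-1)) H eps) as H'.
    eapply filter_imp; [|exact H']. intros s Hs. change (Rabs (cos (th s) - -1) < eps) in Hs.
    change (Rabs (cos (PI - th s) - 1) < eps).
    rewrite Rtrigo_facts.cos_pi_minus. replace (- cos (th s) - 1) with (- (cos (th s) - -1)) by ring.
    now rewrite Rabs_Ropp. }
  apply filterlim_locally; intros eps.
  pose proof (proj1 (filterlim_locally _ 0) L eps) as H'.
  eapply filter_imp; [|exact H']. intros s Hs. change (Rabs (PI - th s - 0) < eps) in Hs.
  change (Rabs (th s - PI) < eps). rewrite Rabs_minus_sym.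
  now replace (PI - th s) with (PI - th s - 0) by ring.
Qed.

(** * Half-turns around a focus *)

Lemma ge_at_left_endpoint (w : R -> R) x t a : continuous w x -> x < t ->
  (forall s, x < s < t -> w s <= a) -> w x <= a.
Proof.
  intros Hw Ht H. apply Ropp_le_cancel.
  apply (le_at_left_endpoint (fun s => - w s) x t); [|assumption|].
  - now apply (continuous_opp w).
  - intros s Hs; apply Ropp_le_contravar; auto.
Qed.

Lemma le_at_right_endpoint (w : R -> R) x t a : continuous w x -> t < x ->
  (forall s, t < s < x -> a <= w s) -> a <= w x.
Proof.
  intros Hw Ht H. apply Ropp_le_cancel.
  apply (ge_at_right_endpoint (fun s => - w s) x t); [|assumption|].
  - now apply (continuous_opp w).
  - intros s Hs; apply Ropp_le_contravar; auto.
Qed.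

Lemma exp_monotone x y : x <= y -> exp x <= exp y.
Proof. intros [H|H]; [now apply Rlt_le, exp_increasing|subst; lra]. Qed.

Lemma continuous_at_right (w : R -> R) x : continuous w x -> filterlim w (at_right x) (locally (w x)).
Proof. intros H P HP. specialize (H P HP). now apply filter_le_within. Qed.

Lemma continuous_at_left (w : R -> R) x : continuous w x -> filterlim w (at_left x) (locally (w x)).
Proof. intros H P HP. specialize (H P HP). now apply filter_le_within. Qed.

Definition solves_on (F : vector_field) (T : R) (u v : R -> R) : Prop :=
  forall t, 0 <= t <= T -> is_derive u t (vX F (u t) (v t)) /\ is_derive v t (vY F (u t) (v t)).

Lemma polar_rates F T u v sg t : solves_on F T u v -> sg * sg = 1 -> 0 <= t <= T -> 0 < sg * v t ->
  let r := fun s => signed_radius sg (u s) (v s) in let th := fun s => half_angle (u s) (v s) in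
  is_derive r t (radial_speed F (r t) (th t)) /\ is_derive th t (angular_speed F (r t) (th t)).
Proof.
  intros Hsol Hs Ht Hv r th. destruct (Hsol t Ht) as [Du Dv].
  destruct (signed_polar sg (u t) (v t) Hs Hv) as [Ec Es].
  unfold radial_speed, angular_speed, r, th. rewrite Ec, Es. split.
  - now apply signed_radius_derive.
  - now apply half_angle_derive.
Qed.

Lemma endpoint_on_axis F T u v sg t : solves_on F T u v -> sg * sg = 1 -> 0 <= t <= T ->
  v t = 0 -> u t <> 0 ->
  let r := fun s => signed_radius sg (u s) (v s) in
  continuous r t /\ r t = sg * Rabs (u t) /\ continuous (fun s => u s / r s) t.
Proof.
  intros Hsol Hs Ht Hv Hu r. destruct (Hsol t Ht) as [Du Dv].
  assert (Hp : 0 < u t ^ 2 + v t ^ 2) by nra.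
  assert (Cr : continuous r t).
  { assert (D1 : is_derive (fun s => u s ^ 2 + v s ^ 2) t
      (INR 2 * vX F (u t) (v t) * u t ^ 1 + INR 2 * vY F (u t) (v t) * v t ^ 1)).
    { apply (is_derive_plus (V := R_NormedModule)).
      - apply (is_derive_pow u 2); assumption.
      - apply (is_derive_pow v 2); assumption. }
    pose proof (is_derive_sqrt _ _ _ D1 Hp) as D2.
    eapply is_derive_continuous. exact (is_derive_scal _ t sg _ D2). }
  assert (Er : r t = sg * Rabs (u t)).
  { unfold r, signed_radius. rewrite Hv. f_equal. rewrite <- sqrt_Rsqr_abs. f_equal. unfold Rsqr; ring. }
  split; [assumption|]. split; [assumption|].
  apply (continuous_mult u (fun s => / r s)); [eapply is_derive_continuous, Du|].
  apply continuous_Rinv_comp; [assumption|]. rewrite Er.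
  apply Rmult_integral_contrapositive_currified; [intros E; rewrite E in Hs; lra|now apply Rabs_no_R0].
Qed.

(** Since [abs r' <= K * abs r * th'], the logarithm of [r ^ 2] varies by at most [2 * K * PI]: this traps
    the orbit near O, starting from whichever endpoint [z] is known to be small.  Then the first integral varies by at
    most the rate bound times the total angle. *)
Lemma half_arc F M l lam s delta K sg T u v z :
  focal_integral F M l lam s delta K -> solves_on F T u v -> sg * sg = 1 -> 0 < T ->
  v 0 = 0 -> v T = 0 -> (forall t, 0 < t < T -> 0 < sg * v t) -> 0 < sg * u 0 ->
  (z = u 0 \/ z = u T) -> exp (K * PI) * Rabs z < delta ->
  sg * u T < 0 /\ Rabs (u T) <= exp (K * PI) * Rabs (u 0) /\ Rabs (u 0) <= exp (K * PI) * Rabs (u T) /\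
  Rabs (Ival l (- u T) PI - u 0) <= K * PI * (exp (K * PI) * Rabs z) ^ M.
Proof.
  intros [Fl F0 Flam Fs Ff Fd FK Fr] Hsol Hs HT v0 vT Hv u0 Hz Hzd.
  set (E := exp (K * PI)) in *. assert (HE : 0 < E) by apply exp_pos.
  pose proof PI_RGT_0 as HPI.
  set (r := fun t => signed_radius sg (u t) (v t)). set (th := fun t => half_angle (u t) (v t)).
  set (w := fun t => u t ^ 2 + v t ^ 2).
  assert (Hth : forall t, 0 < th t < PI) by (intros; apply half_angle_range).
  assert (Hrw : forall t, r t ^ 2 = w t) by (intros; now apply signed_radius_sqr).
  assert (Hd : forall t, 0 < t < T -> is_derive r t (radial_speed F (r t) (th t)) /\
    is_derive th t (angular_speed F (r t) (th t))).
  { intros t Ht. apply (polar_rates F T u v sg t); auto. lra. }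
  assert (Hr0 : forall t, 0 < t < T -> r t <> 0).
  { intros t Ht E0. specialize (Hrw t). rewrite E0 in Hrw. specialize (Hv t Ht). unfold w in Hrw. nra. }
  assert (Cw : forall t, 0 <= t <= T -> continuous w t).
  { intros t Ht. destruct (Hsol t Ht) as [Du Dv].
    apply (continuous_plus (fun t => u t ^ 2) (fun t => v t ^ 2)); apply continuous_pow_R;
      eapply is_derive_continuous; eassumption. }
  assert (Hsmall : forall t, w t < delta ^ 2 -> Rabs (r t) < delta).
  { intros t Ht. rewrite <- Hrw, <- pow2_abs in Ht. apply Rnot_le_lt; intros Hle.
    pose proof (Rabs_pos (r t)). nra. }
  assert (Hcmp : forall a b, 0 < a -> a <= b -> b < T -> (forall t, a <= t <= b -> w t < delta ^ 2) ->
    w b <= E ^ 2 * w a /\ w a <= E ^ 2 * w b).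
  { intros a b Ha Hab Hb Hin.
    assert (Hwp : forall t, a <= t <= b -> 0 < w t).
    { intros t Ht. rewrite <- Hrw. apply pow2_gt_0, Hr0; lra. }
    assert (HL : Rabs (ln (w b) - ln (w a)) <= 2 * K * (th b - th a)).
    { apply (increment_dominated (fun t => ln (w t)) (fun t => 2 * r t * radial_speed F (r t) (th t) / w t)
        th (fun t => angular_speed F (r t) (th t))); [assumption| | |].
      - intros t Ht. destruct (Hd t ltac:(lra)) as [Dr _].
        apply (is_derive_ext (fun t => ln (r t ^ 2))); [intros; now rewrite Hrw|].
        rewrite <- (Hrw t).
        assert (Hp : 0 < r t ^ 2) by (rewrite Hrw; auto).
        eapply eq_ind; [exact (is_derive_comp ln _ t _ _ (is_derive_ln _ Hp) (is_derive_pow r 2 t _ Dr))|].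
        unfold scal; simpl; unfold mult; simpl. field. apply Hr0; lra.
      - intros t Ht; apply Hd; lra.
      - intros t Ht. destruct (Fr (r t) (th t) (Hr0 t ltac:(lra)) (Hsmall t (Hin t Ht))
          (conj (Rlt_le _ _ (proj1 (Hth t))) (Rlt_le _ _ (proj2 (Hth t))))) as (_ & B & _).
        pose proof (Rabs_pos_lt _ (Hr0 t ltac:(lra))) as Hr.
        rewrite <- Hrw, <- (pow2_abs (r t)). unfold Rdiv.
        rewrite !Rabs_mult, (Rabs_pos_eq 2), (Rabs_pos_eq (/ _)) by
          (try apply Rlt_le, Rinv_0_lt_compat, pow_lt; lra).
        apply Rmult_le_reg_r with (Rabs (r t)); [assumption|].
        replace (2 * Rabs (r t) * Rabs (radial_speed F (r t) (th t)) * / Rabs (r t) ^ 2 * Rabs (r t))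
          with (2 * Rabs (radial_speed F (r t) (th t))) by (field; lra). lra. }
    assert (HE2 : E ^ 2 = exp (2 * K * PI)).
    { unfold E. simpl. rewrite Rmult_1_r, <- exp_plus. f_equal; ring. }
    assert (Hle : 2 * K * (th b - th a) <= 2 * K * PI).
    { apply Rmult_le_compat_l; [lra|]. pose proof (Hth a); pose proof (Hth b); lra. }
    apply Rabs_le_between in HL.
    rewrite <- (exp_ln (w a)), <- (exp_ln (w b)), HE2, <- !exp_plus by (apply Hwp; lra).
    split; apply exp_monotone; lra. }
  assert (HE2 : 0 < E ^ 2) by now apply pow_lt.
  assert (HB : E ^ 2 * z ^ 2 < delta ^ 2).
  { rewrite <- (pow2_abs z). pose proof (Rabs_pos z). assert (0 <= E * Rabs z) by nra.
    simpl; nra. }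
  assert (W0 : w 0 = u 0 ^ 2) by (unfold w; rewrite v0; ring).
  assert (WT : w T = u T ^ 2) by (unfold w; rewrite vT; ring).
  assert (Hdiv : forall a b, a <= E ^ 2 * b <-> a / E ^ 2 <= b).
  { intros a b. rewrite Rmult_comm. symmetry. apply Rle_div_l; assumption. }
  assert (E1 : 1 <= E ^ 2).
  { unfold E. simpl. rewrite Rmult_1_r, <- exp_plus, <- exp_0. apply exp_monotone. nra. }
  (* The orbit stays close to O: its radius is comparable to the radius at the known endpoint. *)
  assert (Hw : forall t, 0 <= t <= T -> w t <= E ^ 2 * z ^ 2).
  { destruct Hz as [->| ->].
    - apply (continuous_trap w T _ (delta ^ 2)); try assumption.
      + rewrite W0. pose proof (pow2_ge_0 (u 0)). nra.
      + intros t1 Ht1 Hin t Ht. apply Hdiv. rewrite <- W0.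
        apply (le_at_left_endpoint w 0 t); [apply Cw; lra|lra|]. intros a Ha. apply Hdiv.
        apply (Hcmp a t); try lra. intros; apply Hin; lra.
    - apply (continuous_trap_backward w T _ (delta ^ 2)); try assumption.
      + rewrite WT. pose proof (pow2_ge_0 (u T)). nra.
      + intros t1 Ht1 Hin t Ht. apply Hdiv. rewrite <- WT.
        apply (le_at_right_endpoint w T t); [apply Cw; lra|lra|]. intros b Hb. apply Hdiv.
        apply (Hcmp t b); try lra. intros; apply Hin; lra. }
  assert (Hin : forall t, 0 <= t <= T -> w t < delta ^ 2) by (intros t Ht; specialize (Hw t Ht); lra).
  assert (H0T : w T <= E ^ 2 * w 0).
  { apply (ge_at_right_endpoint w T 0); [apply Cw; lra|lra|]. intros t Ht. apply Hdiv.
    apply (le_at_left_endpoint w 0 t); [apply Cw; lra|lra|]. intros a Ha. apply Hdiv.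
    apply (Hcmp a t); try lra. intros; apply Hin; lra. }
  assert (HT0 : w 0 <= E ^ 2 * w T).
  { apply (ge_at_left_endpoint w 0 T); [apply Cw; lra|lra|]. intros t Ht. apply Hdiv.
    apply (le_at_right_endpoint w T t); [apply Cw; lra|lra|]. intros a Ha. apply Hdiv.
    apply (Hcmp t a); try lra. intros; apply Hin; lra. }
  assert (Hsq : forall a b, a ^ 2 <= E ^ 2 * b ^ 2 -> Rabs a <= E * Rabs b).
  { intros a b Hab. rewrite <- (pow2_abs a), <- (pow2_abs b) in Hab.
    apply Rnot_lt_le; intros Hlt. pose proof (Rabs_pos a); pose proof (Rabs_pos b).
    assert (0 <= E * Rabs b) by nra. simpl in Hab. nra. }
  rewrite W0, WT in H0T, HT0.
  assert (HuT : u T <> 0).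
  { intros E0. rewrite E0 in HT0. assert (u 0 <> 0) by (intros E0'; rewrite E0' in u0; lra). nra. }
  assert (Hu0 : u 0 <> 0) by (intros E0'; rewrite E0' in u0; lra).
  destruct (endpoint_on_axis F T u v sg 0 Hsol Hs ltac:(lra) v0 Hu0) as (Cr0 & Er0 & Cc0).
  destruct (endpoint_on_axis F T u v sg T Hsol Hs ltac:(lra) vT HuT) as (CrT & ErT & CcT).
  fold r in Cr0, CrT. change (r 0 = sg * Rabs (u 0)) in Er0. change (r T = sg * Rabs (u T)) in ErT.
  change (continuous (fun t => u t / r t) 0) in Cc0. change (continuous (fun t => u t / r t) T) in CcT.
  assert (Hcos : forall t, 0 < t < T -> u t / r t = cos (th t)).
  { intros t Ht. destruct (signed_polar sg (u t) (v t) Hs (Hv t Ht)) as [Ec _].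
    change (r t * cos (th t) = u t) in Ec. rewrite <- Ec. field. now apply Hr0. }
  assert (Habs : forall x, 0 < sg * x -> sg * Rabs x = x).
  { intros x Hx. assert (Rabs x = sg * x) as ->.
    { rewrite <- (Rabs_pos_eq (sg * x)) by lra. rewrite Rabs_mult.
      assert (Rabs sg = 1) as ->; [|ring]. 
      assert (Rabs sg * Rabs sg = 1) by (rewrite <- Rabs_mult, Hs; apply Rabs_R1).
      pose proof (Rabs_pos sg). nra. }
    rewrite <- Rmult_assoc, Hs; ring. }
  assert (Lc0 : filterlim (fun t => cos (th t)) (at_right 0) (locally 1)).
  { apply (filterlim_ext_loc (fun t => u t / r t)).
    - exists (mkposreal T HT). intros t Ht Ht'. apply Hcos. split; [assumption|].
      change (Rabs (t - 0) < T) in Ht. apply Rabs_def2 in Ht. lra.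
    - replace 1 with (u 0 / r 0) by (rewrite Er0, Habs by assumption; field; assumption).
      exact (continuous_at_right _ _ Cc0). }
  assert (LcT : filterlim (fun t => cos (th t)) (at_left T) (locally (u T / r T))).
  { apply (filterlim_ext_loc (fun t => u t / r t)).
    - exists (mkposreal T HT). intros t Ht Ht'. apply Hcos. split; [|assumption].
      change (Rabs (t - T) < T) in Ht. apply Rabs_def2 in Ht. lra.
    - exact (continuous_at_left _ _ CcT). }
  assert (Lth0 : filterlim th (at_right 0) (locally 0)).
  { apply (angle_limit_0 (at_right 0) th); assumption. }
  assert (Hang : forall t, 0 < t < T -> 0 < angular_speed F (r t) (th t) /\
    Rabs (Irad l (r t) (th t) * radial_speed F (r t) (th t) + Iang l (r t) (th t) * angular_speed F (r t) (th t))
      <= K * (E * Rabs z) ^ M * angular_speed F (r t) (th t)).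
  { intros t Ht. destruct (Fr (r t) (th t) (Hr0 t Ht) (Hsmall t (Hin t ltac:(lra)))
      (conj (Rlt_le _ _ (proj1 (Hth t))) (Rlt_le _ _ (proj2 (Hth t))))) as (A & _ & B).
    split; [assumption|]. eapply Rle_trans; [exact B|]. apply Rmult_le_compat_r; [lra|].
    apply Rmult_le_compat_l; [assumption|]. apply pow_incr. split; [apply Rabs_pos|].
    apply Hsq. rewrite Hrw. apply Hw; lra. }
  assert (Hinc : forall a b, 0 < a -> a <= b -> b < T -> th a <= th b).
  { intros a b Ha Hab Hb. apply (nondecreasing_of_derivative th (fun t => angular_speed F (r t) (th t)) a b Hab).
    - intros t Ht; apply Hd; lra.
    - intros t Ht; apply Rlt_le, Hang; lra. }
  (* The angle increases from 0, so the orbit cannot return to the half-axis it started from. *)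
  assert (HsT : sg * u T < 0).
  { apply Rnot_le_lt; intros Hle.
    assert (Hpos : 0 < sg * u T).
    { destruct Hle as [|E0]; [assumption|]. exfalso. symmetry in E0.
      apply Rmult_integral in E0 as [E0|E0]; [rewrite E0 in Hs; lra|now apply HuT]. }
    assert (L : filterlim th (at_left T) (locally 0)).
    { apply (angle_limit_0 (at_left T) th); [assumption|].
      replace 1 with (u T / r T); [assumption|]. rewrite ErT, Habs by assumption. field; assumption. }
    assert (Hhalf : 0 < th (T / 2)) by apply Hth.
    destruct (proj1 (filterlim_locally _ 0) L (mkposreal _ Hhalf)) as [d Hd'].
    set (t := T - Rmin d T / 4).
    pose proof (cond_pos d). assert (0 < Rmin d T) by (apply Rmin_glb_lt; lra).
    min_bounds.
    assert (Hball : Rabs (th t - 0) < th (T / 2)).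
    { apply Hd'; [|unfold t; lra]. change (Rabs (t - T) < d). rewrite Rabs_left; unfold t; lra. }
    specialize (Hinc (T / 2) t ltac:(lra) ltac:(unfold t; lra) ltac:(unfold t; lra)).
    rewrite Rminus_0_r, Rabs_pos_eq in Hball by (specialize (Hth t); lra). lra. }
  assert (ErT' : r T = - u T).
  { rewrite ErT, <- Rabs_Ropp. apply Habs. lra. }
  assert (LthT : filterlim th (at_left T) (locally PI)).
  { apply (angle_limit_PI (at_left T) th); [assumption|].
    replace (-1) with (u T / r T); [assumption|]. rewrite ErT'. field; assumption. }
  split; [assumption|]. split; [now apply Hsq|]. split; [now apply Hsq|].
  rewrite <- (F0 (u 0)) at 1.
  apply (endpoint_difference (fun t => Ival l (r t) (th t)) T); [assumption| | |].
  - apply (Ival_limit 1 l (at_right 0)); try assumption.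
    rewrite <- (Habs (u 0)), <- Er0 by assumption.
    exact (continuous_at_right _ _ Cr0).
  - apply (Ival_limit 1 l (at_left T)); try assumption. rewrite <- ErT'.
    exact (continuous_at_left _ _ CrT).
  - intros a b Ha Hab Hb. set (A := K * (E * Rabs z) ^ M) in *.
    apply Rle_trans with (A * (th b - th a)).
    + apply (increment_dominated (fun t => Ival l (r t) (th t)) (fun t => Irad l (r t) (th t) * radial_speed F (r t) (th t)
        + Iang l (r t) (th t) * angular_speed F (r t) (th t)) th (fun t => angular_speed F (r t) (th t)));
        [lra| | |intros t Ht; apply Hang; lra].
      * intros t Ht. destruct (Hd t ltac:(lra)) as [Dr Dth]. now apply (Ival_derive 1).
      * intros t Ht. apply Hd; lra.
    + assert (HA0 : 0 <= A).
      { apply Rmult_le_pos; [assumption|]. apply pow_le, Rmult_le_pos; [lra|apply Rabs_pos]. }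
      replace (K * PI * (E * Rabs z) ^ M) with (A * PI) by (unfold A; ring).
      pose proof (Hth a); pose proof (Hth b). apply Rmult_le_compat_l; lra.
Qed.

(** * Jets of the half-return maps of a focus *)

Lemma derive_nonneg_of_positive_after (f : R -> R) (x t D : R) : is_derive f x D -> f x = 0 -> x < t ->
  (forall s, x < s < t -> 0 < f s) -> 0 <= D.
Proof.
  intros HD H0 Ht H. apply Rnot_lt_le; intros Hlt.
  apply is_derive_Reals in HD. destruct (HD (- D) ltac:(lra)) as [[d Hd] Hd']. simpl in Hd'.
  set (h := Rmin d (t - x) / 2). assert (0 < Rmin d (t - x)) by (apply Rmin_glb_lt; lra).
  min_bounds.
  specialize (H (x + h) ltac:(unfold h; lra)).
  specialize (Hd' h ltac:(unfold h; lra) ltac:(rewrite Rabs_pos_eq; unfold h; lra)).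
  rewrite H0, Rminus_0_r in Hd'. apply Rabs_def2 in Hd'.
  assert (0 < f (x + h) / h) by (apply Rdiv_lt_0_compat; unfold h in *; lra). lra.
Qed.

Lemma derive_nonneg_of_negative_before (f : R -> R) (x t D : R) : is_derive f x D -> f x = 0 -> t < x ->
  (forall s, t < s < x -> f s < 0) -> 0 <= D.
Proof.
  intros HD H0 Ht H.
  assert (DG : is_derive (fun s => - f (2 * x - s)) x D).
  { assert (D1 : is_derive (fun s => 2 * x - s) x (0 - 1)).
    { apply (is_derive_minus (V := R_NormedModule) (fun _ => 2 * x) (fun s => s));
        [apply (is_derive_const (V := R_NormedModule))|apply (is_derive_id (K := R_AbsRing))]. }
    assert (HD' : is_derive f (2 * x - x) D) by (now replace (2 * x - x) with x by ring).
    eapply eq_ind; [exact (is_derive_opp _ _ _ (is_derive_comp f _ x _ _ HD' D1))|].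
    change (- ((0 - 1) * D) = D). ring. }
  apply (derive_nonneg_of_positive_after _ x (2 * x - t) D DG); [|lra|].
  - replace (2 * x - x) with x by ring. rewrite H0; ring.
  - intros s Hs. specialize (H (2 * x - s) ltac:(lra)). lra.
Qed.

(** The real and imaginary parts [W1], [W2] of the characteristic polynomial at the eigenvalue vanish. *)
Lemma complex_eigenvalue_discriminant a b c d alpha beta : beta <> 0 ->
  eigenvalue a b c d (alpha, beta) -> (d - a) ^ 2 + 4 * b * c < 0.
Proof.
  intros Hb ([p1 p2] & [q1 q2] & Hn & E1 & E2).
  unfold RtoC, Cmult, Cplus in E1, E2; simpl in E1, E2.
  injection E1 as E11 E12. injection E2 as E21 E22.
  set (A := a - alpha). set (D := d - alpha).
  assert (F11 : A * p1 + beta * p2 + b * q1 = 0) by (unfold A; lra).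
  assert (F12 : A * p2 - beta * p1 + b * q2 = 0) by (unfold A; lra).
  assert (F21 : c * p1 + D * q1 + beta * q2 = 0) by (unfold D; lra).
  assert (F22 : c * p2 + D * q2 - beta * q1 = 0) by (unfold D; lra).
  set (W1 := A * D - beta ^ 2 - b * c). set (W2 := beta * (A + D)).
  assert (P1 : W1 * p1 + W2 * p2 = 0).
  { replace (W1 * p1 + W2 * p2) with (D * (A * p1 + beta * p2 + b * q1) + beta * (A * p2 - beta * p1 + b * q2)
      - b * (c * p1 + D * q1 + beta * q2)) by (unfold W1, W2; ring). rewrite F11, F12, F21; ring. }
  assert (P2 : W1 * p2 - W2 * p1 = 0).
  { replace (W1 * p2 - W2 * p1) with (D * (A * p2 - beta * p1 + b * q2) - beta * (A * p1 + beta * p2 + b * q1)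
      - b * (c * p2 + D * q2 - beta * q1)) by (unfold W1, W2; ring). rewrite F11, F12, F22; ring. }
  assert (Q1 : W1 * q1 + W2 * q2 = 0).
  { replace (W1 * q1 + W2 * q2) with (A * (c * p1 + D * q1 + beta * q2) + beta * (c * p2 + D * q2 - beta * q1)
      - c * (A * p1 + beta * p2 + b * q1)) by (unfold W1, W2; ring). rewrite F11, F22, F21; ring. }
  assert (Q2 : W1 * q2 - W2 * q1 = 0).
  { replace (W1 * q2 - W2 * q1) with (A * (c * p2 + D * q2 - beta * q1) - beta * (c * p1 + D * q1 + beta * q2)
      - c * (A * p2 - beta * p1 + b * q2)) by (unfold W1, W2; ring). rewrite F12, F22, F21; ring. }
  assert (HP : (W1 ^ 2 + W2 ^ 2) * (p1 ^ 2 + p2 ^ 2) = 0).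
  { replace ((W1 ^ 2 + W2 ^ 2) * (p1 ^ 2 + p2 ^ 2))
      with ((W1 * p1 + W2 * p2) ^ 2 + (W1 * p2 - W2 * p1) ^ 2) by ring. rewrite P1, P2; ring. }
  assert (HQ : (W1 ^ 2 + W2 ^ 2) * (q1 ^ 2 + q2 ^ 2) = 0).
  { replace ((W1 ^ 2 + W2 ^ 2) * (q1 ^ 2 + q2 ^ 2))
      with ((W1 * q1 + W2 * q2) ^ 2 + (W1 * q2 - W2 * q1) ^ 2) by ring. rewrite Q1, Q2; ring. }
  assert (HW : W1 ^ 2 + W2 ^ 2 = 0).
  { apply Rmult_integral in HP as [|HP]; [assumption|].
    apply Rmult_integral in HQ as [|HQ]; [assumption|]. exfalso; apply Hn.
    assert (p1 = 0) by nra. assert (p2 = 0) by nra. assert (q1 = 0) by nra. assert (q2 = 0) by nra.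
    now subst. }
  assert (W1 = 0) as HW1 by nra. assert (W2 = 0) as HW2 by nra.
  unfold W2 in HW2. apply Rmult_integral in HW2 as [|HW2]; [contradiction|].
  unfold W1 in HW1. assert (D = - A) as ED by lra. rewrite ED in HW1.
  assert (0 < beta ^ 2) by (apply pow2_gt_0; assumption).
  replace (d - a) with (D - A) by (unfold A, D; ring). rewrite ED. nra.
Qed.

Lemma rotation_form_positive a b c d th : (d - a) ^ 2 + 4 * b * c < 0 -> 0 < c ->
  0 < rotation_form a b c d th.
Proof.
  intros Hd Hc. unfold rotation_form. pose proof (sin2_cos2 th) as HS. unfold Rsqr in HS.
  set (S := sin th) in *. set (C := cos th) in *.
  apply Rmult_lt_reg_l with (4 * c); [lra|]. rewrite Rmult_0_r.
  replace (4 * c * (C * (c * C + d * S) - S * (a * C + b * S)))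
    with ((2 * c * C + (d - a) * S) ^ 2 + - ((d - a) ^ 2 + 4 * b * c) * S ^ 2) by ring.
  pose proof (pow2_ge_0 (2 * c * C + (d - a) * S)).
  destruct (Req_dec S 0) as [E|E].
  - rewrite E in *. assert (C <> 0) by (intros E'; rewrite E' in HS; lra).
    replace (2 * c * C + (d - a) * 0) with (2 * c * C) by ring.
    assert (0 < (2 * c * C) ^ 2); [|lra]. apply pow2_gt_0.
    repeat apply Rmult_integral_contrapositive_currified; lra.
  - assert (0 < S ^ 2) by (apply pow2_gt_0; assumption). nra.
Qed.

(** The existence of half-returns on one half-axis is enough to fix the sense of rotation. *)
Definition enters_counterclockwise (F : vector_field) : Prop :=
  exists d, 0 < d /\ ((forall x, 0 < x < d -> exists x1, Pi_plus F x x1) \/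
    (forall x, - d < x < 0 -> exists x1, Pi_minus F x x1)).

Lemma axis_slope_nonneg F c d : vY F 0 0 = 0 -> expands_at_O (vY F) c d ->
  enters_counterclockwise F -> 0 <= c.
Proof.
  intros Y0 EY (e & He & Hent). apply Rnot_lt_le; intros Hc.
  destruct (EY 2%nat) as (l & C & dl & Hl & Hdl & Hdl1 & HC & HY).
  destruct (meval_bound 2 l Hl) as (B & HB & HB').
  set (x := Rmin (Rmin e dl) (- c / (C + B + 1)) / 2).
  assert (Hm : 0 < Rmin (Rmin e dl) (- c / (C + B + 1))).
  { repeat apply Rmin_glb_lt; try lra. apply Rdiv_lt_0_compat; lra. }
  min_bounds.
  assert (Hx : 0 < x) by (unfold x; lra).
  assert (Hsmall : x * (C + B + 1) < - c).
  { apply Rlt_div_r; unfold x; lra. }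
  assert (HYx : forall z, Rabs z = x -> Rabs (vY F z 0 - c * z) <= (C + B) * x ^ 2).
  { intros z Hz. specialize (HY z 0 x ltac:(lra) ltac:(rewrite Rabs_R0; lra) ltac:(unfold x; lra)).
    specialize (HB' z 0 x ltac:(lra) ltac:(rewrite Rabs_R0; lra) ltac:(unfold x; lra)).
    rewrite Y0 in HY.
    replace (vY F z 0 - c * z) with ((vY F z 0 - (0 + c * z + d * 0 + meval l z 0)) + meval l z 0) by ring.
    triangle. lra. }
  destruct Hent as [Hin|Hin].
  - destruct (Hin x ltac:(unfold x; lra)) as (x1 & T & u & v & HT & Hsol & u0 & v0 & Hv & _).
    destruct (Hsol 0 ltac:(lra)) as [_ Dv]. rewrite u0, v0 in Dv.
    pose proof (derive_nonneg_of_positive_after v 0 T _ Dv v0 HT Hv) as Hpos.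
    specialize (HYx x ltac:(apply Rabs_pos_eq; lra)). apply Rabs_le_between in HYx. simpl in HYx. nra.
  - destruct (Hin (- x) ltac:(unfold x; lra)) as (x1 & T & u & v & HT & Hsol & u0 & v0 & Hv & _).
    destruct (Hsol 0 ltac:(lra)) as [_ Dv]. rewrite u0, v0 in Dv.
    assert (Hneg : 0 <= - vY F (- x) 0).
    { apply (derive_nonneg_of_positive_after (fun t => - v t) 0 T).
      - exact (is_derive_opp _ _ _ Dv). - rewrite v0; ring. - assumption.
      - intros s Hs; specialize (Hv s Hs); cbv beta in Hv; lra. }
    specialize (HYx (- x) ltac:(rewrite Rabs_Ropp; apply Rabs_pos_eq; lra)).
    apply Rabs_le_between in HYx. simpl in HYx. nra.
Qed.

(** In both definitions [q] is the jet of the inverse of a half-return map.  The inverse of [Pi_plus] lives at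
    [0-], so it is tested at the return point [y]; that of [Pi_minus] lives at [0+]. *)
Definition plus_jet (F : vector_field) (n : nat) (q : R -> R) : Prop :=
  exists C d, 0 <= C /\ 0 < d /\ forall x y, 0 < x < d -> Pi_plus F x y ->
    Rabs y <= C * x /\ Rabs (q y - x) <= C * x ^ n.

Definition minus_jet (F : vector_field) (n : nat) (q : R -> R) : Prop :=
  exists C d, 0 <= C /\ 0 < d /\ forall x x0, 0 < x < d -> x0 < 0 -> Pi_minus F x0 x ->
    Rabs (x0 - q x) <= C * x ^ n.

(** The half-turn with [sg = 1] is followed from its small starting point, the one with [sg = -1] backward
    from its small end point; both use the same [q]. *)
Lemma focus_half_return_jet F : analytic_field F -> is_focus F -> enters_counterclockwise F ->
  forall n, exists q lam, 0 < lam /\ tangent_to_line lam q /\ plus_jet F n q /\ minus_jet F n q.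
Proof.
  intros [AX AY] (X0 & Y0 & alpha & beta & Hbeta & [HJ _]) Hent N. cbv zeta in HJ.
  destruct (analytic_expansion _ AX) as (a & b & EX).
  destruct (analytic_expansion _ AY) as (c & d & EY).
  destruct (analytic_partial_derivatives _ a b EX) as [Ea Eb].
  destruct (analytic_partial_derivatives _ c d EY) as [Ec Ed].
  rewrite Ea, Eb, Ec, Ed in HJ. apply complex_eigenvalue_discriminant in HJ; [|assumption].
  assert (Hc : 0 < c).
  { pose proof (axis_slope_nonneg F c d Y0 EY Hent) as Hc. destruct Hc as [|<-]; [assumption|].
    exfalso. pose proof (pow2_ge_0 (d - a)). lra. }
  destruct (focal_integral_exists F a b c d X0 Y0 EX EY (fun th => rotation_form_positive a b c d th HJ Hc) N)
    as (l & lam & s & delta & K & FI).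
  pose proof (fi_slope _ _ _ _ _ _ _ FI) as Hlam. pose proof (fi_poly _ _ _ _ _ _ _ FI) as Hs.
  pose proof (fi_final _ _ _ _ _ _ _ FI) as Hfin. pose proof (fi_delta _ _ _ _ _ _ _ FI) as Hdelta.
  pose proof (fi_K _ _ _ _ _ _ _ FI) as HK.
  set (E := exp (K * PI)). assert (HE : 0 < E) by apply exp_pos. pose proof PI_RGT_0.
  assert (HKE : 0 <= K * PI * E ^ N).
  { apply Rmult_le_pos; [nra|]. apply pow_le; lra. }
  assert (Hdx : forall x, 0 < x < delta / E -> E * Rabs x < delta).
  { intros x Hx. rewrite Rabs_pos_eq by lra. replace delta with (E * (delta / E)) by (field; lra).
    apply Rmult_lt_compat_l; lra. }
  exists (fun y => Ival l (- y) PI), lam.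
  split; [assumption|]. split.
  { exists (fun y => s (- y)). split.
    - apply (poly_comp s); [exact Hs|]. apply (poly_ext (fun y => -1 * y)); [intros; ring|]. apply poly_scal, poly_id.
    - intros y; rewrite Hfin; ring. }
  assert (HdE : 0 < delta / E) by now apply Rdiv_lt_0_compat.
  split; exists (K * PI * E ^ N + E), (delta / E); (split; [lra|]; split; [assumption|]).
  - intros x y Hx (T & u & v & HT & Hsol & u0 & v0 & Hv & uT & vT).
    specialize (Hdx x Hx). assert (HxN : 0 <= x ^ N) by (apply pow_le; lra).
    destruct (half_arc F N l lam s delta K 1 T u v x FI Hsol ltac:(lra) HT v0 vT) as (_ & B1 & _ & B2).
    + intros t Ht; rewrite Rmult_1_l; auto.
    + rewrite u0; lra.
    + left; now symmetry.
    + assumption.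
    + rewrite u0, uT in *. fold E in B1, B2. rewrite (Rabs_pos_eq x) in B1, B2 by lra.
      rewrite Rpow_mult_distr in B2. split; nra.
  - intros x x0 Hx Hx0 (T & u & v & HT & Hsol & u0 & v0 & Hv & uT & vT).
    specialize (Hdx x Hx). assert (HxN : 0 <= x ^ N) by (apply pow_le; lra).
    destruct (half_arc F N l lam s delta K (-1) T u v x FI Hsol ltac:(lra) HT v0 vT) as (_ & _ & _ & B2).
    + intros t Ht; specialize (Hv t Ht); cbv beta in Hv; lra.
    + rewrite u0; lra.
    + right; now symmetry.
    + assumption.
    + rewrite u0, uT in *. fold E in B2. rewrite (Rabs_pos_eq x) in B2 by lra.
      rewrite Rpow_mult_distr in B2. rewrite Rabs_minus_sym. nra.
Qed.

(** * First integrals in a flow box *)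

Definition mdx (l : list (R * nat * nat)) : list (R * nat * nat) :=
  map (fun t => match t with (c, i, j) => (c * INR i, pred i, j) end) l.
Definition mdy (l : list (R * nat * nat)) : list (R * nat * nat) :=
  map (fun t => match t with (c, i, j) => (c * INR j, i, pred j) end) l.
Definition mprimitive_x (a : R) (l : list (R * nat * nat)) : list (R * nat * nat) :=
  map (fun t => match t with (c, i, j) => (a * c / INR (S i), S i, j) end) l.
Fixpoint mmul (l l' : list (R * nat * nat)) : list (R * nat * nat) :=
  match l with
  | nil => nil
  | (c, i, j) :: l1 =>
      map (fun t => match t with (c', i', j') => (c * c', (i + i')%nat, (j + j')%nat) end) l' ++ mmul l1 l'
  end.

Lemma meval_derive l (u v : R -> R) t du dv : is_derive u t du -> is_derive v t dv ->
  is_derive (fun s => meval l (u s) (v s)) t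
    (meval (mdx l) (u t) (v t) * du + meval (mdy l) (u t) (v t) * dv).
Proof.
  intros Du Dv; induction l as [|[[c i] j] l IH].
  - simpl. replace (0 * du + 0 * dv) with 0 by ring. apply (is_derive_const (V := R_NormedModule)).
  - cbn [meval mdx mdy map]. fold (mdx l) (mdy l).
    pose proof (is_derive_pow u i t du Du) as D1. pose proof (is_derive_pow v j t dv Dv) as D2.
    pose proof (is_derive_scal _ t c _ D1) as D3.
    pose proof (is_derive_plus (V := R_NormedModule) _ _ t _ _
      (is_derive_mult _ _ t _ _ D3 D2 Rmult_comm) IH) as D.
    eapply eq_ind; [exact D|]. unfold plus, mult; simpl. ring.
Qed.

Lemma meval_mmul l l' x y : meval (mmul l l') x y = meval l x y * meval l' x y.
Proof.
  induction l as [|[[c i] j] l IH]; simpl; [ring|].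
  rewrite meval_app, IH. rewrite Rmult_plus_distr_r. f_equal. clear IH.
  induction l' as [|[[c' i'] j'] l' IH]; simpl; [ring|]. rewrite IH, !pow_add. ring.
Qed.

Lemma degrees_mmul m n l l' : degrees_from m l -> degrees_from n l' -> degrees_from (m + n) (mmul l l').
Proof.
  intros Hl Hl'; induction l as [|[[c i] j] l IH]; [constructor|].
  apply Forall_cons_iff in Hl as [Hd Hl]; simpl in Hd. simpl. apply degrees_from_app; [|now apply IH].
  apply Forall_map. eapply Forall_impl; [|exact Hl']. intros [[c' i'] j']; simpl; lia.
Qed.

Lemma degrees_mdx m l : degrees_from (S m) l -> degrees_from m (mdx l).
Proof. intros Hl. apply Forall_map. eapply Forall_impl; [|exact Hl]. intros [[c i] j]; simpl; lia. Qed.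

Lemma degrees_mdy m l : degrees_from (S m) l -> degrees_from m (mdy l).
Proof. intros Hl. apply Forall_map. eapply Forall_impl; [|exact Hl]. intros [[c i] j]; simpl; lia. Qed.

Lemma degrees_mprimitive_x a m l : degrees_from m l -> degrees_from (S m) (mprimitive_x a l).
Proof. intros Hl. apply Forall_map. eapply Forall_impl; [|exact Hl]. intros [[c i] j]; simpl; lia. Qed.

Lemma meval_mdx_mprimitive_x a l x y : meval (mdx (mprimitive_x a l)) x y = a * meval l x y.
Proof.
  induction l as [|[[c i] j] l IH]; [simpl; ring|].
  cbn [mprimitive_x mdx map meval]. fold (mprimitive_x a l). fold (mdx (mprimitive_x a l)). rewrite IH.
  replace (pred (S i)) with i by reflexivity. field. apply not_0_INR; lia.
Qed.

(** The residual is integrated in [x] as a whole and divided by the constant term of the first component of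
    the field; all other products have at least one degree more. *)
Lemma flow_box_integral (X0 : R) (lx ly : list (R * nat * nat)) : X0 <> 0 ->
  degrees_from 1 lx -> degrees_from 1 ly ->
  forall m, exists k res, degrees_from 2 k /\ degrees_from (S m) res /\ forall x y,
    meval (mdx ((1, 0%nat, 1%nat) :: k)) x y * (X0 + meval lx x y)
    + meval (mdy ((1, 0%nat, 1%nat) :: k)) x y * meval ly x y = meval res x y.
Proof.
  intros HX0 Hlx Hly m. induction m as [|m (k & res & Hk & Hres & E)].
  - exists nil, ly. split; [constructor|]. split; [assumption|]. intros x y; simpl. ring.
  - set (k' := mprimitive_x (- / X0) res).
    exists (k ++ k'), (mmul (mdx k') lx ++ mmul (mdy k') ly).
    assert (Hk' : degrees_from (S (S m)) k') by now apply degrees_mprimitive_x.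
    split; [|split].
    + apply degrees_from_app; [assumption|]. eapply Forall_impl; [|exact Hk']. simpl; intros; lia.
    + replace (S (S m)) with (S m + 1)%nat by lia.
      apply degrees_from_app; apply degrees_mmul; try assumption; [now apply degrees_mdx|now apply degrees_mdy].
    + intros x y. specialize (E x y).
      change ((1, 0%nat, 1%nat) :: k ++ k') with (((1, 0%nat, 1%nat) :: k) ++ k').
      unfold mdx at 1, mdy at 1. rewrite !map_app.
      change (meval (mdx ((1, 0%nat, 1%nat) :: k) ++ mdx k') x y * (X0 + meval lx x y)
        + meval (mdy ((1, 0%nat, 1%nat) :: k) ++ mdy k') x y * meval ly x y
        = meval (mmul (mdx k') lx ++ mmul (mdy k') ly) x y).
      rewrite !meval_app, !meval_mmul.
      assert (Ek : meval (mdx k') x y = - / X0 * meval res x y) by apply meval_mdx_mprimitive_x.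
      rewrite Ek.
      set (A := meval (mdx ((1, 0%nat, 1%nat) :: k)) x y) in *.
      set (B := meval (mdy ((1, 0%nat, 1%nat) :: k)) x y) in *.
      apply Rminus_diag_uniq.
      replace (meval res x y) with (A * (X0 + meval lx x y) + B * meval ly x y). field. assumption.
Qed.

Lemma meval_vertical_increment k : degrees_from 2 k -> exists C, 0 <= C /\
  forall x y rho, Rabs x <= rho -> Rabs y <= rho -> rho <= 1 ->
    Rabs (meval k x y - meval k x 0) <= C * rho * Rabs y.
Proof.
  induction k as [|[[c i] j] k IH]; intros Hk.
  - exists 0; split; [lra|]. intros; simpl. rewrite Rminus_0_r, Rabs_R0; lra.
  - apply Forall_cons_iff in Hk as [Hd Hk]; simpl in Hd. destruct (IH Hk) as (C & HC & H).
    exists (Rabs c + C); split; [pose proof (Rabs_pos c); lra|].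
    intros x y rho Hx Hy Hr. cbn [meval]. specialize (H x y rho Hx Hy Hr).
    replace (c * x ^ i * y ^ j + meval k x y - (c * x ^ i * 0 ^ j + meval k x 0))
      with (c * (x ^ i * (y ^ j - 0 ^ j)) + (meval k x y - meval k x 0)) by ring.
    triangle.
    rewrite 2!Rmult_plus_distr_r. apply Rplus_le_compat; [|assumption].
    rewrite Rabs_mult, !Rmult_assoc. apply Rmult_le_compat_l; [apply Rabs_pos|].
    pose proof (Rabs_pos x); pose proof (Rabs_pos y).
    destruct j as [|j].
    + simpl. rewrite Rminus_diag, Rmult_0_r, Rabs_R0. nra.
    + rewrite pow_i, Rminus_0_r by lia. rewrite Rabs_mult, <- !RPow_abs.
      change (Rabs y ^ S j) with (Rabs y * Rabs y ^ j).
      assert (Rabs x ^ i * Rabs y ^ j <= rho); [|nra].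
      apply Rle_trans with (rho ^ i * rho ^ j).
      * apply Rmult_le_compat; try (apply pow_le; assumption); apply pow_incr; lra.
      * rewrite <- pow_add. apply Rle_trans with (rho ^ 1); [|rewrite pow_1; lra].
        apply pow_le_antitone; [lra|lia].
Qed.

(** The estimates satisfied by a truncated first integral [y + meval k] in a small square. *)
Record flow_box (F : vector_field) (M : nat) (k : list (R * nat * nat)) (C delta : R) : Prop := {
  fb_C : 0 <= C;
  fb_delta : 0 < delta;
  fb_delta1 : delta <= 1;
  fb_X : forall x y rho, Rabs x <= rho -> Rabs y <= rho -> rho < delta ->
    Rabs (vX F x y - vX F 0 0) <= C * rho;
  fb_Y : forall x y rho, Rabs x <= rho -> Rabs y <= rho -> rho < delta -> Rabs (vY F x y) <= C * rho;
  fb_dy : forall x y rho, Rabs x <= rho -> Rabs y <= rho -> rho < delta ->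
    Rabs (meval (mdy ((1, 0%nat, 1%nat) :: k)) x y - 1) <= C * rho;
  fb_increment : forall x y rho, Rabs x <= rho -> Rabs y <= rho -> rho < delta ->
    Rabs (meval ((1, 0%nat, 1%nat) :: k) x y - meval ((1, 0%nat, 1%nat) :: k) x 0 - y) <= C * rho * Rabs y;
  fb_invariant : forall x y rho, Rabs x <= rho -> Rabs y <= rho -> rho < delta ->
    Rabs (meval (mdx ((1, 0%nat, 1%nat) :: k)) x y * vX F x y
      + meval (mdy ((1, 0%nat, 1%nat) :: k)) x y * vY F x y) <= C * rho ^ M;
  fb_degrees : degrees_from 2 k }.

Lemma analytic_expansion_from_1 f : analytic_at_O f -> forall M, exists l C d,
  degrees_from 1 l /\ 0 < d /\ d <= 1 /\ 0 <= C /\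
  forall x y rho, Rabs x <= rho -> Rabs y <= rho -> rho < d ->
    Rabs (f x y - (f 0 0 + meval l x y)) <= C * rho ^ M.
Proof.
  intros Hf M. destruct (analytic_expansion f Hf) as (a & b & H).
  destruct (H M) as (l & C & d & Hl & Hd & Hd1 & HC & HE).
  exists ((a, 1%nat, 0%nat) :: (b, 0%nat, 1%nat) :: l), C, d.
  split; [|split; [assumption|split; [assumption|split; [assumption|]]]].
  - repeat constructor. eapply Forall_impl; [|exact Hl]. simpl; intros; lia.
  - intros x y rho Hx Hy Hr. cbn [meval].
    replace (f 0 0 + (a * x ^ 1 * y ^ 0 + (b * x ^ 0 * y ^ 1 + meval l x y)))
      with (f 0 0 + a * x + b * y + meval l x y) by ring. now apply HE.
Qed.

Lemma analytic_increment l f C d M : degrees_from 1 l -> 0 <= C -> d <= 1 -> (1 <= M)%nat ->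
  (forall x y rho, Rabs x <= rho -> Rabs y <= rho -> rho < d ->
    Rabs (f x y - (f 0 0 + meval l x y)) <= C * rho ^ M) ->
  exists B, 0 <= B /\ forall x y rho, Rabs x <= rho -> Rabs y <= rho -> rho < d ->
    Rabs (f x y - f 0 0) <= B * rho.
Proof.
  intros Hl HC Hd HM H. destruct (meval_bound 1 l Hl) as (B & HB & HB').
  exists (C + B); split; [lra|]. intros x y rho Hx Hy Hr.
  specialize (H x y rho Hx Hy Hr). specialize (HB' x y rho Hx Hy ltac:(lra)).
  pose proof (Rabs_pos x).
  replace (f x y - f 0 0) with ((f x y - (f 0 0 + meval l x y)) + meval l x y) by ring.
  triangle. rewrite pow_1 in HB'.
  assert (rho ^ M <= rho) by (rewrite <- (pow_1 rho) at 2; apply pow_le_antitone; [lra|lia]). nra.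
Qed.

Lemma flow_box_exists F : analytic_field F -> vX F 0 0 <> 0 -> vY F 0 0 = 0 ->
  forall M, (1 <= M)%nat -> exists k C delta, flow_box F M k C delta.
Proof.
  intros [AX AY] HX0 HY0 M HM.
  destruct (analytic_expansion_from_1 _ AX M) as (lx & Cx & dx & Hlx & Hdx & Hdx1 & HCx & EX).
  destruct (analytic_expansion_from_1 _ AY M) as (ly & Cy & dy & Hly & Hdy & Hdy1 & HCy & EY).
  destruct (analytic_increment lx _ Cx dx M Hlx HCx Hdx1 HM EX) as (Bx & HBx & IX).
  destruct (analytic_increment ly _ Cy dy M Hly HCy Hdy1 HM EY) as (By & HBy & IY).
  destruct (flow_box_integral (vX F 0 0) lx ly HX0 Hlx Hly M) as (k & res & Hk & Hres & E).
  destruct (meval_bound 1 _ (degrees_mdx 1 k Hk)) as (B1 & HB1 & HB1').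
  destruct (meval_bound 1 _ (degrees_mdy 1 k Hk)) as (B2 & HB2 & HB2').
  destruct (meval_vertical_increment k Hk) as (B3 & HB3 & HB3').
  destruct (meval_bound (S M) res Hres) as (B4 & HB4 & HB4').
  set (I := (1, 0%nat, 1%nat) :: k) in *.
  assert (Edx : forall x y, meval (mdx I) x y = meval (mdx k) x y).
  { intros x y. unfold I; cbn [mdx map meval]. fold (mdx k). simpl. ring. }
  assert (Edy : forall x y, meval (mdy I) x y = 1 + meval (mdy k) x y).
  { intros x y. unfold I; cbn [mdy map meval]. fold (mdy k). simpl. ring. }
  set (C0 := B1 * Cx + (1 + B2) * Cy + B4).
  assert (H1 : 0 <= B1 * Cx) by now apply Rmult_le_pos.
  assert (H2 : 0 <= (1 + B2) * Cy) by (apply Rmult_le_pos; lra).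
  exists k, (Bx + By + B1 + B2 + B3 + C0), (Rmin dx dy).
  assert (Hd : forall rho, rho < Rmin dx dy -> rho < dx /\ rho < dy /\ rho <= 1).
  { intros rho Hr. pose proof (Rmin_l dx dy); pose proof (Rmin_r dx dy). lra. }
  split.
  - unfold C0; lra.
  - now apply Rmin_glb_lt.
  - pose proof (Rmin_l dx dy); lra.
  - intros x y rho Hx Hy Hr. destruct (Hd rho Hr) as (D1 & D2 & D3).
    specialize (IX x y rho Hx Hy D1). pose proof (Rabs_pos x). unfold C0; nra.
  - intros x y rho Hx Hy Hr. destruct (Hd rho Hr) as (D1 & D2 & D3).
    specialize (IY x y rho Hx Hy D2). rewrite HY0, Rminus_0_r in IY. pose proof (Rabs_pos x). unfold C0; nra.
  - intros x y rho Hx Hy Hr. destruct (Hd rho Hr) as (D1 & D2 & D3). fold I. rewrite Edy.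
    specialize (HB2' x y rho Hx Hy D3). rewrite pow_1 in HB2'. pose proof (Rabs_pos x).
    replace (1 + meval (mdy k) x y - 1) with (meval (mdy k) x y) by ring. unfold C0; nra.
  - intros x y rho Hx Hy Hr. destruct (Hd rho Hr) as (D1 & D2 & D3).
    specialize (HB3' x y rho Hx Hy D3). pose proof (Rabs_pos x); pose proof (Rabs_pos y).
    unfold I; cbn [meval].
    replace (1 * x ^ 0 * y ^ 1 + meval k x y - (1 * x ^ 0 * 0 ^ 1 + meval k x 0) - y)
      with (meval k x y - meval k x 0) by ring.
    assert (0 <= rho * Rabs y) by nra. rewrite Rmult_assoc in HB3' |- *. unfold C0; nra.
  - intros x y rho Hx Hy Hr. destruct (Hd rho Hr) as (D1 & D2 & D3). fold I.
    specialize (EX x y rho Hx Hy D1). specialize (EY x y rho Hx Hy D2). rewrite HY0, Rplus_0_l in EY.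
    specialize (HB1' x y rho Hx Hy D3). specialize (HB2' x y rho Hx Hy D3).
    specialize (HB4' x y rho Hx Hy D3). pose proof (Rabs_pos x).
    specialize (E x y). rewrite pow_1 in HB1', HB2'.
    replace (meval (mdx I) x y * vX F x y + meval (mdy I) x y * vY F x y)
      with (meval res x y + (meval (mdx I) x y * (vX F x y - (vX F 0 0 + meval lx x y))
        + meval (mdy I) x y * (vY F x y - meval ly x y))) by (rewrite <- E; ring).
    triangle.
    pose proof (Rabs_triang (meval (mdx I) x y * (vX F x y - (vX F 0 0 + meval lx x y)))
      (meval (mdy I) x y * (vY F x y - meval ly x y))) as Ht.
    rewrite !Rabs_mult in Ht.
    assert (HpM : 0 <= rho ^ M) by (apply pow_le; lra).
    assert (Q1 : Rabs (meval (mdx I) x y) <= B1) by (rewrite Edx; nra).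
    assert (Q2 : Rabs (meval (mdy I) x y) <= 1 + B2).
    { rewrite Edy. triangle. rewrite Rabs_R1. nra. }
    assert (P1 : Rabs (meval (mdx I) x y) * Rabs (vX F x y - (vX F 0 0 + meval lx x y)) <= B1 * (Cx * rho ^ M)).
    { apply Rmult_le_compat; try apply Rabs_pos; assumption. }
    assert (P2 : Rabs (meval (mdy I) x y) * Rabs (vY F x y - meval ly x y) <= (1 + B2) * (Cy * rho ^ M)).
    { apply Rmult_le_compat; try apply Rabs_pos; assumption. }
    assert (P4 : rho ^ S M <= rho ^ M) by (apply pow_le_antitone; [lra|lia]).
    assert (0 <= (Bx + By + B1 + B2 + B3) * rho ^ M) by (apply Rmult_le_pos; lra).
    unfold C0. nra.
  - assumption.
Qed.

(** On the axis, invariance reads [g' * X + (1 + O(z)) * Y = O(z ^ M)]. *)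
Lemma axis_slope F M k C delta n c e Ce : flow_box F M k C delta -> vX F 0 0 <> 0 -> (S n <= M)%nat ->
  0 < e -> (forall x, Rabs x < e -> Rabs (vY F x 0 - c * x ^ n) <= Ce * Rabs x ^ S n) ->
  exists B d, 0 <= B /\ 0 < d /\ forall z, Rabs z < d ->
    Rabs (meval (mdx ((1, 0%nat, 1%nat) :: k)) z 0 + c / vX F 0 0 * z ^ n) <= B * Rabs z ^ S n.
Proof.
  intros [FC Fd Fd1 FX FY Fdy _ FI _] HX0 HM He HY.
  set (X0 := vX F 0 0) in *. set (dg := meval (mdx ((1, 0%nat, 1%nat) :: k))) in *.
  set (dh := meval (mdy ((1, 0%nat, 1%nat) :: k))) in *.
  assert (HaX : 0 < Rabs X0) by now apply Rabs_pos_lt.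
  assert (HCe : 0 <= Rabs Ce) by apply Rabs_pos. assert (Hac : 0 <= Rabs c) by apply Rabs_pos.
  set (A := Rabs c + Rabs Ce). set (D := (C + (1 + C) * A) * (2 / Rabs X0)).
  exists ((C + D * C + C * A + Rabs Ce) / Rabs X0), (Rmin (Rmin delta e) (Rabs X0 / (2 * (C + 1)))).
  assert (HA : 0 <= A) by (unfold A; lra).
  assert (H2X : 0 < 2 / Rabs X0) by (apply Rdiv_lt_0_compat; lra).
  assert (HD : 0 <= D) by (unfold D; apply Rmult_le_pos; nra).
  assert (Hq : 0 < Rabs X0 / (2 * (C + 1))) by (apply Rdiv_lt_0_compat; lra).
  split; [apply Rdiv_le_0_compat; nra|]. split; [repeat apply Rmin_glb_lt; assumption|].
  intros z Hz. set (t := Rabs z) in *. assert (Ht0 : 0 <= t) by apply Rabs_pos.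
  min_bounds.
  assert (Z0 : Rabs 0 <= t) by (rewrite Rabs_R0; assumption).
  assert (Htd : t < delta) by lra. assert (Hzt : Rabs z <= t) by (unfold t; lra).
  specialize (FX z 0 t Hzt Z0 Htd). specialize (Fdy z 0 t Hzt Z0 Htd).
  specialize (FI z 0 t Hzt Z0 Htd). specialize (HY z ltac:(fold t; lra)). fold t in HY.
  assert (HsX : C * t <= Rabs X0 / 2).
  { apply Rle_trans with ((C + 1) * (Rabs X0 / (2 * (C + 1)))).
    - apply Rmult_le_compat; lra.
    - apply Req_le; field; lra. }
  assert (HXl : Rabs X0 / 2 <= Rabs (vX F z 0)).
  { pose proof (Rabs_triang (vX F z 0) (- (vX F z 0 - X0))) as Hti. rewrite Rabs_Ropp in Hti.
    replace (vX F z 0 + - (vX F z 0 - X0)) with X0 in Hti by ring. lra. }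
  set (p := t ^ n). assert (Hp : 0 <= p) by now apply pow_le.
  assert (HpS : t ^ S n = t * p) by reflexivity.
  assert (HpM : t ^ M <= t * p) by (rewrite <- HpS; apply pow_le_antitone; [lra|assumption]).
  assert (Ht1 : t <= 1) by lra.
  rewrite HpS in HY.
  assert (HYe : Rabs (vY F z 0 - c * z ^ n) <= Rabs Ce * (t * p)).
  { eapply Rle_trans; [exact HY|]. apply Rmult_le_compat_r; [nra|apply Rle_abs]. }
  assert (HYn : Rabs (vY F z 0) <= A * p).
  { replace (vY F z 0) with (c * z ^ n + (vY F z 0 - c * z ^ n)) by ring.
    triangle. rewrite Rabs_mult, <- RPow_abs. fold t p.
    unfold A. assert (t * p <= p) by nra. nra. }
  assert (Hdh : Rabs (dh z 0) <= 1 + C).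
  { replace (dh z 0) with (1 + (dh z 0 - 1)) by ring. triangle.
    rewrite Rabs_R1. nra. }
  assert (Hdg : Rabs (dg z 0) <= D * p).
  { assert (Hprod : Rabs (dg z 0) * Rabs (vX F z 0) <= (C + (1 + C) * A) * p).
    { rewrite <- Rabs_mult.
      replace (dg z 0 * vX F z 0) with ((dg z 0 * vX F z 0 + dh z 0 * vY F z 0) - dh z 0 * vY F z 0) by ring.
      unfold Rminus. triangle. rewrite Rabs_Ropp, Rabs_mult.
      assert (Rabs (dh z 0) * Rabs (vY F z 0) <= (1 + C) * (A * p)).
      { apply Rmult_le_compat; try apply Rabs_pos; assumption. }
      assert (t * p <= p) by nra. nra. }
    unfold D. replace ((C + (1 + C) * A) * (2 / Rabs X0) * p)
      with ((C + (1 + C) * A) * p * (2 / Rabs X0)) by ring.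
    apply Rle_trans with (Rabs (dg z 0) * Rabs (vX F z 0) * (2 / Rabs X0)).
    - rewrite Rmult_assoc. rewrite <- (Rmult_1_r (Rabs (dg z 0))) at 1.
      apply Rmult_le_compat_l; [apply Rabs_pos|].
      replace 1 with (Rabs X0 / 2 * (2 / Rabs X0)) by (field; lra).
      apply Rmult_le_compat_r; lra.
    - apply Rmult_le_compat_r; lra. }
  apply Rmult_le_reg_r with (Rabs X0); [assumption|].
  rewrite <- Rabs_mult.
  replace ((dg z 0 + c / X0 * z ^ n) * X0)
    with ((dg z 0 * vX F z 0 + dh z 0 * vY F z 0) + (- (dg z 0 * (vX F z 0 - X0))
      + (- ((dh z 0 - 1) * vY F z 0) + - (vY F z 0 - c * z ^ n)))) by (field; assumption).
  replace ((C + D * C + C * A + Rabs Ce) / Rabs X0 * t ^ S n * Rabs X0)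
    with (C * (t * p) + (D * p * (C * t) + (C * t * (A * p) + Rabs Ce * (t * p)))) by (rewrite HpS; field; lra).
  triangle. apply Rplus_le_compat; [nra|].
  triangle. rewrite Rabs_Ropp, Rabs_mult. apply Rplus_le_compat.
  { apply Rmult_le_compat; try apply Rabs_pos; assumption. }
  triangle. rewrite !Rabs_Ropp, Rabs_mult. apply Rplus_le_compat; [|assumption].
  apply Rmult_le_compat; try apply Rabs_pos; assumption.
Qed.

(** * Arcs below a tangent point *)

Lemma potential_of_slope (g dg : R -> R) kappa B d n : (forall z, is_derive g z (dg z)) -> g 0 = 0 ->
  (forall z, Rabs z < d -> Rabs (dg z + kappa * z ^ n) <= B * Rabs z ^ S n) -> 0 <= B ->
  forall z, Rabs z < d -> Rabs (g z + kappa / INR (S n) * z ^ S n) <= B * Rabs z ^ S (S n).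
Proof.
  intros Dg g0 Hdg HB z Hz.
  set (h := fun z => g z + kappa / INR (S n) * z ^ S n).
  assert (HS : INR (S n) <> 0) by (apply not_0_INR; lia).
  assert (Dh : forall x, is_derive h x (dg x + kappa * x ^ n)).
  { intros x. pose proof (is_derive_scal _ x (kappa / INR (S n)) _
      (is_derive_pow (fun y => y) (S n) x 1 (is_derive_id (K := R_AbsRing) x))) as D.
    eapply eq_ind; [exact (is_derive_plus (V := R_NormedModule) _ _ x _ _ (Dg x) D)|].
    unfold plus; cbn -[INR pow]. simpl pred. field. assumption. }
  destruct (MVT_gen h 0 z (fun x => dg x + kappa * x ^ n)) as (c & Hc & E).
  - intros; apply Dh.
  - intros; apply continuity_pt_filterlim. eapply is_derive_continuous, Dh.
  - assert (h0 : h 0 = 0) by (unfold h; rewrite g0, pow_i by lia; ring).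
    rewrite h0, !Rminus_0_r in E. change (Rabs (h z) <= B * Rabs z ^ S (S n)). rewrite E, Rabs_mult.
    assert (Hcz : Rabs c <= Rabs z).
    { unfold Rmin, Rmax in Hc. destruct (Rle_dec 0 z).
      - rewrite !Rabs_pos_eq; lra.
      - rewrite (Rabs_left z) by lra. apply Rabs_le; lra. }
    change (Rabs z ^ S (S n)) with (Rabs z * Rabs z ^ S n).
    pose proof (Rabs_pos z).
    apply Rle_trans with (B * Rabs c ^ S n * Rabs z).
    + apply Rmult_le_compat_r; [assumption|apply Hdg; lra].
    + assert (Rabs c ^ S n <= Rabs z ^ S n) by (apply pow_incr; split; [apply Rabs_pos|assumption]).
      replace (B * (Rabs z * Rabs z ^ S n)) with (B * Rabs z ^ S n * Rabs z) by ring.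
      apply Rmult_le_compat_r; [assumption|]. now apply Rmult_le_compat_l.
Qed.

Lemma pow_difference_lower n w x : 0 < w -> 0 < x -> x ^ n * Rabs (w - x) <= Rabs (w ^ S n - x ^ S n).
Proof.
  intros Hw Hx. destruct (Rle_dec x w) as [H|H].
  - assert (x ^ n <= w ^ n) by (apply pow_incr; lra). assert (0 <= x ^ n) by (apply pow_le; lra).
    rewrite (Rabs_pos_eq (w - x)) by lra. apply Rle_trans with (w ^ S n - x ^ S n); [simpl; nra|apply Rle_abs].
  - assert (w ^ n <= x ^ n) by (apply pow_incr; lra). assert (0 <= w ^ n) by (apply pow_le; lra).
    rewrite (Rabs_left (w - x)) by lra. rewrite Rabs_minus_sym.
    apply Rle_trans with (x ^ S n - w ^ S n); [simpl; nra|apply Rle_abs].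
Qed.

(** An arc in the lower half-plane arrives at its end point from below, so the vertical speed there cannot be
    negative. *)
Lemma no_arc_arriving_downwards F n c Ce e : c < 0 -> 0 < e ->
  (forall x, Rabs x < e -> Rabs (vY F x 0 - c * x ^ n) <= Ce * Rabs x ^ S n) ->
  exists d, 0 < d /\ forall x x0, 0 < x < d -> ~ Pi_minus F x0 x.
Proof.
  intros Hc He HY. exists (Rmin e (- c / (Rabs Ce + 1))).
  pose proof (Rabs_pos Ce) as HCe.
  split; [apply Rmin_glb_lt; [assumption|apply Rdiv_lt_0_compat; lra]|].
  intros x x0 Hx (T & u & v & HT & Hsol & _ & _ & Hv & uT & vT).
  min_bounds.
  destruct (Hsol T ltac:(lra)) as [_ Dv]. rewrite uT, vT in Dv.
  pose proof (derive_nonneg_of_negative_before v T 0 _ Dv vT HT Hv) as Hpos.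
  specialize (HY x ltac:(rewrite Rabs_pos_eq; lra)). rewrite (Rabs_pos_eq x) in HY by lra.
  apply Rabs_le_between in HY. assert (0 < x ^ n) by (apply pow_lt; lra). simpl in HY.
  assert (x * (Rabs Ce + 1) < - c).
  { apply Rlt_div_r; lra. }
  pose proof (Rle_abs Ce).
  assert (Ce * x <= Rabs Ce * x) by nra.
  assert (0 <= x ^ n * (c + Ce * x)) by nra.
  assert (c + Ce * x < 0) by lra. nra.
Qed.

Lemma below_inverse K Ki x : 0 < x -> Ki <= K -> x * K < 1 -> x * Ki < 1.
Proof. intros; nra. Qed.

Lemma below_unit K x : 0 < K -> x < / K -> x * K < 1.
Proof. intros HK H. apply Rlt_div_r; [assumption|]. now replace (1 / K) with (/ K) by (field; lra). Qed.

Lemma below_scale y D : y < 1 -> 0 < D -> y * D < D.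
Proof. intros; nra. Qed.

(** The arc is followed backward from [(x, 0)].  In a box of size [3 * x] the ordinate stays below [x], since
    the slope of the orbit is [O(x)].  The abscissa cannot pass [- 2 * x]: there the first integral is at
    most about [- gamma * (2 * x) ^ (n + 1)] while [v < 0], and its value at the end of the arc is about
    [- gamma * x ^ (n + 1)].  So the arc never leaves the box. *)
Lemma tangent_arc F M k C delta n gamma B d : flow_box F M k C delta -> 0 < vX F 0 0 ->
  (S n <= M)%nat -> Nat.Even (S n) -> 0 < gamma -> 0 <= B -> 0 < d ->
  let g := fun z => meval ((1, 0%nat, 1%nat) :: k) z 0 in
  (forall z, Rabs z < d -> Rabs (g z + gamma * z ^ S n) <= B * Rabs z ^ S (S n)) ->
  exists C' d', 0 <= C' /\ 0 < d' /\ forall x x0, 0 < x < d' -> x0 < 0 -> Pi_minus F x0 x ->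
    Rabs x0 <= 3 * x /\ Rabs (g x0 - g x) <= C' * x ^ M.
Proof.
  intros FB HX0 HM Heven Hgam HB Hd g Hg.
  destruct FB as [FC Fd Fd1 FX FY _ Fi FI _]. set (X0 := vX F 0 0) in *.
  set (Q := C / X0).
  assert (HQ : 0 <= Q) by (apply Rdiv_le_0_compat; lra).
  assert (HCQ : C = Q * X0) by (unfold Q; field; lra).
  assert (H3 : 0 < 3 ^ M) by (apply pow_lt; lra).
  set (Kbig := 3 / delta + 3 / d + 24 * Q + 3 * C + 12 * (B / gamma) + 8 * Q * 3 ^ M / gamma + 1).
  assert (0 < 3 / delta) by (apply Rdiv_lt_0_compat; lra).
  assert (0 < 3 / d) by (apply Rdiv_lt_0_compat; lra).
  assert (0 <= B / gamma) by (apply Rdiv_le_0_compat; lra).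
  assert (0 <= 8 * Q * 3 ^ M / gamma) by (apply Rdiv_le_0_compat; [nra|assumption]).
  assert (HK : 0 < Kbig) by (unfold Kbig; lra).
  exists (8 * Q * 3 ^ M), (/ Kbig). split; [nra|]. split; [now apply Rinv_0_lt_compat|].
  intros x x0 [Hx HxK] Hx0 (T & u & v & HT & Hsol & u0 & v0 & Hv & uT & vT).
  assert (HxK' : x * Kbig < 1).
  { now apply below_unit. }
  assert (C1 : 3 * x < delta).
  { assert (x * (3 / delta) < 1) by (apply (below_inverse Kbig); (assumption || (unfold Kbig; lra))).
    replace (3 * x) with (x * (3 / delta) * delta) by (field; lra). now apply below_scale. }
  assert (C2 : 3 * x < d).
  { assert (x * (3 / d) < 1) by (apply (below_inverse Kbig); (assumption || (unfold Kbig; lra))).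
    replace (3 * x) with (x * (3 / d) * d) by (field; lra). now apply below_scale. }
  assert (C3 : x * (24 * Q) < 1) by (apply (below_inverse Kbig); (assumption || (unfold Kbig; lra))).
  assert (C4 : x * (3 * C) < 1) by (apply (below_inverse Kbig); (assumption || (unfold Kbig; lra))).
  assert (C5 : 12 * B * x < gamma).
  { assert (x * (12 * (B / gamma)) < 1) by (apply (below_inverse Kbig); (assumption || (unfold Kbig; lra))).
    replace (12 * B * x) with (x * (12 * (B / gamma)) * gamma) by (field; lra). now apply below_scale. }
  assert (C6 : 8 * Q * 3 ^ M * x < gamma).
  { assert (x * (8 * Q * 3 ^ M / gamma) < 1) by (apply (below_inverse Kbig); (assumption || (unfold Kbig; lra))).
    replace (8 * Q * 3 ^ M * x) with (x * (8 * Q * 3 ^ M / gamma) * gamma) by (field; lra). now apply below_scale. }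
  assert (C7 : x < 1) by (assert (x * 1 < 1) by (apply (below_inverse Kbig); (assumption || (unfold Kbig; lra))); lra).
  set (rho := 3 * x).
  set (I := (1, 0%nat, 1%nat) :: k) in *.
  (* Inside the box of size rho the abscissa increases at a speed of at least X0 / 2, so it serves as time. *)
  assert (Hbox : forall a b, 0 <= a -> a <= b -> b <= T ->
    (forall t, a <= t <= b -> Rabs (u t) <= rho /\ Rabs (v t) <= rho) ->
    u a <= u b /\ Rabs (v b - v a) <= 2 * Q * rho * (u b - u a) /\
    Rabs (meval I (u b) (v b) - meval I (u a) (v a)) <= 2 * Q * rho ^ M * (u b - u a)).
  { intros a b Ha Hab Hb Hin.
    assert (HX : forall t, a <= t <= b -> X0 / 2 <= vX F (u t) (v t)).
    { intros t Ht. destruct (Hin t Ht) as [Ht1 Ht2]. specialize (FX _ _ rho Ht1 Ht2 C1).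
      apply Rabs_le_between in FX. unfold rho in FX. rewrite HCQ in FX. nra. }
    split; [|split].
    - apply (nondecreasing_of_derivative u (fun t => vX F (u t) (v t)) a b Hab).
      + intros t Ht; apply Hsol; lra.
      + intros t Ht; specialize (HX t Ht); lra.
    - apply (increment_dominated v (fun t => vY F (u t) (v t)) u (fun t => vX F (u t) (v t))); [assumption| | |].
      + intros t Ht; apply Hsol; lra.
      + intros t Ht; apply Hsol; lra.
      + intros t Ht. destruct (Hin t Ht) as [Ht1 Ht2]. specialize (FY _ _ rho Ht1 Ht2 C1). specialize (HX t Ht).
        eapply Rle_trans; [exact FY|]. rewrite HCQ. assert (0 <= Q * rho) by (unfold rho; nra). nra.
    - apply (increment_dominated (fun t => meval I (u t) (v t))
        (fun t => meval (mdx I) (u t) (v t) * vX F (u t) (v t) + meval (mdy I) (u t) (v t) * vY F (u t) (v t))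
        u (fun t => vX F (u t) (v t))); [assumption| | |].
      + intros t Ht; apply meval_derive; apply Hsol; lra.
      + intros t Ht; apply Hsol; lra.
      + intros t Ht. destruct (Hin t Ht) as [Ht1 Ht2]. specialize (FI _ _ rho Ht1 Ht2 C1). specialize (HX t Ht).
        eapply Rle_trans; [exact FI|]. rewrite HCQ.
        assert (0 <= rho ^ M) by (apply pow_le; unfold rho; lra).
        assert (0 <= Q * rho ^ M) by nra. nra. }
  set (w := fun t => u t ^ 2 + v t ^ 2).
  assert (Cw : forall t, 0 <= t <= T -> continuous w t).
  { intros t Ht. destruct (Hsol t Ht) as [Du Dv].
    apply (continuous_plus (fun t => u t ^ 2) (fun t => v t ^ 2)); apply continuous_pow_R;
      eapply is_derive_continuous; eassumption. }
  assert (Hbw : forall t, w t < rho ^ 2 -> Rabs (u t) <= rho /\ Rabs (v t) <= rho).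
  { intros t Ht. unfold w in Ht. split; apply Rabs_le; unfold rho in *; nra. }
  assert (HpS : 0 < x ^ S n) by now apply pow_lt.
  assert (HxM : x ^ M <= x ^ S n) by (apply pow_le_antitone; [lra|assumption]).
  assert (Hval : meval I x 0 = g x) by reflexivity.
  assert (Htrap : forall t, 0 <= t <= T -> w t <= 5 * x ^ 2).
  { apply (continuous_trap_backward w T _ (rho ^ 2) HT Cw).
    - unfold w. rewrite uT, vT. simpl. nra.
    - unfold rho. assert (0 < x ^ 2) by now apply pow_lt. nra.
    - intros t1 Ht1 Hin t Ht.
      assert (Hin' : forall s, t <= s <= T -> Rabs (u s) <= rho /\ Rabs (v s) <= rho).
      { intros s Hs. apply Hbw. destruct (Req_dec s T) as [->|].
        - unfold w, rho. rewrite uT, vT. simpl. nra.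
        - apply Hin; lra. }
      destruct (Hbox t T ltac:(lra) ltac:(lra) ltac:(lra) Hin') as (A1 & A2 & A3).
      rewrite uT in A1, A2, A3. rewrite vT in A2, A3. rewrite Hval in A3.
      destruct (Hin' t ltac:(lra)) as [U1 V1].
      pose proof (proj1 (Rabs_le_between _ _) U1) as U2. unfold rho in U2.
      assert (V2 : Rabs (v t) <= x).
      { replace (v t) with (- (0 - v t)) by ring. rewrite Rabs_Ropp.
        eapply Rle_trans; [exact A2|]. unfold rho.
        assert (x - u t <= 4 * x) by lra.
        apply Rle_trans with (2 * Q * (3 * x) * (4 * x)); [apply Rmult_le_compat_l; nra|]. nra. }
      assert (U3 : - (2 * x) <= u t).
      { apply Rnot_lt_le; intros Hlt.
        assert (vneg : v t < 0) by (apply Hv; lra).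
        specialize (Fi (u t) (v t) rho U1 V1 C1). fold I in Fi.
        rewrite (Rabs_left (v t)) in Fi by assumption.
        pose proof (proj1 (Rabs_le_between _ _) Fi) as Fi'.
        assert (Hgu : meval I (u t) (v t) <= g (u t)).
        { assert (C * rho * - v t <= - v t) by (unfold rho; nra). 
          change (g (u t)) with (meval I (u t) 0). lra. }
        pose proof (Hg (u t) ltac:(unfold rho in U1; lra)) as G1.
        pose proof (Hg x ltac:(rewrite Rabs_pos_eq; lra)) as G2.
        apply Rabs_le_between in G1. apply Rabs_le_between in G2. apply Rabs_le_between in A3.
        rewrite (Rabs_pos_eq x) in G2 by lra.
        set (y := - u t) in *. assert (Hy : 2 * x <= y) by (unfold y; lra).
        assert (Hay : Rabs (u t) = y) by (unfold y; rewrite Rabs_left; lra).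
        assert (Hyp : u t ^ S n = y ^ S n).
        { unfold y. replace (- u t) with (-1 * u t) by ring. rewrite Rpow_mult_distr.
          destruct Heven as [h ->]. rewrite pow_1_even. ring. }
        rewrite Hay, Hyp in G1.
        assert (Hy4 : 4 * x ^ S n <= y ^ S n).
        { apply Rle_trans with ((2 * x) ^ S n); [|apply pow_incr; lra].
          rewrite Rpow_mult_distr. apply Rmult_le_compat_r; [lra|].
          destruct Heven as [h Hh]. replace 4 with (2 ^ 2) by ring. apply Rle_pow; [lra|lia]. }
        change (y ^ S (S n)) with (y * y ^ S n) in G1. change (x ^ S (S n)) with (x * x ^ S n) in G2.
        set (py := y ^ S n) in *. set (px := x ^ S n) in *.
        assert (Hy3 : y <= 3 * x) by (unfold y; lra).
        assert (B * (y * py) <= gamma / 4 * py) by (assert (B * y <= gamma / 4) by nra; nra).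
        assert (B * (x * px) <= gamma / 4 * px) by (assert (B * x <= gamma / 4) by nra; nra).
        assert (2 * Q * rho ^ M * (x - u t) <= gamma * px).
        { unfold rho. rewrite Rpow_mult_distr.
          assert (0 <= 2 * Q * (3 ^ M * x ^ M)).
          { apply Rmult_le_pos; [lra|]. apply Rmult_le_pos; [lra|apply pow_le; lra]. }
          apply Rle_trans with (2 * Q * (3 ^ M * x ^ M) * (4 * x)); [apply Rmult_le_compat_l; lra|].
          replace (2 * Q * (3 ^ M * x ^ M) * (4 * x)) with (8 * Q * 3 ^ M * x * x ^ M) by ring.
          assert (0 <= 8 * Q * 3 ^ M * x) by (apply Rmult_le_pos; nra).
          assert (0 <= x ^ M) by (apply pow_le; lra). nra. }
        nra. }
      unfold w. assert (u t ^ 2 <= 4 * x ^ 2) by (simpl; nra).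
      assert (v t ^ 2 <= x ^ 2).
      { rewrite <- (pow2_abs (v t)). apply pow_incr. split; [apply Rabs_pos|assumption]. }
      lra. }
  assert (Hin : forall t, 0 <= t <= T -> Rabs (u t) <= rho /\ Rabs (v t) <= rho).
  { intros t Ht. apply Hbw. specialize (Htrap t Ht). unfold rho. assert (0 < x ^ 2) by now apply pow_lt. nra. }
  destruct (Hbox 0 T ltac:(lra) ltac:(lra) ltac:(lra) Hin) as (A1 & _ & A3).
  destruct (Hin 0 ltac:(lra)) as [U1 _].
  rewrite uT, u0 in A1. rewrite uT, vT, u0, v0 in A3. rewrite u0 in U1. split; [assumption|].
  rewrite Rabs_minus_sym. eapply Rle_trans; [exact A3|]. unfold rho. rewrite Rpow_mult_distr.
  apply Rabs_le_between in U1. unfold rho in U1.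
  assert (0 <= x ^ M) by (apply pow_le; lra).
  replace (8 * Q * 3 ^ M * x ^ M) with (2 * Q * (3 ^ M * x ^ M) * 4) by ring.
  apply Rmult_le_compat_l; [|lra]. apply Rmult_le_pos; nra.
Qed.

(** * The involution of a tangent point *)

Lemma mean_value_everywhere (g dg : R -> R) a b : (forall z, is_derive g z (dg z)) ->
  exists c, Rmin a b <= c <= Rmax a b /\ g b - g a = dg c * (b - a).
Proof.
  intros D. apply MVT_gen; intros; [apply D|].
  apply continuity_pt_filterlim. eapply is_derive_continuous, D.
Qed.

Lemma poly_meval_axis l : polynomial (fun z => meval l z 0).
Proof.
  induction l as [|[[c i] j] l IH]; simpl; [apply poly_const|].
  apply poly_plus; [|exact IH]. apply (poly_ext (fun z => (c * 0 ^ j) * z ^ i)); [intros; ring|].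
  apply poly_scal, poly_pow.
Qed.

(** The restriction of the first integral to the switching line, recorded through its derivative because
    both lower and upper bounds for its increments are needed. *)
Definition fold_potential (n : nat) (g : R -> R) : Prop :=
  polynomial g /\ exists dg kappa B d, (forall z, is_derive g z (dg z)) /\ 0 < kappa /\ 0 <= B /\ 0 < d /\
    forall z, Rabs z < d -> Rabs (dg z + kappa * z ^ n) <= B * Rabs z ^ S n.

(** With [2 * l] even, equal values of [g] on the two sides of [0] force [x0 = - x + O(x ^ 2)]. *)
Lemma tangent_half_return F l : (1 <= l)%nat -> analytic_field F -> vX F 0 0 <> 0 ->
  (forall j : nat, (j <= 2 * l - 2)%nat -> Derive_n (fun x => vY F x 0) j 0 = 0) ->
  0 < vX F 0 0 * Derive_n (fun x => vY F x 0) (2 * l - 1) 0 ->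
  (exists d, 0 < d /\ forall x, 0 < x < d -> exists x0, Pi_minus F x0 x) ->
  forall M, (2 * l + 1 <= M)%nat -> exists g C d, fold_potential (2 * l - 1) g /\ 0 <= C /\ 0 < d /\
    forall x x0, 0 < x < d -> x0 < 0 -> Pi_minus F x0 x ->
      Rabs (g x0 - g x) <= C * x ^ M /\ Rabs (x0 + x) <= C * x ^ 2.
Proof.
  intros Hl HF HX0 HD0 HDn (dr & Hdr & Hret) M HM.
  destruct HF as [AX AY].
  set (n := (2 * l - 1)%nat) in *.
  assert (HSn : S n = (2 * l)%nat) by (unfold n; lia).
  destruct (analytic_axis_leading (vY F) n AY) as (Ce & e & He & HY).
  { intros j Hj; apply HD0. unfold n in Hj; lia. }
  set (c := Derive_n (fun x => vY F x 0) n 0 / INR (fact n)) in *.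
  assert (Hfact : 0 < INR (fact n)) by apply INR_fact_lt_0.
  assert (HXc : 0 < vX F 0 0 * c).
  { unfold c. replace (vX F 0 0 * (Derive_n (fun x => vY F x 0) n 0 / INR (fact n)))
      with (vX F 0 0 * Derive_n (fun x => vY F x 0) n 0 / INR (fact n)) by (field; lra).
    now apply Rdiv_lt_0_compat. }
  assert (Hc : 0 < c).
  { apply Rnot_le_lt; intros [Hc|Hc]; [|rewrite Hc, Rmult_0_r in HXc; lra].
    destruct (no_arc_arriving_downwards F n c Ce e Hc He HY) as (d & Hd & Hno).
    set (x := Rmin d dr / 2). assert (0 < Rmin d dr) by (apply Rmin_glb_lt; assumption).
    min_bounds.
    destruct (Hret x ltac:(unfold x; lra)) as (x0 & Hx0). apply (Hno x x0); [unfold x; lra|assumption]. }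
  assert (HXp : 0 < vX F 0 0) by (apply Rnot_le_lt; intros Hle; nra).
  assert (Y0 : vY F 0 0 = 0) by (apply (HD0 0%nat); lia).
  destruct (flow_box_exists F (conj AX AY) HX0 Y0 M ltac:(lia)) as (k & C & delta & FB).
  destruct (axis_slope F M k C delta n c e Ce FB HX0 ltac:(lia) He HY) as (B & d & HB & Hd & Hslope).
  set (I := (1, 0%nat, 1%nat) :: k) in *. set (g := fun z => meval I z 0).
  set (dg := fun z => meval (mdx I) z 0) in *.
  set (kappa := c / vX F 0 0) in *. assert (Hkappa : 0 < kappa) by now apply Rdiv_lt_0_compat.
  assert (Dg : forall z, is_derive g z (dg z)).
  { intros z. pose proof (meval_derive I (fun s => s) (fun _ => 0) z 1 0
      (is_derive_id (K := R_AbsRing) z) (is_derive_const (V := R_NormedModule) 0 z)) as D.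
    eapply eq_ind; [exact D|]. unfold dg. rewrite Rmult_1_r, Rmult_0_r. apply Rplus_0_r. }
  assert (g0 : g 0 = 0).
  { destruct (meval_bound 2 k (fb_degrees _ _ _ _ _ FB)) as (A & _ & HA).
    specialize (HA 0 0 0 ltac:(rewrite Rabs_R0; lra) ltac:(rewrite Rabs_R0; lra) ltac:(lra)).
    rewrite pow_i, Rmult_0_r in HA by lia.
    unfold g, I; cbn [meval]. assert (meval k 0 0 = 0) as ->; [|simpl; ring].
    apply Rabs_eq_0. apply Rle_antisym; [assumption|apply Rabs_pos]. }
  pose proof (potential_of_slope g dg kappa B d n Dg g0 Hslope HB) as Hpot.
  set (gamma := kappa / INR (S n)) in *.
  assert (Hgamma : 0 < gamma) by (apply Rdiv_lt_0_compat; [assumption|apply lt_0_INR; lia]).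
  destruct (tangent_arc F M k C delta n gamma B d FB HXp ltac:(lia)) as (C' & d' & HC' & Hd' & Harc);
    try assumption.
  { rewrite HSn. now exists l. }
  fold I g in Harc.
  assert (H3n : 0 < 3 ^ S (S n)) by (apply pow_lt; lra).
  set (C2 := (C' + B * 3 ^ S (S n) + B) / gamma).
  assert (HC2 : 0 <= C2) by (apply Rdiv_le_0_compat; [nra|assumption]).
  exists g, (C' + C2), (Rmin d' (Rmin (d / 3) 1)).
  split; [|split; [lra|split; [repeat apply Rmin_glb_lt; lra|]]].
  { split; [apply poly_meval_axis|]. exists dg, kappa, B, d. split; [exact Dg|]. split; [assumption|]. split; [assumption|]. split; [assumption|]. exact Hslope. }
  intros x x0 Hx Hx0 Hpi.
  min_bounds.
  destruct (Harc x x0 ltac:(lra) Hx0 Hpi) as [A1 A2].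
  assert (HxM : 0 <= x ^ M) by (apply pow_le; lra).
  assert (HC2M : 0 <= C2 * x ^ M) by now apply Rmult_le_pos.
  change (Rabs (g x0 - g x) <= C' * x ^ M) in A2. split; [lra|].
  pose proof (Hpot x0 ltac:(lra)) as P0. pose proof (Hpot x ltac:(rewrite Rabs_pos_eq; lra)) as P1.
  rewrite (Rabs_pos_eq x) in P1 by lra.
  set (w := - x0). assert (Hw : 0 < w) by (unfold w; lra).
  assert (Hw3 : Rabs x0 ^ S (S n) <= 3 ^ S (S n) * x ^ S (S n)).
  { rewrite <- Rpow_mult_distr. apply pow_incr. split; [apply Rabs_pos|lra]. }
  assert (Hw' : x0 ^ S n = w ^ S n).
  { unfold w. replace (- x0) with (-1 * x0) by ring. rewrite Rpow_mult_distr, HSn, pow_1_even. ring. }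
  rewrite Hw' in P0.
  assert (HxMn : x ^ M <= x ^ S (S n)) by (apply pow_le_antitone; [lra|lia]).
  set (px := x ^ S (S n)) in *. assert (Hpx : 0 <= px) by (apply pow_le; lra).
  assert (Hdiff : gamma * Rabs (w ^ S n - x ^ S n) <= (C' + B * 3 ^ S (S n) + B) * px).
  { rewrite <- (Rabs_pos_eq gamma) at 1 by lra. rewrite <- Rabs_mult.
    replace (gamma * (w ^ S n - x ^ S n)) with ((g x0 + gamma * w ^ S n) +
      (- (g x + gamma * x ^ S n) + - (g x0 - g x))) by ring.
    triangle.
    pose proof (Rabs_triang (- (g x + gamma * x ^ S n)) (- (g x0 - g x))) as Ht. rewrite !Rabs_Ropp in Ht.
    assert (B * Rabs x0 ^ S (S n) <= B * (3 ^ S (S n) * px)) by (apply Rmult_le_compat_l; assumption).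
    nra. }
  pose proof (pow_difference_lower n w x Hw ltac:(lra)) as Hlow.
  replace (x0 + x) with (- (w - x)) by (unfold w; ring). rewrite Rabs_Ropp.
  assert (Hxn : 0 < x ^ n) by (apply pow_lt; lra).
  assert (Hw2 : Rabs (w - x) <= C2 * x ^ 2).
  { apply Rmult_le_reg_l with (gamma * x ^ n); [now apply Rmult_lt_0_compat|].
    replace (gamma * x ^ n * (C2 * x ^ 2)) with ((C' + B * 3 ^ S (S n) + B) * px)
      by (unfold C2, px; simpl; field; lra).
    eapply Rle_trans; [|exact Hdiff]. rewrite Rmult_assoc. apply Rmult_le_compat_l; lra. }
  assert (0 <= x ^ 2) by (apply pow_le; lra). nra.
Qed.

Lemma bigO_power n f : bigO 1 f -> bigO n (fun x => f x ^ n).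
Proof.
  intros Hf; induction n as [|n IH]; [exact (bigO_pow 0)|].
  simpl. exact (bigO_mult 1 n _ _ Hf IH).
Qed.

Lemma bigO_comp_poly h f : polynomial h -> bigO 1 f -> bigO 0 (fun x => h (f x)).
Proof.
  intros Hh Hf. destruct (poly_bounded h Hh) as (B & HB & Hb).
  destruct (bigO_small f Hf 1 ltac:(lra)) as (d & Hd & Hs).
  apply (bigO_intro _ _ B d Hd). intros x Hx. simpl; rewrite Rmult_1_r. apply Hb, Rlt_le, Hs, Hx.
Qed.

(** The polynomial [g (psi x) - g x] vanishes to high order for small positive [x], hence also at the
    negative point [psi x].  So [psi (psi x)] and [x] have nearly the same value of [g], and both lie on
    the positive side, where [g] is injective. *)
Lemma fold_potential_reflects n k g psi C d : fold_potential n g -> polynomial psi -> (1 <= k)%nat -> 0 < d ->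
  (forall x, 0 < x < d -> exists x0, Rabs (g x0 - g x) <= C * x ^ (n + S k) /\
     Rabs (x0 + x) <= C * x ^ 2 /\ Rabs (x0 - psi x) <= C * x ^ S k) ->
  tangent_to_line 1 psi /\ bigO (S k) (fun x => psi (psi x) - x).
Proof.
  intros (Pg & dg & kappa & B & dd & Dg & Hkappa & HB & Hdd & Hdg) Ppsi Hk Hd H.
  assert (HC : 0 <= C).
  { destruct (H (d / 2) ltac:(lra)) as (x0 & _ & H2 & _). pose proof (Rabs_pos (x0 + d / 2)).
    assert (0 < (d / 2) ^ 2) by (apply pow_lt; lra). nra. }
  assert (Lpsi : bigO 2 (fun x => psi x + x)).
  { apply (bigO_intro _ _ (2 * C) (Rmin d 1)); [apply Rmin_glb_lt; lra|]. intros x Hx.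
    min_bounds.
    destruct (H x ltac:(lra)) as (x0 & _ & H2 & H3).
    replace (psi x + x) with ((x0 + x) + - (x0 - psi x)) by ring.
    triangle. rewrite Rabs_Ropp.
    assert (x ^ S k <= x ^ 2) by (apply pow_le_antitone; [lra|lia]). nra. }
  assert (Tpsi : tangent_to_line 1 psi).
  { destruct (poly_bigO_factor 2 (fun x => psi x + x)) as (p & Pp & Ep); [|assumption|].
    - apply poly_plus; [assumption|apply poly_id].
    - exists p; split; [assumption|]. intros x. rewrite <- Ep; ring. }
  split; [assumption|].
  assert (Opsi : bigO 1 psi).
  { apply (bigO_1_of_leading 1). apply (bigO_ext _ (fun x => psi x + x)); [intros; ring|assumption]. }
  set (M := (n + S k)%nat) in *.
  assert (G1 : bigO M (fun x => g (psi x) - g x)).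
  { destruct (bigO_small _ (bigO_weaken 2 1 _ ltac:(lia) Lpsi) 1 ltac:(lra)) as (d1 & Hd1 & _).
    destruct Lpsi as (Cp & dp & HCp & Hdp & Hdp1 & Lp).
    set (D := (kappa + B) * 2 ^ n).
    assert (H2n : 0 < 2 ^ n) by (apply pow_lt; lra).
    assert (HD : 0 <= D) by (apply Rmult_le_pos; lra).
    set (K := C + Cp + 2).
    apply (bigO_intro _ _ (C + D * C) (Rmin (Rmin d dp) (Rmin (dd / 2) (/ K)))).
    { assert (0 < / K) by (apply Rinv_0_lt_compat; unfold K; lra). repeat apply Rmin_glb_lt; lra. }
    intros x Hx.
    min_bounds.
    destruct (H x ltac:(lra)) as (x0 & Hx1 & Hx2 & Hx3). specialize (Lp x ltac:(lra)).
    assert (HxK : x * K < 1).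
    { apply below_unit; unfold K in *; lra. }
    assert (N1 : C * x ^ 2 <= x) by (unfold K in HxK; simpl; nra).
    assert (N2 : Cp * x ^ 2 <= x) by (unfold K in HxK; simpl; nra).
    assert (B1 : Rabs (x0 + x) <= x) by lra. assert (B2 : Rabs (psi x + x) <= x) by lra.
    apply Rabs_le_between in B1. apply Rabs_le_between in B2.
    destruct (mean_value_everywhere g dg x0 (psi x) Dg) as (c & Hc & Emv).
    assert (Hcx : Rabs c <= 2 * x).
    { apply Rabs_le. unfold Rmin, Rmax in Hc. destruct (Rle_dec x0 (psi x)); lra. }
    assert (Hdgc : Rabs (dg c) <= D * x ^ n).
    { specialize (Hdg c ltac:(lra)).
      replace (dg c) with ((dg c + kappa * c ^ n) + - (kappa * c ^ n)) by ring.
      triangle. rewrite Rabs_Ropp, Rabs_mult, <- RPow_abs, (Rabs_pos_eq kappa) by lra.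
      assert (Hcn : Rabs c ^ n <= 2 ^ n * x ^ n).
      { rewrite <- Rpow_mult_distr. apply pow_incr. split; [apply Rabs_pos|assumption]. }
      assert (0 <= Rabs c ^ n) by apply pow_le, Rabs_pos.
      assert (HK1 : x <= / 2).
      { unfold K in HxK. nra. }
      assert (Rabs c ^ S n <= Rabs c ^ n) by (apply pow_le_antitone; [split; [apply Rabs_pos|lra]|lia]).
      unfold D. nra. }
    replace (g (psi x) - g x) with ((g (psi x) - g x0) + (g x0 - g x)) by ring.
    triangle. rewrite Emv, Rabs_mult.
    rewrite (Rabs_minus_sym (psi x)).
    assert (Rabs (dg c) * Rabs (x0 - psi x) <= D * x ^ n * (C * x ^ S k)).
    { apply Rmult_le_compat; try apply Rabs_pos; assumption. }
    unfold M in *. rewrite pow_add in *. lra. }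
  (* The identity g (psi x) = g x is now used at the negative point psi x. *)
  assert (G2 : bigO M (fun x => g (psi (psi x)) - g x)).
  { destruct (poly_bigO_factor M (fun x => g (psi x) - g x)) as (h & Ph & Eh); [|assumption|].
    - apply (poly_ext (fun x => g (psi x) + -1 * g x)); [intros; ring|].
      apply poly_plus; [now apply poly_comp|now apply poly_scal].
    - apply (bigO_ext _ (fun x => psi x ^ M * h (psi x) + (g (psi x) - g x))).
      { intros x. rewrite <- Eh. ring. }
      apply bigO_plus; [|assumption].
      pose proof (bigO_mult M 0 _ _ (bigO_power M psi Opsi) (bigO_comp_poly h psi Ph Opsi)) as Q.
      now rewrite Nat.add_0_r in Q. }
  pose proof (tangent_comp_leading 1 1 psi psi Tpsi Tpsi) as L2.
  destruct L2 as (C2 & d2 & HC2 & Hd2 & _ & L2).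
  destruct G2 as (CG & dG & HCG & HdG & HdG1 & G2).
  set (K := 2 * C2 + 2 * B * 2 / kappa + 1).
  assert (HBk : 0 <= 2 * B * 2 / kappa) by (apply Rdiv_le_0_compat; lra).
  assert (HK : 0 < / K) by (apply Rinv_0_lt_compat; unfold K; lra).
  assert (Hp2 : 0 < (/ 2) ^ n) by (apply pow_lt; lra).
  apply (bigO_intro _ _ (CG / ((/ 2) ^ n * (kappa / 2))) (Rmin (Rmin d2 dG) (Rmin (dd / 2) (/ K)))).
  { repeat apply Rmin_glb_lt; lra. }
  intros x Hx.
  min_bounds.
  specialize (L2 x ltac:(lra)). specialize (G2 x ltac:(lra)).
  assert (HxK : x * K < 1).
  { apply below_unit; unfold K in *; lra. }
  set (a := psi (psi x)) in *.
  assert (N1 : C2 * x ^ 2 <= x / 2) by (unfold K in HxK; simpl; nra).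
  assert (Ba : Rabs (a - x) <= x / 2).
  { replace (a - x) with (a - 1 * 1 * x) by ring. lra. }
  apply Rabs_le_between in Ba.
  destruct (mean_value_everywhere g dg x a Dg) as (c & Hc & Emv).
  assert (Hcx : x / 2 <= c <= 2 * x).
  { unfold Rmin, Rmax in Hc. destruct (Rle_dec x a); lra. }
  assert (N2 : B * c <= kappa / 2).
  { assert (x * (2 * B * 2 / kappa) < 1) by (apply (below_inverse K); (assumption || (unfold K; lra) || lra)).
    assert (x * (2 * B * 2 / kappa) * kappa < kappa) by (now apply below_scale).
    replace (x * (2 * B * 2 / kappa) * kappa) with (4 * B * x) in * by (field; lra). nra. }
  assert (Hxn : 0 < x ^ n) by (apply pow_lt; lra).
  assert (Hlow : (/ 2) ^ n * (kappa / 2) * x ^ n <= Rabs (dg c)).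
  { specialize (Hdg c ltac:(rewrite Rabs_pos_eq; lra)). rewrite (Rabs_pos_eq c) in Hdg by lra.
    assert (Hcn : (/ 2) ^ n * x ^ n <= c ^ n) by (rewrite <- Rpow_mult_distr; apply pow_incr; lra).
    apply Rabs_le_between in Hdg. change (c ^ S n) with (c * c ^ n) in Hdg.
    assert (0 <= c ^ n) by (apply pow_le; lra).
    assert (kappa / 2 * c ^ n <= - dg c) by nra.
    rewrite <- Rabs_Ropp. eapply Rle_trans; [|apply Rle_abs]. nra. }
  set (m := (/ 2) ^ n * (kappa / 2)) in *. assert (Hm : 0 < m) by (unfold m; apply Rmult_lt_0_compat; lra).
  apply Rmult_le_reg_l with (m * x ^ n); [now apply Rmult_lt_0_compat|].
  replace (m * x ^ n * (CG / m * x ^ S k)) with (CG * x ^ M) by (unfold M; rewrite pow_add; field; lra).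
  eapply Rle_trans; [|exact G2]. rewrite Emv, Rabs_mult.
  apply Rmult_le_compat_r; [apply Rabs_pos|assumption].
Qed.

(** * From constants to orders *)

Definition leading_displacement (Fp Fm : vector_field) (k : nat) (V : R) : Prop :=
  exists C e, 0 < e /\ forall x, 0 < x < e ->
    exists d, displacement Fp Fm x d /\ Rabs (d - V * x ^ k) <= C * x ^ S k.

Lemma lyapunov_leading_displacement Fp Fm V k : lyapunov_constants Fp Fm V -> (1 <= k)%nat ->
  (forall j, (1 <= j < k)%nat -> V j = 0) -> leading_displacement Fp Fm k (V k).
Proof. intros (r & Hr & H) Hk H0. exact (lyapunov_leading_term V r _ k Hr H Hk H0). Qed.

Lemma displacement_points Fp Fm k V q1 q2 : leading_displacement Fp Fm k V ->
  plus_jet Fp (S k) q1 -> minus_jet Fm (S k) q2 ->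
  exists C e, 0 <= C /\ 0 < e /\ forall x, 0 < x < e -> exists y,
    Rabs y <= C * x /\ Rabs (q1 y - x) <= C * x ^ S k /\ Rabs (y - (q2 x - V * x ^ k)) <= C * x ^ S k.
Proof.
  intros (C & e & He & HD) (C1 & d1 & HC1 & Hd1 & H1) (C2 & d2 & HC2 & Hd2 & H2).
  exists (C1 + C2 + Rabs C), (Rmin e (Rmin d1 d2)).
  pose proof (Rabs_pos C) as HC. pose proof (Rle_abs C).
  split; [lra|]. split; [repeat apply Rmin_glb_lt; assumption|]. intros x Hx.
  min_bounds.
  destruct (HD x ltac:(lra)) as (d & (x0 & x1 & Hx0 & Hm & Hp & Ed) & Hd).
  destruct (H1 x x1 ltac:(lra) Hp) as [A1 A2]. specialize (H2 x x0 ltac:(lra) Hx0 Hm).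
  assert (HxS : 0 <= x ^ S k) by (apply pow_le; lra).
  exists x1. split; [nra|]. split; [nra|].
  replace (x1 - (q2 x - V * x ^ k)) with ((x0 - q2 x) + - (d - V * x ^ k)) by (rewrite Ed; ring).
  triangle. rewrite Rabs_Ropp. nra.
Qed.

(** The displacement gives the upper half-return point as [q2 x - V * x ^ k] up to [x ^ (k + 1)], and [q1]
    sends that point back to [x]. *)
Lemma displacement_identity Fp Fm k V q1 q2 lam : (1 <= k)%nat -> leading_displacement Fp Fm k V ->
  plus_jet Fp (S k) q1 -> minus_jet Fm (S k) q2 -> polynomial q1 -> tangent_to_line lam q2 ->
  bigO (S k) (fun x => q1 (q2 x - V * x ^ k) - x).
Proof.
  intros Hk HD H1 H2 P1 T2.
  destruct (displacement_points Fp Fm k V q1 q2 HD H1 H2) as (C & e & HC & He & H).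
  destruct (poly_lipschitz q1 P1) as (L & HL & HL').
  assert (Ow : bigO 1 (fun x => q2 x - V * x ^ k)).
  { apply bigO_minus; [exact (bigO_1_of_leading _ _ (tangent_leading _ _ T2))|].
    apply bigO_scal, (bigO_weaken k); [assumption|apply bigO_pow]. }
  destruct (bigO_small _ Ow 1 ltac:(lra)) as (d & Hd & Hs).
  apply (bigO_intro _ _ (L * C + C) (Rmin (Rmin e d) (/ (C + 1)))).
  { repeat apply Rmin_glb_lt; try assumption. apply Rinv_0_lt_compat; lra. }
  intros x Hx.
  min_bounds.
  destruct (H x ltac:(lra)) as (y & Y1 & Y2 & Y3). specialize (Hs x ltac:(lra)).
  assert (Hy : Rabs y <= 1).
  { assert (x * (C + 1) < 1); [|nra].
    apply below_unit; lra. }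
  set (w := q2 x - V * x ^ k) in *.
  specialize (HL' w y (Rlt_le _ _ Hs) Hy). rewrite Rabs_minus_sym in Y3.
  replace (q1 w - x) with ((q1 w - q1 y) + (q1 y - x)) by ring.
  triangle. rewrite Rmult_plus_distr_r.
  apply Rplus_le_compat; [|assumption]. rewrite Rmult_assoc.
  eapply Rle_trans; [exact HL'|]. apply Rmult_le_compat_l; assumption.
Qed.

Definition constants_linked (V1 V2 V : nat -> R) : Prop :=
  forall k, Nat.Odd k -> (forall j, (1 <= j < k)%nat -> V1 j = 0 /\ V2 j = 0 /\ V j = 0) ->
    odd_constants_linked (V1 k) (V2 k) (V k).

Lemma focus_focus_constants_linked Fp Fm V1 V2 V :
  analytic_field Fp -> analytic_field Fm -> is_focus Fp -> is_focus Fm ->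
  enters_counterclockwise Fp -> enters_counterclockwise Fm ->
  lyapunov_constants Fp Fp V1 -> lyapunov_constants Fm Fm V2 -> lyapunov_constants Fp Fm V ->
  constants_linked V1 V2 V.
Proof.
  intros Ap Am Op Om Ep Em L1 L2 L k Hk H0.
  assert (Hk1 : (1 <= k)%nat) by (destruct Hk; lia).
  destruct (focus_half_return_jet Fp Ap Op Ep (S k)) as (q1 & l1 & Hl1 & T1 & P1 & M1).
  destruct (focus_half_return_jet Fm Am Om Em (S k)) as (q2 & l2 & Hl2 & T2 & P2 & M2).
  pose proof (lyapunov_leading_displacement Fp Fp V1 k L1 Hk1 (fun j Hj => proj1 (H0 j Hj))) as D1.
  pose proof (lyapunov_leading_displacement Fm Fm V2 k L2 Hk1 (fun j Hj => proj1 (proj2 (H0 j Hj)))) as D2.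
  pose proof (lyapunov_leading_displacement Fp Fm V k L Hk1 (fun j Hj => proj2 (proj2 (H0 j Hj)))) as D.
  pose proof (tangent_poly _ _ T1) as Q1. pose proof (tangent_poly _ _ T2) as Q2.
  apply (first_odd_constants k q1 q2 l1 l2); try assumption.
  - now apply (displacement_identity Fp Fp k (V1 k) q1 q1 l1).
  - now apply (displacement_identity Fm Fm k (V2 k) q2 q2 l2).
  - now apply (displacement_identity Fp Fm k (V k) q1 q2 l2).
Qed.

(** The jet [psi] of the inverse of [Pi_minus] is obtained from the two displacement maps:
    [q1 x - V1 k * x ^ k] is the jet of [Pi_plus], and adding [V k * x ^ k] gives [psi]. *)
Lemma focus_tangent_constants_linked Fp Fm V1 V :
  analytic_field Fp -> analytic_field Fm -> is_focus Fp -> enters_counterclockwise Fp ->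
  invisible_tangent_point_of_lower Fm ->
  lyapunov_constants Fp Fp V1 -> lyapunov_constants Fp Fm V ->
  constants_linked V1 (fun _ => 0) V.
Proof.
  intros Ap Am Op Ep (l & Hl & HX0 & HD0 & HDn) L1 L k Hk H0.
  assert (Hk1 : (1 <= k)%nat) by (destruct Hk; lia).
  destruct (focus_half_return_jet Fp Ap Op Ep (S k)) as (q1 & l1 & Hl1 & T1 & P1 & M1).
  pose proof (tangent_poly _ _ T1) as Q1.
  pose proof (bigO_1_of_leading _ _ (tangent_leading _ _ T1)) as B1.
  pose proof (lyapunov_leading_displacement Fp Fp V1 k L1 Hk1 (fun j Hj => proj1 (H0 j Hj))) as D1.
  pose proof (lyapunov_leading_displacement Fp Fm V k L Hk1 (fun j Hj => proj2 (proj2 (H0 j Hj)))) as D.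
  pose proof (displacement_identity Fp Fp k (V1 k) q1 q1 l1 Hk1 D1 P1 M1 Q1 T1) as I1.
  set (p := fun x => q1 x - V1 k * x ^ k) in *.
  assert (Op1 : bigO 1 p).
  { apply bigO_minus; [assumption|]. apply bigO_scal, (bigO_weaken k); [assumption|apply bigO_pow]. }
  set (psi := fun x => p x + V k * x ^ k).
  assert (Ppsi : polynomial psi).
  { apply (poly_ext (fun x => q1 x + (V k - V1 k) * x ^ k)); [intros; unfold psi, p; ring|].
    apply poly_plus; [assumption|]. apply poly_scal, poly_pow. }
  destruct D as (C & e & He & HD).
  destruct (tangent_half_return Fm l Hl Am HX0 HD0 HDn) with (M := (2 * l - 1 + S k)%nat)
    as (g & Cg & dg & Hfold & HCg & Hdg & Hg).
  { exists e; split; [assumption|]. intros x Hx. destruct (HD x Hx) as (d & (x0 & x1 & _ & Hm & _) & _).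
    now exists x0. }
  { lia. }
  (* The upper half-return point of any displacement arc agrees with p x up to the order considered. *)
  assert (Hx1 : exists A d, 0 < d /\ forall x y, 0 < x < d -> Pi_plus Fp x y -> Rabs (y - p x) <= A * x ^ S k).
  { destruct P1 as (C1 & d1 & HC1 & Hd1 & H1).
    destruct (tangent_local_injectivity l1 q1 Hl1 T1) as (r & Hr & Hinj).
    destruct I1 as (CI & dI & HCI & HdI & _ & HI).
    destruct (bigO_small p Op1 r Hr) as (dp & Hdp & Hp).
    exists (2 / l1 * (C1 + CI)), (Rmin (Rmin d1 dI) (Rmin dp (r / (C1 + 1)))).
    split; [repeat apply Rmin_glb_lt; try assumption; apply Rdiv_lt_0_compat; lra|]. intros x y Hx Hy.
    min_bounds.
    destruct (H1 x y ltac:(lra) Hy) as [Y1 Y2]. specialize (HI x ltac:(lra)). specialize (Hp x ltac:(lra)).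
    assert (Hyr : Rabs y < r).
    { assert (x * (C1 + 1) < r); [|nra].
      apply Rlt_div_r; lra. }
    specialize (Hinj (p x) y Hp Hyr).
    apply Rmult_le_reg_l with (l1 / 2); [lra|].
    replace (l1 / 2 * (2 / l1 * (C1 + CI) * x ^ S k)) with ((C1 + CI) * x ^ S k) by (field; lra).
    eapply Rle_trans; [exact Hinj|].
    replace (q1 y - q1 (p x)) with ((q1 y - x) + - (q1 (p x) - x)) by ring.
    triangle. rewrite Rabs_Ropp. change (q1 (p x)) with (q1 (q1 x - V1 k * x ^ k)). lra. }
  destruct Hx1 as (A & dA & HdA & HA).
  destruct (fold_potential_reflects (2 * l - 1) k g psi (Cg + (Rabs C + Rabs A)) (Rmin (Rmin e dg) dA)
    Hfold Ppsi Hk1) as [Tpsi Ipsi].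
  { repeat apply Rmin_glb_lt; assumption. }
  { intros x Hx. pose proof (Rmin_l (Rmin e dg) dA); pose proof (Rmin_r (Rmin e dg) dA).
    min_bounds.
    destruct (HD x ltac:(lra)) as (d & (x0 & x1 & Hx0 & Hm & Hp & Ed) & Hd).
    exists x0. specialize (HA x x1 ltac:(lra) Hp). destruct (Hg x x0 ltac:(lra) Hx0 Hm) as [G1 G2].
    pose proof (Rabs_pos C); pose proof (Rabs_pos A); pose proof (Rle_abs C); pose proof (Rle_abs A).
    assert (0 <= x ^ (2 * l - 1 + S k)) by (apply pow_le; lra).
    assert (0 <= x ^ 2) by (apply pow_le; lra).
    assert (HxS : 0 <= x ^ S k) by (apply pow_le; lra).
    split; [nra|]. split; [nra|].
    replace (x0 - psi x) with ((d - V k * x ^ k) + (x1 - p x)) by (unfold psi; rewrite Ed; ring).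
    triangle.
    assert (C * x ^ S k <= Rabs C * x ^ S k) by now apply Rmult_le_compat_r.
    assert (A * x ^ S k <= Rabs A * x ^ S k) by now apply Rmult_le_compat_r.
    assert (0 <= Cg * x ^ S k) by now apply Rmult_le_pos. lra. }
  apply (first_odd_constants k q1 psi l1 1); try assumption; [lra| |].
  - apply (bigO_ext _ (fun x => psi (psi x) - x)); [|assumption]. intros x. f_equal. f_equal. ring.
  - apply (bigO_ext _ (fun x => q1 (p x) - x)); [|assumption].
    intros x. f_equal. f_equal. unfold psi; ring.
Qed.

(** * Possible orders *)

Definition order_of_constants (V : nat -> R) (s : Rbar) : Prop :=
  (exists i : nat, s = Finite (INR i / 2) /\
     (forall k : nat, (1 <= k <= i)%nat -> V k = 0) /\ V (S i) <> 0) \/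
  (s = p_infty /\ forall k : nat, (1 <= k)%nat -> V k = 0).

Lemma order_integer V n : order_of_constants V (Finite (INR n)) ->
  (forall k, (1 <= k <= 2 * n)%nat -> V k = 0) /\ V (S (2 * n)) <> 0.
Proof.
  intros [(i & E & H0 & H1)|[E _]]; [|discriminate].
  injection E as E. assert (i = (2 * n)%nat) as ->; [|now split].
  apply INR_eq. rewrite mult_INR. simpl (INR 2). lra.
Qed.

Lemma order_infinite V : order_of_constants V p_infty -> forall k, (1 <= k)%nat -> V k = 0.
Proof. intros [(i & E & _)|[_ H]]; [discriminate|assumption]. Qed.

Lemma order_vanishing V s n : order_of_constants V s -> (exists m, (n <= m)%nat /\ s = Finite (INR m)) \/ s = p_infty ->
  forall k, (1 <= k <= 2 * n)%nat -> V k = 0.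
Proof.
  intros H [(m & Hm & ->)| ->] k Hk.
  - apply (order_integer V m H). lia.
  - apply (order_infinite V H). lia.
Qed.

(** Below the orders of both subsystems, an odd-indexed constant is determined by two vanishing ones. *)
Lemma first_constant_parity V1 V2 V i n : constants_linked V1 V2 V ->
  (forall k, (1 <= k <= 2 * n)%nat -> V1 k = 0 /\ V2 k = 0) ->
  (forall k, (1 <= k <= i)%nat -> V k = 0) -> V (S i) <> 0 -> (i < 2 * n)%nat ->
  exists h, (h < n)%nat /\ i = (2 * h + 1)%nat.
Proof.
  intros HL H12 H0 H1 Hi. destruct (Nat.Even_or_Odd (S i)) as [[h Hh]|Hodd].
  - exists (h - 1)%nat. lia.
  - exfalso. apply H1. destruct (HL (S i) Hodd) as [A _].
    + intros j Hj. destruct (H12 j ltac:(lia)) as [E1 E2]. repeat split; try assumption. apply H0; lia.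
    + apply A; apply H12; lia.
Qed.

Lemma odd_half_value h : INR (2 * h + 1) / 2 = (2 * INR h + 1) / 2.
Proof. rewrite plus_INR, mult_INR. simpl. lra. Qed.

Lemma odd_halves_below_finite h n : (h < n)%nat -> odd_halves_below (Finite (INR n)) (Finite (INR (2 * h + 1) / 2)).
Proof.
  intros Hh. exists h. rewrite odd_half_value. split; [|reflexivity]. simpl.
  apply le_INR in Hh. rewrite S_INR in Hh. lra.
Qed.

Lemma order_zero_of_unequal V1 V2 V s : constants_linked V1 V2 V -> order_of_constants V s ->
  ~ (V1 1%nat = 0 <-> V2 1%nat = 0) -> s = Finite 0.
Proof.
  intros HL Hs Hne. assert (HV : V 1%nat <> 0).
  { intros E. apply Hne. apply (HL 1%nat); [now exists 0%nat|intros; lia|assumption]. }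
  destruct Hs as [(i & -> & H0 & H1)|[_ H0]]; [|exfalso; apply HV, H0; lia].
  destruct i as [|i]; [f_equal; simpl; lra|]. exfalso; apply HV, H0; lia.
Qed.

Lemma order_of_unequal V1 V2 V s n : constants_linked V1 V2 V -> order_of_constants V s ->
  (forall k, (1 <= k <= 2 * n)%nat -> V1 k = 0 /\ V2 k = 0) ->
  ~ (V1 (S (2 * n)) = 0 <-> V2 (S (2 * n)) = 0) ->
  odd_halves_below (Finite (INR n)) s \/ s = Finite (INR n).
Proof.
  intros HL Hs H12 Hne.
  assert (HV : (forall k, (1 <= k <= 2 * n)%nat -> V k = 0) -> V (S (2 * n)) <> 0).
  { intros H0 E. apply Hne. apply (HL (S (2 * n))); [exists n; lia| |assumption].
    intros j Hj. destruct (H12 j ltac:(lia)). repeat split; try assumption. apply H0; lia. }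
  destruct Hs as [(i & -> & H0 & H1)|[_ H0]].
  - destruct (Nat.lt_trichotomy i (2 * n)) as [Hi|[->|Hi]].
    + left. destruct (first_constant_parity V1 V2 V i n HL H12 H0 H1 Hi) as (h & Hh & ->).
      now apply odd_halves_below_finite.
    + right. f_equal. rewrite mult_INR. simpl. lra.
    + exfalso. apply HV; intros; apply H0; lia.
  - exfalso. apply HV; intros; apply H0; lia.
Qed.

Lemma order_of_equal_finite V1 V2 V s n : constants_linked V1 V2 V -> order_of_constants V s ->
  (forall k, (1 <= k <= 2 * n)%nat -> V1 k = 0 /\ V2 k = 0) ->
  odd_halves_below (Finite (INR n)) s \/ halves_from (Rbar_mult (Finite 2) (Finite (INR n))) s.
Proof.
  intros HL Hs H12. destruct Hs as [(i & -> & H0 & H1)|[-> _]].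
  - destruct (Nat.lt_ge_cases i (2 * n)) as [Hi|Hi].
    + left. destruct (first_constant_parity V1 V2 V i n HL H12 H0 H1 Hi) as (h & Hh & ->).
      now apply odd_halves_below_finite.
    + right. left. exists i. split; [|reflexivity]. simpl. apply le_INR in Hi.
      rewrite mult_INR in Hi. simpl in Hi. lra.
  - right. now right.
Qed.

Lemma order_of_centers V1 V2 V s : constants_linked V1 V2 V -> order_of_constants V s ->
  (forall k, (1 <= k)%nat -> V1 k = 0 /\ V2 k = 0) -> odd_halves_below p_infty s \/ s = p_infty.
Proof.
  intros HL Hs H12. destruct Hs as [(i & -> & H0 & H1)|[-> _]]; [left|now right].
  destruct (first_constant_parity V1 V2 V i (S i) HL) as (h & Hh & ->); try assumption; try lia.
  - intros; apply H12; lia.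
  - exists h. rewrite odd_half_value. now split.
Qed.

Lemma counterclockwise_enters Fp Fm : rotates_counterclockwise Fp Fm ->
  enters_counterclockwise Fp /\ enters_counterclockwise Fm.
Proof.
  intros (d & Hd & H1 & H2). split; exists d; (split; [assumption|]).
  - left. intros x Hx. destruct (H1 x Hx) as (x1 & _ & H). now exists x1.
  - right. intros x Hx. destruct (H2 x Hx) as (x1 & _ & H). now exists x1.
Qed.

Lemma orders_classified V1 V2 V sp sm s : constants_linked V1 V2 V ->
  order_of_constants V1 sp -> order_of_constants V2 sm -> order_of_constants V s ->
  ((sp = Finite 0 -> posint_or_infty sm -> s = Finite 0) /\
   (sm = Finite 0 -> posint_or_infty sp -> s = Finite 0)) /\
  (posint_or_infty sp -> posint_or_infty sm -> sp <> sm ->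
   odd_halves_below (Rbar_min sp sm) s \/ s = Rbar_min sp sm) /\
  (posint_or_infty sp -> posint_or_infty sm -> sp = sm ->
   odd_halves_below sp s \/ halves_from (Rbar_mult (Finite 2) sp) s).
Proof.
  intros HL H1 H2 Hs.
  assert (Hpos : forall W t, order_of_constants W t -> posint_or_infty t -> W 1%nat = 0).
  { intros W t HW Ht. apply (order_vanishing W t 1 HW); [exact Ht|lia]. }
  assert (Hzero : forall W, order_of_constants W (Finite 0) -> W 1%nat <> 0).
  { intros W HW. now apply (order_integer W 0). }
  assert (Hmin : forall a b : nat, (a < b)%nat -> Rbar_min (INR a) (INR b) = INR a /\ Rbar_min (INR b) (INR a) = INR a).
  { intros a b Hab. apply lt_INR in Hab. unfold Rbar_min; simpl.
    rewrite Rmin_left, Rmin_right by lra. now split. }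
  split; [split|split].
  - intros -> Hsm. apply (order_zero_of_unequal V1 V2 V s HL Hs).
    pose proof (Hzero _ H1). pose proof (Hpos _ _ H2 Hsm). tauto.
  - intros -> Hsp. apply (order_zero_of_unequal V1 V2 V s HL Hs).
    pose proof (Hzero _ H2). pose proof (Hpos _ _ H1 Hsp). tauto.
  - intros [(a & Ha & ->)| ->] [(b & Hb & ->)| ->] Hne.
    + destruct (order_integer _ _ H1) as [Z1 N1]. destruct (order_integer _ _ H2) as [Z2 N2].
      destruct (Nat.lt_trichotomy a b) as [Hab|[->|Hab]]; [|congruence|].
      * rewrite (proj1 (Hmin a b Hab)). apply (order_of_unequal V1 V2 V s a HL Hs).
        -- intros k Hk; split; [apply Z1|apply Z2]; lia.
        -- assert (V2 (S (2 * a)) = 0) by (apply Z2; lia). tauto.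
      * rewrite (proj2 (Hmin b a Hab)). apply (order_of_unequal V1 V2 V s b HL Hs).
        -- intros k Hk; split; [apply Z1|apply Z2]; lia.
        -- assert (V1 (S (2 * b)) = 0) by (apply Z1; lia). tauto.
    + destruct (order_integer _ _ H1) as [Z1 N1]. pose proof (order_infinite _ H2) as Z2.
      apply (order_of_unequal V1 V2 V s a HL Hs).
      * intros k Hk; split; [apply Z1|apply Z2]; lia.
      * assert (V2 (S (2 * a)) = 0) by (apply Z2; lia). tauto.
    + destruct (order_integer _ _ H2) as [Z2 N2]. pose proof (order_infinite _ H1) as Z1.
      apply (order_of_unequal V1 V2 V s b HL Hs).
      * intros k Hk; split; [apply Z1|apply Z2]; lia.
      * assert (V1 (S (2 * b)) = 0) by (apply Z1; lia). tauto.
    + congruence.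
  - intros [(a & Ha & ->)| ->] _ <-.
    + apply (order_of_equal_finite V1 V2 V s a HL Hs).
      intros k Hk; split; [apply (order_integer _ _ H1)|apply (order_integer _ _ H2)]; lia.
    + destruct (order_of_centers V1 V2 V s HL Hs) as [H| ->]; [|now left|right; now right].
      intros k Hk; split; [now apply order_infinite|now apply order_infinite].
Qed.

Theorem theorem1p3 (Fp Fm : vector_field) (sp : Rbar) :
  analytic_field Fp -> analytic_field Fm ->
  monodromic_singular_point Fp Fm ->
  rotates_counterclockwise Fp Fm ->
  nat_or_infty sp -> weak_focus_of_order Fp sp ->
  (forall sm s : Rbar,
     nat_or_infty sm -> weak_focus_of_order Fm sm -> has_order Fp Fm s ->
     ((sp = Finite 0 -> posint_or_infty sm -> s = Finite 0) /\
      (sm = Finite 0 -> posint_or_infty sp -> s = Finite 0)) /\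
     (posint_or_infty sp -> posint_or_infty sm -> sp <> sm ->
      odd_halves_below (Rbar_min sp sm) s \/ s = Rbar_min sp sm) /\
     (posint_or_infty sp -> posint_or_infty sm -> sp = sm ->
      odd_halves_below sp s \/ halves_from (Rbar_mult (Finite 2) sp) s)) /\
  (forall s : Rbar,
     invisible_tangent_point_of_lower Fm -> has_order Fp Fm s ->
     (sp = Finite 0 -> s = Finite 0) /\
     (posint_or_infty sp -> odd_halves_below sp s \/ s = sp)).
Proof.
  intros Ap Am _ Hrot _ (Op & V1 & L1 & H1).
  destruct (counterclockwise_enters Fp Fm Hrot) as [Ep Em].
  split.
  - intros sm s _ (Om & V2 & L2 & H2) (V & L & Hs).
    apply (orders_classified V1 V2 V); try assumption.
    now apply (focus_focus_constants_linked Fp Fm).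
  - intros s Htan (V & L & Hs).
    pose proof (focus_tangent_constants_linked Fp Fm V1 V Ap Am Op Ep Htan L1 L) as HL.
    assert (H2 : order_of_constants (fun _ => 0) p_infty) by (right; now split).
    assert (Hinf : posint_or_infty p_infty) by now right.
    destruct (orders_classified V1 (fun _ => 0) V sp p_infty s HL H1 H2 Hs) as ((Ha & _) & Hb & Hc).
    split; [intros E; exact (Ha E Hinf)|].
    intros [(n & Hn & ->)| ->].
    + apply Hb; [left; now exists n|assumption|discriminate].
    + destruct (Hc Hinf Hinf eq_refl) as [H|[(i & Hi & _)|H]]; [now left| |now right].
      exfalso. revert Hi. unfold Rbar_mult; simpl.
      destruct (Rle_dec 0 2) as [r|r]; [|lra].
      destruct (Rle_lt_or_eq_dec 0 2 r) as [_|E]; [now simpl|lra].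
Qed.
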